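(* Let $S_{m,n}$ be subsampled randomized Hadamard transform (SRHT) sketching matrices, and let $(X_n,y_n)$ be deterministic data with $\limsup_n\ell_{n,1}/\ell_{n,p}<\infty$. Let $U_{i:}$ be the $i$-th row of $U_n$. Consider $m,n\to\infty$ with $p$ fixed, $m/\log^2n\to\infty$ and, for $\gamma_n=m/n$, $\limsup\gamma_n<1$. If either $\lim_{n\to\infty}\max_{i=1,\dots,n}\|U_{i:}\|=0$ or $\lim_{n\to\infty}\max_{i=1,\dots,n}|\varepsilon_{n,i}|/\|\varepsilon_n\|=0$, then $$\big(m/(1-\gamma_n)\big)^{1/2}\|\tilde\varepsilon_{m,n}\|^{-1}(\tilde X_{m,n}^\top\tilde X_{m,n})^{1/2}(\hat\beta^{\mathrm s}_{m,n}-\beta_n)\Rightarrow\mathcal N(0,I_p).$$ If either $\lim_{n\to\infty}\max_{i=1,\dots,n}\|U_{i:}\|=0$ or $\lim_{n\to\infty}\max_{i=1,\dots,n}|y_{n,i}-\varepsilon_{n,i}|/\|y_n-\varepsilon_n\|=0$, then $$\big(m/(1-\gamma_n)\big)^{1/2}\Big(\|\tilde X_{m,n}\hat\beta^{\mathrm{pa}}_{m,n}\|^2(\tilde X_{m,n}^\top\tilde X_{m,n})^{-1}+2\hat\beta^{\mathrm{pa}}_{m,n}\hat\beta^{\mathrm{pa}\top}_{m,n}\Big)^{-1/2}(\hat\beta^{\mathrm{pa}}_{m,n}-\beta_n)\Rightarrow\mathcal N(0,I_p).$$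
   Context: $n=2^l$ ranges over powers of two. Hadamard matrices: $H_0=1$, $H_{t+1}=\frac1{\sqrt2}\begin{pmatrix}H_t&H_t\\H_t&-H_t\end{pmatrix}$. The SRHT sketching matrix is $S_{m,n}=\sqrt{n/m}\,BH_lD$, where $B$ is an $n\times n$ diagonal matrix with i.i.d. Bernoulli$(m/n)$ diagonal entries and $D$ is an independent $n\times n$ diagonal matrix with i.i.d. Rademacher diagonal entries. $X_n$ is $n\times p$ of full column rank with SVD $X_n=U_nL_nV_n^\top$ ($U_n$ is $n\times p$ with orthonormal columns, $L_n=\mathrm{diag}(\ell_{n,1},\dots,\ell_{n,p})$, $\ell_{n,1}\ge\dots\ge\ell_{n,p}>0$, $V_n$ orthogonal), $y_n\in\mathbb R^n$, $\beta_n=(X_n^\top X_n)^{-1}X_n^\top y_n$, $\varepsilon_n=y_n-X_n\beta_n$; $\varepsilon_n\ne0$ is assumed for the first claim and $X_n\beta_n\ne0$ for the second. $\tilde X_{m,n}=S_{m,n}X_n$, $\tilde y_{m,n}=S_{m,n}y_n$, $\hat\beta^{\mathrm s}_{m,n}=(\tilde X_{m,n}^\top\tilde X_{m,n})^{-1}\tilde X_{m,n}^\top\tilde y_{m,n}$, $\hat\beta^{\mathrm{pa}}_{m,n}=(\tilde X_{m,n}^\top\tilde X_{m,n})^{-1}X_n^\top y_n$, $\tilde\varepsilon_{m,n}=\tilde y_{m,n}-\tilde X_{m,n}\hat\beta^{\mathrm s}_{m,n}$ (arbitrary when the inverse does not exist). *)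

(* Defs.v *)
From HB Require Import structures.
From mathcomp Require Import all_boot all_order all_algebra.
From mathcomp Require Import all_classical all_reals all_analysis.

Set Implicit Arguments.
Unset Strict Implicit.
Unset Printing Implicit Defensive.

Import Order.TTheory GRing.Theory Num.Theory.
Import numFieldNormedType.Exports.

Local Open Scope classical_set_scope.
Local Open Scope ring_scope.

Section LinearAlgebra.
Context {R : realType}.

(* The library norm on matrices is the sup norm; this is the Euclidean one. *)
Definition enorm m n (A : 'M[R]_(m, n)) : R :=
  Num.sqrt (\sum_i \sum_j A i j ^+ 2).

Definition psdmx n (A : 'M[R]_n) : Prop :=
  A^T = A /\ forall v : 'cV[R]_n, 0 <= (v^T *m A *m v) 0 0.

(* A ^ (1/2): the (unique) positive semidefinite square root of A; the default
   value 0 is only used when A is not positive semidefinite. *)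
Definition sqrtmx n (A : 'M[R]_n) : 'M[R]_n :=
  xget 0 [set B | psdmx B /\ B *m B = A].

Definition is_svd n p (X U : 'M[R]_(n, p)) (L : 'rV[R]_p) (V : 'M[R]_p) : Prop :=
  [/\ X = U *m diag_mx L *m V^T,
      U^T *m U = 1%:M,
      V^T *m V = 1%:M,
      (forall i j : 'I_p, (i <= j)%N -> L 0 j <= L 0 i) &
      (forall i, 0 < L 0 i)].

Definition gram n p (X : 'M[R]_(n, p)) : 'M[R]_p := X^T *m X.

Definition ols n p (X : 'M[R]_(n, p)) (y : 'cV[R]_n) : 'cV[R]_p :=
  invmx (gram X) *m X^T *m y.

Definition residual n p (X : 'M[R]_(n, p)) (y : 'cV[R]_n) (b : 'cV[R]_p) :
  'cV[R]_n := y - X *m b.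

Definition partial_ols n p (S : 'M[R]_n) (X : 'M[R]_(n, p)) (y : 'cV[R]_n) :
  'cV[R]_p := invmx (gram (S *m X)) *m X^T *m y.

(* The studentized estimation errors; b stands for the sketched estimator. *)
Definition pivot_s (m : nat) n p (S : 'M[R]_n) (X : 'M[R]_(n, p))
    (y : 'cV[R]_n) (b : 'cV[R]_p) : 'cV[R]_p :=
  Num.sqrt (m%:R / (1 - m%:R / n%:R)) *:
    ((enorm (residual (S *m X) (S *m y) b))^-1 *:
       (sqrtmx (gram (S *m X)) *m (b - ols X y))).

Definition pivot_pa (m : nat) n p (S : 'M[R]_n) (X : 'M[R]_(n, p))
    (y : 'cV[R]_n) (b : 'cV[R]_p) : 'cV[R]_p :=
  Num.sqrt (m%:R / (1 - m%:R / n%:R)) *: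
    (invmx (sqrtmx (enorm (S *m X *m b) ^+ 2 *: invmx (gram (S *m X))
                    + 2 *: (b *m b^T))) *m (b - ols X y)).

End LinearAlgebra.

Section SRHT.
Context {R : realType}.

Lemma double_expn2 t : (2 ^ t + 2 ^ t = 2 ^ t.+1)%N.
Proof. by rewrite addnn -mul2n expnS. Qed.

Fixpoint hadamard (t : nat) : 'M[R]_(2 ^ t) :=
  match t with
  | 0 => 1%:M
  | t'.+1 =>
      castmx (double_expn2 t', double_expn2 t')
        ((Num.sqrt 2)^-1 *: block_mx (hadamard t') (hadamard t')
                                     (hadamard t') (- hadamard t'))
  end.

(* The outcome s i of a fair coin encodes the Rademacher sign (-1) ^+ s i. *)
Definition srht (m l : nat) (b s : 'I_(2 ^ l) -> bool) : 'M[R]_(2 ^ l) :=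
  Num.sqrt ((2 ^ l)%N%:R / m%:R) *:
    (diag_mx (\row_i (b i)%:R) *m hadamard l *m diag_mx (\row_i (-1) ^+ s i)).

Definition mutually_independent d (T : measurableType d) (P : probability T R)
    d' (T' : measurableType d') (I : finType) (X : I -> {RV P >-> T'}) : Prop :=
  forall (J : {set I}) (A : I -> set T'), (forall i, measurable (A i)) ->
    P (\bigcap_(i in [set` J]) X i @^-1` A i) =
    (\prod_(i in J) P (X i @^-1` A i))%E.

Definition srht_law d (T : measurableType d) (P : probability T R) (m l : nat)
    (b s : 'I_(2 ^ l) -> {RV P >-> bool}) : Prop :=
  [/\ forall i A, distribution P (b i) A =
                  bernoulli_prob (m%:R / (2 ^ l)%N%:R) A,
      forall i A, distribution P (s i) A = bernoulli_prob (2^-1) A &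
      mutually_independent
        (fun u : 'I_(2 ^ l) + 'I_(2 ^ l) =>
           match u with inl i => b i | inr i => s i end)].

End SRHT.

Section WeakConvergence.
Variable R : realType.

Definition consT n (x : measurableTypeR R * n.-tuple (measurableTypeR R)) :
    n.+1.-tuple (measurableTypeR R) := [tuple of x.1 :: x.2].

Lemma measurable_consT n : measurable_fun setT (@consT n).
Proof. exact: measurable_cons. Qed.

HB.instance Definition _ n :=
  isMeasurableFun.Build _ _ _ _ (@consT n) (@measurable_consT n).

(* N(0, I_p) on p-tuples, as the p-fold product of N(0, 1). *)
Fixpoint std_normal (p : nat) : probability (p.-tuple (measurableTypeR R)) R :=
  match p with
  | 0 => \d_[tuple]
  | p'.+1 => distribution (normal_prob 0 1 \x std_normal p')%E (@consT p')
  end.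

(* Convergence in distribution of the random vectors Z k, possibly defined on
   different probability spaces, to the law mu. *)
Definition cvg_in_law p (d : nat -> measure_display)
    (T : forall k, measurableType (d k)) (P : forall k, probability (T k) R)
    (Z : forall k, T k -> 'cV[R]_p)
    (mu : probability (p.-tuple (measurableTypeR R)) R) : Prop :=
  forall f : 'cV[R]_p -> R, continuous f -> bounded_fun f ->
    ('E_(P k)[fun w => f (Z k w)] @[k --> \oo] -->
     'E_mu[fun t => f (\col_i tnth t i)])%E.

End WeakConvergence.

(* Main.v *)
Require Import Defs.
From HB Require Import structures.
From mathcomp Require Import all_boot all_order all_algebra.
From mathcomp Require Import all_classical all_reals all_analysis.
From mathcomp Require Import measurable_realfun ring lra.

Set Implicit Arguments.
Unset Strict Implicit.
Unset Printing Implicit Defensive.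

Import Order.TTheory GRing.Theory Num.Theory.
Import numFieldNormedType.Exports.

Local Open Scope classical_set_scope.
Local Open Scope ring_scope.

(** Write the design in polar form [X = U K]: the frame [U] has orthonormal columns, and
    rows of the same length as those of the left singular vectors, and [K] is symmetric
    positive definite of bounded condition number. Let [E = S^T S - 1] be the error of
    the sketch.

    Least squares algebra shows that each of the two studentized errors is a matrix
    close to the identity times [sqrt (m / (1 - m / n)) Phi^T E c], for deterministic
    [Phi] and a unit vector [c] with [Phi^T Phi + 2 (Phi^T c) (Phi^T c)^T = 1]
    ([pivot_s_near], [pivot_pa_near]). For the sketched least squares estimator, [c]
    is the direction of the residual and [Phi] is [U]; for the partial estimator, [c]
    is opposite to the direction of the fitted vector, and [Phi] is [U] corrected by
    the inverse square root of the limiting covariance. The matrix factor is close to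
    the identity because the square root of positive matrices is Lipschitz away from
    singular ones ([sqrt_lipschitz]) and because the entries [a^T E c] have second
    moments of order [1 / m] ([ip_error_moment2]).

    For [a = Phi t], the number [a^T E c] is [1 / m] times the sum over [i] of
    [(b_i - m / n) w_i], where [w_i] is the product of the [i]-th coordinates of
    [sqrt n H D a] and [sqrt n H D c]. Given the signs in [D] this is a sum of
    independent centred terms, so that its characteristic function is Gaussian up to a
    Lindeberg error ([bernoulli_cos]), and its normalised variance is the average of the
    [w_i ^+ 2]. As a polynomial in the signs, this average is
    [|a|^2 |c|^2 + 2 (a, c)^2 - 2 sum a_j^2 c_j^2] plus a homogeneous chaos of degree
    four. The squared correlations of four columns of a Hadamard matrix sum to one over
    any of the four indices, so the chaos is small as soon as one of the two vectors has
    only small coordinates ([fourth_concentrates]). That is why flatness of either the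
    frame or [c] suffices. The variance then tends to [|a|^2 + 2 (a, c)^2 = |t|^2], which
    gives the limit of the characteristic functions ([sketch_clt]).

    The passage to bounded continuous functions goes through trigonometric polynomials
    ([trig_approx]) and the characteristic function of the Gaussian law
    ([cos_std_normal]); with tightness they give convergence in law ([cvg_mean_normal]),
    which the factors close to the identity do not affect ([cvg_mean_slutsky]). A sketch
    takes finitely many values, so all expectations before the limit are finite sums
    ([expectation_srht]). *)

(** * Finite products of Bernoulli laws *)

Section FiniteBernoulli.
Context {R : realType} {I : finType}.
Implicit Types (q : I -> R) (F G : {ffun I -> bool} -> R).

Definition bweight q (x : {ffun I -> bool}) : R :=
  \prod_i (if x i then q i else 1 - q i).

(** Expectation of a function of independent Bernoulli variables of parameters [q i]. *)
Definition bexp q F : R := \sum_x bweight q x * F x.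

Lemma bexp_prod q (g : I -> bool -> R) :
  bexp q (fun x => \prod_i g i (x i)) =
  \prod_i (q i * g i true + (1 - q i) * g i false).
Proof.
rewrite /bexp /bweight.
transitivity (\sum_(x : {ffun I -> bool})
    \prod_i ((if x i then q i else 1 - q i) * g i (x i))).
  by apply: eq_bigr => x _; rewrite -big_split.
rewrite -(bigA_distr_bigA (fun i b => (if b then q i else 1 - q i) * g i b)).
by apply: eq_bigr => i _; rewrite big_bool.
Qed.

Lemma bexp_cst q c : bexp q (fun=> c) = c.
Proof.
rewrite /bexp -mulr_suml.
have -> : \sum_x bweight q x = bexp q (fun x => \prod_(i : I) 1).
  by apply: eq_bigr => x _; rewrite big1 ?mulr1.
by rewrite (bexp_prod q (fun _ _ => 1)) big1 ?mul1r// => i _; ring.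
Qed.

Lemma eq_bexp q F G : F =1 G -> bexp q F = bexp q G.
Proof. by move=> FG; apply: eq_bigr => x _; rewrite FG. Qed.

Lemma bexpD q F G : bexp q (fun x => F x + G x) = bexp q F + bexp q G.
Proof. by rewrite /bexp -big_split; apply: eq_bigr => x _; rewrite mulrDr. Qed.

Lemma bexpZ q c F : bexp q (fun x => c * F x) = c * bexp q F.
Proof. by rewrite /bexp mulr_sumr; apply: eq_bigr => x _; rewrite mulrCA. Qed.

Lemma bexpB q F G : bexp q (fun x => F x - G x) = bexp q F - bexp q G.
Proof. by rewrite /bexp -sumrB; apply: eq_bigr => x _; rewrite mulrBr. Qed.

Lemma bexp_sum q (J : Type) (r : seq J) (P : pred J)
    (F : J -> {ffun I -> bool} -> R) :
  bexp q (fun x => \sum_(j <- r | P j) F j x) =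
  \sum_(j <- r | P j) bexp q (F j).
Proof.
by rewrite /bexp exchange_big; apply: eq_bigr => x _; rewrite mulr_sumr.
Qed.

Section Monotonicity.
Context {q : I -> R} (q01 : forall i, 0 <= q i <= 1).

Lemma bweight_ge0 x : 0 <= bweight q x.
Proof.
apply: prodr_ge0 => i _; have /andP[? ?] := q01 i.
by case: ifP => _; rewrite // subr_ge0.
Qed.

Lemma ler_bexp F G : (forall x, F x <= G x) -> bexp q F <= bexp q G.
Proof. by move=> FG; apply: ler_sum => x _; rewrite ler_wpM2l// bweight_ge0. Qed.

Lemma bexp_ge0 F : (forall x, 0 <= F x) -> 0 <= bexp q F.
Proof. by move=> F0; apply: sumr_ge0 => x _; rewrite mulr_ge0// bweight_ge0. Qed.

Lemma ler_norm_bexp F : `|bexp q F| <= bexp q (fun x => `|F x|).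
Proof.
apply: (le_trans (ler_norm_sum _ _ _)); apply: ler_sum => x _.
by rewrite normrM ger0_norm// bweight_ge0.
Qed.

Lemma bexp_le_cst F c : (forall x, F x <= c) -> bexp q F <= c.
Proof. by move=> Fc; rewrite -[leRHS](bexp_cst q); apply: ler_bexp. Qed.

(** Nonnegativity of the variance. *)
Lemma sqr_bexp F : bexp q F ^+ 2 <= bexp q (fun x => F x ^+ 2).
Proof.
have : 0 <= bexp q (fun x => (F x - bexp q F) ^+ 2).
  by apply: bexp_ge0 => x; exact: sqr_ge0.
rewrite (eq_bexp q (G := fun x =>
  F x ^+ 2 - (2 * bexp q F) * F x + bexp q F ^+ 2)); last by move=> x; ring.
rewrite bexpD bexpB bexpZ bexp_cst; nra.
Qed.

End Monotonicity.

Definition flip (i : I) (x : {ffun I -> bool}) : {ffun I -> bool} :=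
  [ffun j => if j == i then ~~ x j else x j].

Lemma flipK i : involutive (flip i).
Proof.
by move=> x; apply/ffunP => j; rewrite !ffunE; case: eqP => // _; rewrite negbK.
Qed.

(** Conditioning on one coordinate: the Boolean argument of [F] isolates the dependence
    on that coordinate, so that it can be averaged first. *)
Lemma bexp_cond q i (F : bool -> {ffun I -> bool} -> R) :
  (forall c x, F c (flip i x) = F c x) ->
  bexp q (fun x => F (x i) x) =
  bexp q (fun x => q i * F true x + (1 - q i) * F false x).
Proof.
move=> Fi; pose r (x : {ffun I -> bool}) :=
  \prod_(j | j != i) (if x j then q j else 1 - q j).
have wE x : bweight q x = (if x i then q i else 1 - q i) * r x.
  by rewrite /bweight (bigD1 i).
have rflip x : r (flip i x) = r x.
  by apply: eq_bigr => j /negPf ji; rewrite ffunE ji.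
(* a configuration with a true [i]-th bit is grouped with its flip, whose weight
   differs by that factor only *)
have pairing (H : {ffun I -> bool} -> R) :
    \sum_x H x = \sum_(x : {ffun I -> bool} | x i) (H x + H (flip i x)).
  rewrite (bigID (fun x : {ffun I -> bool} => x i))/= big_split/=; congr (_ + _).
  rewrite (reindex_inj (inv_inj (flipK i)))/=.
  by apply: eq_bigl => x; rewrite ffunE eqxx negbK.
rewrite /bexp [LHS]pairing [RHS]pairing; apply: eq_bigr => x xi.
rewrite !wE !rflip !Fi ffunE eqxx xi/=; ring.
Qed.

Definition sgn (b : bool) : R := (-1) ^+ b.

Lemma sgn_sqr b : sgn b * sgn b = 1.
Proof. by case: b; rewrite /sgn ?expr1 ?expr0; ring. Qed.

(** The Walsh function of [S]. *)
Definition chi (S : {set I}) (x : {ffun I -> bool}) : R :=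
  \prod_(i in S) sgn (x i).

Lemma bexp_chi (S : {set I}) :
  bexp (fun=> 2^-1) (chi S) = (S == finset.set0)%:R.
Proof.
rewrite (eq_bexp _ (G := fun x => \prod_i if i \in S then sgn (x i) else 1)); last first.
  by move=> x; rewrite /chi big_mkcond.
rewrite (bexp_prod _ (fun i b => if i \in S then sgn b else 1)).
have [->|/finset.set0Pn[i iS]] := eqVneq S finset.set0.
  rewrite big1// => i _; rewrite inE; lra.
rewrite (bigD1 i)//= iS /sgn expr1 expr0 (_ : _ + _ = 0) ?mul0r//; lra.
Qed.

Lemma chiM (S T : {set I}) x : chi S x * chi T x = chi ((S :\: T) :|: (T :\: S)) x.
Proof.
rewrite /chi !(big_mkcond (fun i => i \in _))/= -big_split/=.
apply: eq_bigr => i _; rewrite !inE.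
by case: (i \in S); case: (i \in T); rewrite /= ?mulr1 ?mul1r ?sgn_sqr.
Qed.

Lemma bexp_chi2 (S T : {set I}) :
  bexp (fun=> 2^-1) (fun x => chi S x * chi T x) = (S == T)%:R.
Proof.
rewrite (eq_bexp _ (chiM S T)) bexp_chi; congr (nat_of_bool _)%:R; apply/idP/idP.
  by rewrite finset.setU_eq0 !finset.setD_eq0 => /andP[? ?]; rewrite finset.eqEsubset; apply/andP.
by move=> /eqP ->; rewrite finset.setDv finset.setU0.
Qed.

(** Rademacher chaos: monomials attached to different sets are orthogonal, so
    the second moment is controlled by the coefficients, up to the largest
    number [N] of monomials attached to the same set. *)
Lemma chaos_moment2 (J : finType) (S : J -> {set I}) (c : J -> R) (N : nat) :
  (forall j, (#|[set k | S k == S j]%SET| <= N)%N) ->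
  bexp (fun=> 2^-1) (fun x => (\sum_j c j * chi (S j) x) ^+ 2) <=
  N%:R * \sum_j c j ^+ 2.
Proof.
move=> SN.
rewrite (eq_bexp _ (G := fun x => \sum_j \sum_k (c j * c k) *
    (chi (S j) x * chi (S k) x))); last first.
  move=> x; rewrite expr2 mulr_suml; apply: eq_bigr => j _.
  by rewrite mulr_sumr; apply: eq_bigr => k _; ring.
rewrite bexp_sum.
apply: (@le_trans _ _ (\sum_j \sum_k
   ((S k == S j)%:R * (c j ^+ 2 / 2) + (S k == S j)%:R * (c k ^+ 2 / 2)))).
  apply: ler_sum => j _; rewrite bexp_sum; apply: ler_sum => k _.
  rewrite bexpZ bexp_chi2 eq_sym; case: eqP => _; last by rewrite mulr0 !mul0r addr0.
  rewrite mulr1 !mul1r; have := sqr_ge0 (c j - c k); nra.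
under eq_bigr do rewrite big_split/=.
rewrite big_split/= [X in _ + X]exchange_big/=.
rewrite -[N%:R * _]/(N%:R * _) mulr_sumr -big_split/=; apply: ler_sum => j _.
have cardE : \sum_k (S k == S j)%:R = #|[set k | S k == S j]%SET|%:R :> R.
  by rewrite -sum1dep_card natr_sum [RHS]big_mkcond/=; apply: eq_bigr => k _; case: eqP.
under [X in _ + X]eq_bigr do rewrite eq_sym.
rewrite -!mulr_suml cardE -mulrDr (_ : c j ^+ 2 / 2 + c j ^+ 2 / 2 = c j ^+ 2); last lra.
by rewrite ler_wpM2r ?sqr_ge0// ler_nat.
Qed.

End FiniteBernoulli.

(** * Elementary inequalities *)

Section RealInequalities.
Context {R : realType}.
Implicit Types x y : R.

(** Used repeatedly, this gives the Taylor bounds for [sin] and [cos], each from the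
    previous one. *)
Lemma ge0_of_derive (f df : R -> R) :
  (forall x : R, is_derive x 1 f (df x)) -> 0 <= f 0 ->
  (forall x, 0 <= x -> 0 <= df x) -> forall x, 0 <= x -> 0 <= f x.
Proof.
move=> fE f0 df0 x x0; apply: (le_trans f0).
apply: (@ger0_derive1_ndecry _ f 0) => //.
- move=> z; rewrite in_itv/= andbT => z0; rewrite derive1E.
  by have [_ ->] := fE z; rewrite df0// ltW.
- apply: continuous_subspaceT => z; apply: differentiable_continuous.
  by apply/derivable1_diffP; have [? _] := fE z.
Qed.

Lemma ler_sin x : 0 <= x -> sin x <= x.
Proof.
move=> x0; rewrite -subr_ge0.
apply: (@ge0_of_derive (fun z => z - sin z) (fun z => 1 - cos z)) => //.
  by rewrite sin0 subrr.
Qed.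

Lemma cos_ge x : 0 <= x -> 1 - x ^+ 2 / 2 <= cos x.
Proof.
move=> x0; rewrite -subr_ge0.
apply: (@ge0_of_derive (fun z => cos z - (1 - z ^+ 2 / 2)) (fun z => z - sin z)) => //.
- move=> z; apply: is_derive_eq; rewrite /GRing.scale/=; lra.
- by rewrite cos0 expr0n/=; lra.
- by move=> z z0; rewrite subr_ge0 ler_sin.
Qed.

Lemma sin_ge x : 0 <= x -> x - x ^+ 3 / 6 <= sin x.
Proof.
move=> x0; rewrite -subr_ge0.
apply: (@ge0_of_derive (fun z => sin z - (z - z ^+ 3 / 6))
  (fun z => cos z - (1 - z ^+ 2 / 2))) => //.
- move=> z; apply: is_derive_eq; rewrite /GRing.scale/=; lra.
- by rewrite sin0 expr0n/=; lra.
- by move=> z z0; rewrite subr_ge0 cos_ge.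
Qed.

Lemma cos_le x : 0 <= x -> cos x <= 1 - x ^+ 2 / 2 + x ^+ 4 / 24.
Proof.
move=> x0; rewrite -subr_ge0.
apply: (@ge0_of_derive (fun z => (1 - z ^+ 2 / 2 + z ^+ 4 / 24) - cos z)
  (fun z => sin z - (z - z ^+ 3 / 6))) => //.
- move=> z; apply: is_derive_eq; rewrite /GRing.scale/=; lra.
- by rewrite cos0 !expr0n/=; lra.
- by move=> z z0; rewrite subr_ge0 sin_ge.
Qed.

Lemma norm_sin_sub x : `|sin x - x| <= `|x| ^+ 3.
Proof.
wlog x0 : x / 0 <= x.
  move=> H; have [x0|/ltW x0] := leP 0 x; first exact: H.
  have := H (- x); rewrite oppr_ge0 => /(_ x0).
  by rewrite sinN -opprD !normrN.
rewrite (ger0_norm x0) ler_norml; have := ler_sin x0; have := sin_ge x0.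
have := exprn_ge0 3 x0; lra.
Qed.

Lemma norm_cos_sub x : `|cos x - (1 - x ^+ 2 / 2)| <= x ^+ 4.
Proof.
wlog x0 : x / 0 <= x.
  move=> H; have [x0|/ltW x0] := leP 0 x; first exact: H.
  have := H (- x); rewrite oppr_ge0 => /(_ x0).
  by rewrite cosN sqrrN (_ : (- x) ^+ 4 = x ^+ 4); last ring.
rewrite ler_norml; have := cos_le x0; have := cos_ge x0.
have := exprn_ge0 4 x0; lra.
Qed.

Lemma norm_expRN_sub x : 0 <= x -> `|expR (- x) - (1 - x)| <= x ^+ 2.
Proof.
move=> x0; rewrite ger0_norm; last first.
  by rewrite subr_ge0; have := expR_ge1Dx (- x).
have e1 : expR (- x) * (1 + x) <= 1.
  by rewrite -[leRHS](expRxMexpNx_1 x) mulrC ler_wpM2r ?expR_ge0// expR_ge1Dx.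
suff : expR (- x) <= 1 - x + x ^+ 2 by lra.
have : (1 + x) * expR (- x) <= (1 + x) * (1 - x + x ^+ 2).
  apply: (@le_trans _ _ 1); first by rewrite mulrC.
  rewrite (_ : _ * _ = 1 + x ^+ 3); last ring.
  by rewrite lerDl exprn_ge0.
by rewrite ler_pM2l//; lra.
Qed.

Lemma expRN_lip x y : 0 <= x -> 0 <= y ->
  `|expR (- x) - expR (- y)| <= `|x - y|.
Proof.
wlog xy : x y / x <= y.
  move=> H x0 y0; have [xy|/ltW yx] := leP x y; first exact: H.
  by rewrite distrC (distrC x); apply: H.
move=> x0 y0; rewrite ger0_norm ?subr_ge0 ?ler_expR ?lerN2//.
rewrite distrC ger0_norm ?subr_ge0//.
have -> : expR (- x) - expR (- y) = expR (- x) * (1 - expR (x - y)).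
  by rewrite mulrBr mulr1 -expRD; congr (_ - expR _); ring.
apply: (@le_trans _ _ (1 * (1 - expR (x - y)))).
  apply: ler_wpM2r; first by rewrite subr_ge0 -expR0 ler_expR; lra.
  by rewrite -expR0 ler_expR; lra.
by rewrite mul1r; have := expR_ge1Dx (x - y); lra.
Qed.

(** The inequality [x / 8 <= expR (x / 8)] raised to the eighth power. *)
Lemma expr8_le_exp x : x ^+ 8 <= 8 ^+ 8 * (expR x + expR (- x)).
Proof.
wlog x0 : x / 0 <= x.
  move=> H; have [x0|/ltW x0] := leP 0 x; first exact: H.
  have := H (- x); rewrite opprK addrC oppr_ge0 (_ : (- x) ^+ 8 = x ^+ 8); last ring.
  exact.
apply: (@le_trans _ _ (8 ^+ 8 * expR x)); last first.
  by rewrite ler_wpM2l ?exprn_ge0// lerDl expR_ge0.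
have -> : x = 8 * (x / 8) by field.
rewrite exprMn ler_wpM2l ?exprn_ge0// expRM_natl lerXn2r ?nnegrE ?expR_ge0//; first lra.
by have := expR_ge1Dx (x / 8); lra.
Qed.

(** By [expR z <= (1 - z)^-1] the left-hand side is at most [(1 - x ^+ 2)^-1]. *)
Lemma cosh_le x : x ^+ 2 <= 2^-1 ->
  (expR x + expR (- x)) / 2 <= expR (2 * x ^+ 2).
Proof.
move=> x2.
have inv (z : R) : z < 1 -> expR z <= (1 - z)^-1.
  move=> z1; rewrite -[expR z]invrK lef_pV2 ?posrE ?invr_gt0 ?expR_gt0 ?subr_gt0//.
  by rewrite -expRN expR_ge1Dx.
have [x1 x1'] : x < 1 /\ - x < 1 by split; nra.
have ltx : 0 < 1 - x ^+ 2 by lra.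
apply: (@le_trans _ _ (1 - x ^+ 2)^-1).
  apply: (@le_trans _ _ (((1 - x)^-1 + (1 - - x)^-1) / 2)).
    by have := inv _ x1; have := inv _ x1'; lra.
  by rewrite le_eqVlt; apply/orP; left; apply/eqP; field; rewrite !gt_eqF//; lra.
rewrite -[leRHS]invrK lef_pV2 ?posrE ?invr_gt0 ?expR_gt0//.
have := expR_ge1Dx (2 * x ^+ 2); set e := expR _ => e1.
rewrite -(ler_pM2r (x := e)) ?expR_gt0// mulVf ?gt_eqF ?expR_gt0//.
have := sqr_ge0 x; nra.
Qed.

End RealInequalities.

(** * The Frobenius norm *)

Section Frobenius.
Context {R : realType}.

(** From Lagrange's identity. *)
Lemma cauchy_schwarz_sum (I : finType) (x y : I -> R) :
  (\sum_i x i * y i) ^+ 2 <= (\sum_i x i ^+ 2) * (\sum_i y i ^+ 2).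
Proof.
have : 0 <= \sum_i \sum_j (x i * y j - x j * y i) ^+ 2.
  by do 2 apply: sumr_ge0 => ? _; exact: sqr_ge0.
have -> : \sum_i \sum_j (x i * y j - x j * y i) ^+ 2 =
    2 * ((\sum_i x i ^+ 2) * (\sum_i y i ^+ 2)) - 2 * (\sum_i x i * y i) ^+ 2.
  have e1 : (\sum_i x i ^+ 2) * (\sum_i y i ^+ 2) =
      \sum_i \sum_j x i ^+ 2 * y j ^+ 2.
    by rewrite mulr_suml; apply: eq_bigr => i _; rewrite mulr_sumr.
  have e2 : (\sum_i x i * y i) ^+ 2 = \sum_i \sum_j (x i * y i) * (x j * y j).
    by rewrite expr2 mulr_suml; apply: eq_bigr => i _; rewrite mulr_sumr.
  have e3 : \sum_i \sum_j x i ^+ 2 * y j ^+ 2 = \sum_i \sum_j x j ^+ 2 * y i ^+ 2.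
    by rewrite exchange_big.
  rewrite e1 e2 mulr2n mulrDl mul1r {2}e3 -big_split/= !mulr_sumr -sumrB.
  apply: eq_bigr => i _; rewrite -big_split/= !mulr_sumr -sumrB.
  by apply: eq_bigr => j _; ring.
lra.
Qed.

Section Norm.
Context {m n : nat}.
Implicit Types A B : 'M[R]_(m, n).

Lemma sum_sqr_ge0 A : 0 <= \sum_i \sum_j A i j ^+ 2.
Proof. by do 2 apply: sumr_ge0 => ? _; exact: sqr_ge0. Qed.

Lemma sqr_enorm A : enorm A ^+ 2 = \sum_i \sum_j A i j ^+ 2.
Proof. by rewrite sqr_sqrtr// sum_sqr_ge0. Qed.

Lemma enorm_ge0 A : 0 <= enorm A.
Proof. exact: sqrtr_ge0. Qed.

Lemma tr_mulTmx A B : \tr (A^T *m B) = \sum_i \sum_j A i j * B i j.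
Proof.
rewrite /mxtrace exchange_big; apply: eq_bigr => j _; rewrite mxE.
by apply: eq_bigr => i _; rewrite mxE.
Qed.

Lemma sqr_enormE A : enorm A ^+ 2 = \tr (A^T *m A).
Proof. by rewrite sqr_enorm tr_mulTmx. Qed.

Lemma tr_mulTmx_le A B : `|\tr (A^T *m B)| <= enorm A * enorm B.
Proof.
rewrite -ler_sqr ?nnegrE ?mulr_ge0 ?enorm_ge0// real_normK ?num_real//.
rewrite exprMn !sqr_enorm tr_mulTmx !pair_big/=; exact: cauchy_schwarz_sum.
Qed.

Lemma enormD A B : enorm (A + B) <= enorm A + enorm B.
Proof.
rewrite -ler_sqr ?nnegrE ?addr_ge0 ?enorm_ge0// sqr_enormE.
rewrite [(A + B)^T]linearD/= mulmxDl !mulmxDr !raddfD/= -!sqr_enormE.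
rewrite -[\tr (B^T *m A)]mxtrace_tr trmx_mul trmxK.
by have := ler_norm (\tr (A^T *m B)); have := tr_mulTmx_le A B; nra.
Qed.

Lemma enormZ (a : R) A : enorm (a *: A) = `|a| * enorm A.
Proof.
apply: (@pexpIrn _ 2) => //; rewrite ?nnegrE ?mulr_ge0 ?enorm_ge0//.
rewrite exprMn real_normK ?num_real// !sqr_enorm mulr_sumr.
apply: eq_bigr => i _; rewrite mulr_sumr; apply: eq_bigr => j _.
by rewrite mxE exprMn.
Qed.

Lemma enormN A : enorm (- A) = enorm A.
Proof. by rewrite -scaleN1r enormZ normrN1 mul1r. Qed.

Lemma enorm0 : enorm (0 : 'M[R]_(m, n)) = 0.
Proof. by rewrite -(scale0r (0 : 'M[R]_(m, n))) enormZ normr0 mul0r. Qed.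

Lemma entry_le_enorm A i j : `|A i j| <= enorm A.
Proof.
rewrite -ler_sqr ?nnegrE ?enorm_ge0// real_normK ?num_real// sqr_enorm.
rewrite (bigD1 i)//= (bigD1 j)//= -addrA lerDl addr_ge0// sumr_ge0// => *.
  exact: sqr_ge0.
by apply: sumr_ge0 => *; exact: sqr_ge0.
Qed.

Lemma enorm_eq0 A : (enorm A == 0) = (A == 0).
Proof.
apply/eqP/eqP => [A0|->]; last exact: enorm0.
apply/matrixP => i j; rewrite mxE; apply/eqP; rewrite -normr_le0 -A0.
exact: entry_le_enorm.
Qed.

Lemma enorm_le_entries A (d : R) : (forall i j, `|A i j| <= d) ->
  enorm A <= (m * n)%:R * d.
Proof.
move=> Ad.
have [->|A0] := eqVneq A 0.
  rewrite enorm0; have [/eqP->|] := boolP (m * n == 0)%N; first by rewrite mul0r.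
  case: m n A Ad => [//|m'] [|n'] A Ad; first by rewrite muln0.
  by move=> _; rewrite mulr_ge0//; apply: (le_trans _ (Ad ord0 ord0)).
have [i [j Aij]] : exists i j, A i j != 0.
  apply/not_existsP => H; move/eqP: A0; apply; apply/matrixP => i j.
  rewrite mxE; apply/eqP/negPn/negP => Aij; apply: (H i); by exists j.
have d0 : 0 <= d by apply: (le_trans _ (Ad i j)).
have mn0 : (1 <= m * n)%N.
  by rewrite muln_gt0 (leq_trans _ (ltn_ord i))// (leq_trans _ (ltn_ord j)).
rewrite -ler_sqr ?nnegrE ?enorm_ge0 ?mulr_ge0// sqr_enorm.
apply: (@le_trans _ _ (\sum_(i < m) \sum_(j < n) d ^+ 2)).
  apply: ler_sum => k _; apply: ler_sum => l _.
  by rewrite -[leLHS]real_normK ?num_real// ler_sqr ?nnegrE.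
rewrite !sumr_const !card_ord -mulrnA mulnC exprMn -[_ *+ _]mulr_natl.
rewrite ler_wpM2r ?sqr_ge0// -natrX ler_nat.
by rewrite -mulnn leq_pmulr.
Qed.

End Norm.

Lemma enorm_trmx m n (A : 'M[R]_(m, n)) : enorm A^T = enorm A.
Proof.
rewrite /enorm exchange_big; congr Num.sqrt.
by apply: eq_bigr => i _; apply: eq_bigr => j _; rewrite mxE.
Qed.

Lemma enormM m n k (A : 'M[R]_(m, n)) (B : 'M[R]_(n, k)) :
  enorm (A *m B) <= enorm A * enorm B.
Proof.
rewrite -ler_sqr ?nnegrE ?mulr_ge0 ?enorm_ge0// exprMn !sqr_enorm.
apply: (@le_trans _ _ (\sum_i \sum_j (\sum_l A i l ^+ 2) * (\sum_l B l j ^+ 2))).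
  apply: ler_sum => i _; apply: ler_sum => j _; rewrite mxE.
  exact: cauchy_schwarz_sum.
rewrite [X in _ * X]exchange_big/= mulr_suml; apply: ler_sum => i _.
by rewrite mulr_sumr.
Qed.

Lemma enorm1 n : enorm (1%:M : 'M[R]_n) = Num.sqrt n%:R.
Proof.
congr Num.sqrt; rewrite (eq_bigr (fun=> 1)) ?sumr_const ?card_ord// => i _.
rewrite (bigD1 i)//= !mxE eqxx expr1n big1 ?addr0// => j ji.
by rewrite mxE eq_sym (negbTE ji) expr0n.
Qed.

(** A perturbation of the identity that is small in norm is invertible, since
    a vector in its kernel would be shorter than itself. *)
Lemma unitmx_near1 n (N : 'M[R]_n) : enorm (N - 1%:M) < 1 -> N \in unitmx.
Proof.
move=> N1; rewrite -row_free_unit; apply/row_freeP.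
have kN : kermx N = 0.
  apply/eqP; rewrite -enorm_eq0; apply/negPn/negP => k0.
  have e : kermx N = kermx N *m (1%:M - N).
    by rewrite mulmxBr mulmx1 mulmx_ker subr0.
  have := enormM (kermx N) (1%:M - N); rewrite -e -opprB enormN.
  rewrite -[leLHS]mulr1 ler_pM2l; first by rewrite leNgt N1.
  by rewrite lt_neqAle eq_sym k0 enorm_ge0.
exists (pinvmx N); rewrite mulmxVp//.
by rewrite -kermx_eq0 kN.
Qed.

(** Since [N^-1 - 1 = (1 - N) + (1 - N) (N^-1 - 1)]. *)
Lemma invmx_near1 n (N : 'M[R]_n) (d : R) : enorm (N - 1%:M) <= d -> d <= 2^-1 ->
  enorm (invmx N - 1%:M) <= 2 * d.
Proof.
move=> N1 d1; have uN : N \in unitmx by apply: unitmx_near1; lra.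
have e : invmx N - 1%:M = (1%:M - N) + (1%:M - N) *m (invmx N - 1%:M).
  by rewrite mulmxBr mulmx1 [RHS]addrC subrK mulmxBl mul1mx mulmxV.
have : enorm (invmx N - 1%:M) <= d + d * enorm (invmx N - 1%:M).
  have dN : enorm (1%:M - N) <= d by rewrite -opprB enormN.
  rewrite {1}e (le_trans (enormD _ _))// lerD// (le_trans (enormM _ _))//.
  by rewrite ler_wpM2r ?enorm_ge0.
have := enorm_ge0 (invmx N - 1%:M); nra.
Qed.

End Frobenius.

(** * Real symmetric matrices *)

Section RealSpectral.
Context {R : realType}.

Lemma continuous_sum (T : topologicalType) (I : finType) (P : pred I)
    (F : I -> T -> R) :
  (forall i, P i -> continuous (F i)) ->
  continuous (fun x => \sum_(i | P i) F i x).
Proof.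
move=> cF; apply: (@continuous_big R^o _ +%R 0 P) => // x.
exact: add_continuous.
Qed.

Lemma continuous_mul (T : topologicalType) (f g : T -> R) :
  continuous f -> continuous g -> continuous (fun x => f x * g x).
Proof. by move=> cf cg x; apply: continuousM; [exact: cf|exact: cg]. Qed.

Section Orthogonal.
Context {n : nat}.
Implicit Types Q : 'M[R]_n.

Lemma continuous_mxvec_entry (i j : 'I_n) :
  continuous (fun v : 'rV[R]_(n * n) => vec_mx v i j).
Proof.
rewrite (_ : (fun v : 'rV[R]_(n * n) => vec_mx v i j) =
    (fun v => v ord0 (mxvec_index i j))); first exact: coord_continuous.
by apply/funext => v; rewrite mxE.
Qed.

(** Orthogonal matrices, encoded as row vectors: closed bounded sets of row vectors are
    compact and the extreme value theorem applies to them. *)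
Let orth_vec : set 'rV[R]_(n * n) :=
  [set v | vec_mx v *m (vec_mx v)^T = 1%:M].

Lemma orth_entry_le Q i j : Q *m Q^T = 1%:M -> `|Q i j| <= 1.
Proof.
move=> /matrixP/(_ i i); rewrite !mxE eqxx => Q1.
rewrite -(@ler_pXn2r _ 2) ?nnegrE// expr1n real_normK ?num_real//.
rewrite -[leRHS]Q1 (bigD1 j)//= !mxE -expr2 lerDl sumr_ge0// => k _.
by rewrite mxE -expr2 sqr_ge0.
Qed.

Lemma compact_orth_vec : compact orth_vec.
Proof.
apply: bounded_closed_compact.
  exists 1; split; first exact: num_real.
  move=> M M1 v /= vQ; rewrite [leLHS]mx_normrE.
  apply: bigmax_le; first lra.
  move=> -[i k] _ /=; rewrite (ord1 i); case/mxvec_indexP: k => i1 j1.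
  apply: (@le_trans _ _ 1); last lra.
  by have := orth_entry_le i1 j1 vQ; rewrite mxE.
have -> : orth_vec = \bigcap_(ij in [set: 'I_n * 'I_n])
    ((fun v => \sum_k vec_mx v ij.1 k * vec_mx v ij.2 k) @^-1`
       [set x | x = (1%:M : 'M[R]_n) ij.1 ij.2]).
  apply/seteqP; split => [v /= vQ ij _/=|v /= H].
    by rewrite -vQ !mxE; apply: eq_bigr => k _; rewrite !mxE.
  apply/matrixP => i j; rewrite -(H (i, j) I)/= mxE.
  by apply: eq_bigr => k _; rewrite !mxE.
apply: closed_bigI => ij _; apply: preimage_closed; last exact: closed_eq.
move=> v _; apply: continuous_sum => k _; apply: continuous_mul;
  exact: continuous_mxvec_entry.
Qed.

(** The weights are distinct, so that exchanging two unequal diagonal entries changes the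
    value. *)
Definition wdiag (G Q : 'M[R]_n) : R := \sum_(i < n) i%:R * (Q *m G *m Q^T) i i.

Lemma wdiag_max (G : 'M[R]_n) : exists Q, Q *m Q^T = 1%:M /\
  forall Q', Q' *m Q'^T = 1%:M -> wdiag G Q' <= wdiag G Q.
Proof.
have o1 : orth_vec !=set0.
  by exists (mxvec 1%:M); rewrite /orth_vec/= mxvecK trmx1 mulmx1.
have [|v vo vmax] := @EVT_max_rV R _ (fun v => wdiag G (vec_mx v)) _ o1 compact_orth_vec.
  apply: continuous_subspaceT => v.
  have -> : (fun v : 'rV[R]_(n * n) => wdiag G (vec_mx v)) =
      (fun v => \sum_(i < n) \sum_k (\sum_l (i%:R * G l k) * vec_mx v i l) * vec_mx v i k).
    apply/funext => u; apply: eq_bigr => i _; rewrite mxE mulr_sumr.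
    apply: eq_bigr => k _; rewrite !mxE mulrA; congr (_ * _).
    by rewrite mulr_sumr; apply: eq_bigr => l _; rewrite !mxE; ring.
  apply: continuous_sum => i _; apply: continuous_sum => k _.
  apply: continuous_mul; last exact: continuous_mxvec_entry.
  apply: continuous_sum => l _; apply: continuous_mul; last exact: continuous_mxvec_entry.
  by move=> x; exact: cst_continuous.
exists (vec_mx v); split; first by move: vo; rewrite inE.
move=> Q' Q'o; rewrite -[Q' in leLHS]mxvecK; apply: vmax.
by rewrite inE /orth_vec/= mxvecK.
Qed.

End Orthogonal.

(** At a small angle [t] the tested quantity is [2 t b] up to the order [t ^+ 2], and the
    angle can have either sign. *)
Lemma rotation_test (a b : R) :
  (forall c s : R, c ^+ 2 + s ^+ 2 = 1 -> 2 * c * s * b + s ^+ 2 * a <= 0) -> b = 0.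
Proof.
move=> H.
suff aux : forall b', (forall c s : R, c ^+ 2 + s ^+ 2 = 1 ->
    2 * c * s * b' + s ^+ 2 * a <= 0) -> b' <= 0.
  apply/eqP; rewrite eq_le aux// -oppr_le0 aux// => c s cs.
  by have := H (- c) s; rewrite sqrrN => /(_ cs); nra.
move=> {H} b' H; rewrite leNgt; apply/negP => b0.
(* half the tangent: [(1 - t ^+ 2) / (1 + t ^+ 2)] and [2 t / (1 + t ^+ 2)] parametrise
   the circle *)
pose t := b' / (2 * (b' + `|a|)).
have D0 : 0 < 2 * (b' + `|a|) by have := normr_ge0 a; lra.
have t0 : 0 < t by rewrite divr_gt0.
have tE : t * (2 * (b' + `|a|)) = b' by rewrite divfK// gt_eqF.
have a0 := normr_ge0 a.
have t1 : t <= 2^-1 by rewrite ler_pdivrMr//; lra.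
have d0 : 0 < 1 + t ^+ 2 by have := sqr_ge0 t; lra.
have d0' : 1 + t ^+ 2 != 0 by rewrite gt_eqF.
have := H ((1 - t ^+ 2) / (1 + t ^+ 2)) (2 * t / (1 + t ^+ 2)).
rewrite (_ : _ + _ = 1); last by field.
move=> /(_ erefl).
rewrite (_ : _ + _ = (4 * t / (1 + t ^+ 2) ^+ 2) * ((1 - t ^+ 2) * b' + t * a)); last by field.
rewrite pmulr_rle0; last by rewrite divr_gt0 ?exprn_gt0// mulr_gt0.
have ta : - (t * `|a|) <= t * a.
  by rewrite -mulrN ler_wpM2l ?(ltW t0)// lerNl; have := ler_norm (- a); rewrite normrN.
have tt : t ^+ 2 <= 4^-1 by nra.
nra.
Qed.

Section Spectral.
Context {n : nat} (G : 'M[R]_n) (Gsym : G^T = G).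

Let B (u v : 'rV[R]_n) : R := (u *m G *m v^T) 0 0.
Let dot (u v : 'rV[R]_n) : R := (u *m v^T) 0 0.

Let BC u v : B u v = B v u.
Proof. by rewrite /B -[in LHS](trmxK (u *m G *m v^T)) mxE !trmx_mul trmxK Gsym mulmxA. Qed.

Let B_entry (Q : 'M[R]_n) i j : (Q *m G *m Q^T) i j = B (row i Q) (row j Q).
Proof.
rewrite /B -row_mul tr_row !mxE; apply: eq_bigr => k _.
by rewrite !mxE.
Qed.

Let dot_entry (Q : 'M[R]_n) i j : (Q *m Q^T) i j = dot (row i Q) (row j Q).
Proof. by rewrite /dot tr_row !mxE; apply: eq_bigr => k _; rewrite !mxE. Qed.

Let Blin c s (u v u' : 'rV[R]_n) :
  B (c *: u + s *: v) u' = c * B u u' + s * B v u'.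
Proof. by rewrite /B !mulmxDl -!scalemxAl !mxE. Qed.

Let dotlin c s (u v u' : 'rV[R]_n) :
  dot (c *: u + s *: v) u' = c * dot u u' + s * dot v u'.
Proof. by rewrite /dot !mulmxDl -!scalemxAl !mxE. Qed.

Let dotC u v : dot u v = dot v u.
Proof. by rewrite /dot -[in LHS](trmxK (u *m v^T)) mxE !trmx_mul trmxK. Qed.

Let Blinr c s (u v u' : 'rV[R]_n) :
  B u' (c *: u + s *: v) = c * B u' u + s * B u' v.
Proof. by rewrite BC Blin BC [B v _]BC. Qed.

Let dotlinr c s (u v u' : 'rV[R]_n) :
  dot u' (c *: u + s *: v) = c * dot u' u + s * dot u' v.
Proof. by rewrite dotC dotlin dotC [dot v _]dotC. Qed.

(** Spectral theorem, by maximising a weighted trace over the compact orthogonal group: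
    at a maximiser, rotating two rows gains nothing, which forces the off-diagonal
    entries of [Q *m G *m Q^T] to vanish. *)
Lemma spectral_thm : exists Q : 'M[R]_n, exists d : 'rV[R]_n,
  [/\ Q *m Q^T = 1%:M, Q^T *m Q = 1%:M & G = Q^T *m diag_mx d *m Q].
Proof.
have [Q [Qo Qmax]] := wdiag_max G.
have Qo' : Q^T *m Q = 1%:M by apply: mulmx1C.
have qq i j : dot (row i Q) (row j Q) = (i == j)%:R.
  by rewrite -dot_entry Qo mxE.
have off (i j : 'I_n) : (i < j)%N -> (Q *m G *m Q^T) i j = 0.
  move=> ij; have nij : (i == j) = false by apply/negP => /eqP e; rewrite e ltnn in ij.
  rewrite B_entry.
  pose q k := row k Q.
  have ijR : (j%:R : R) - i%:R != 0 by rewrite subr_eq0 eqr_nat neq_ltn ij orbT.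
  apply: (mulfI ijR); rewrite mulr0.
  apply: (@rotation_test (((j : nat)%:R - (i : nat)%:R) * (B (q i) (q i) - B (q j) (q j)))) => c s cs.
  (* [Q'] is [Q] with the rows [i] and [j] rotated *)
  pose Q' := \matrix_(k < n) (if k == i then c *: q i + (- s) *: q j else
                     if k == j then s *: q i + c *: q j else q k).
  have rowQ' k : row k Q' = if k == i then c *: q i + (- s) *: q j else
                     if k == j then s *: q i + c *: q j else q k by rewrite rowK.
  have Q'o : Q' *m Q'^T = 1%:M.
    apply/matrixP => k l; rewrite dot_entry !rowQ' mxE.
    have nji : (j == i) = false by rewrite eq_sym nij.
    case: (eqVneq k i) => [?|ki]; [subst k|case: (eqVneq k j) => [?|kj]; [subst k|]];
    (case: (eqVneq l i) => [?|li]; [subst l|case: (eqVneq l j) => [?|lj]; [subst l|]]);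
    rewrite ?eqxx ?nij ?nji ?(dotlin, dotlinr) /q ?qq;
    repeat match goal with h : is_true (?a != ?b) |- _ =>
      move: (negbTE h); rewrite eq_sym; move: (negbTE h); clear h => ? ? end;
    repeat match goal with h : (_ == _) = false |- _ => rewrite ?h; clear h end;
    rewrite ?eqxx /=; try nra.
  have sumE (N : 'M[R]_n) : \sum_(k < n) k%:R * N k k =
      i%:R * N i i + (j%:R * N j j +
        \sum_(k < n | (k != i) && (k != j)) k%:R * N k k).
    by rewrite (bigD1 i)//= (bigD1 j)//=; rewrite eq_sym nij.
  have := Qmax _ Q'o; rewrite /wdiag !sumE.
  have -> : \sum_(k < n | (k != i) && (k != j)) k%:R * (Q' *m G *m Q'^T) k k =
     \sum_(k < n | (k != i) && (k != j)) k%:R * (Q *m G *m Q^T) k k.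
    apply: eq_bigr => k /andP[/negPf ki /negPf kj].
    by rewrite !B_entry rowQ' ki kj.
  rewrite !B_entry !rowQ' !eqxx eq_sym nij !(Blin, Blinr) -/(q i) -/(q j).
  rewrite [B (q j) (q i)]BC.
  set bii := B (q i) (q i); set bij := B _ _; set bjj := B _ _.
  set r := \sum_(k < n | _) _.
  move=> H.
  have -> : 2 * c * s * ((j%:R - i%:R) * bij) + s ^+ 2 * ((j%:R - i%:R) * (bii - bjj)) =
    i%:R * (c * (c * bii + - s * bij) + - s * (c * bij + - s * bjj)) +
    j%:R * (s * (s * bii + c * bij) + c * (s * bij + c * bjj))
     - (i%:R * bii + j%:R * bjj) - (c ^+ 2 + s ^+ 2 - 1) * (i%:R * bii + j%:R * bjj) by ring.
  by rewrite cs subrr mul0r; lra.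
have NC i j : (Q *m G *m Q^T) i j = (Q *m G *m Q^T) j i by rewrite !B_entry BC.
exists Q; exists (\row_i (Q *m G *m Q^T) i i); split => //.
have -> : diag_mx (\row_i (Q *m G *m Q^T) i i) = Q *m G *m Q^T.
  apply/matrixP => i j; rewrite 2!mxE; case: (ltngtP i j) => [ij|ji|/val_inj ->].
  - rewrite (off _ _ ij) (_ : (i == j) = false) ?mulr0n//.
    by apply/negP => /eqP e; rewrite e ltnn in ij.
  - rewrite NC (off _ _ ji) (_ : (i == j) = false) ?mulr0n//.
    by apply/negP => /eqP e; rewrite e ltnn in ji.
  - by rewrite eqxx mulr1n.
by rewrite -!mulmxA Qo' mulmx1 !mulmxA Qo' mul1mx.
Qed.

End Spectral.

Lemma sqr_enorm_col n (v : 'cV[R]_n) : enorm v ^+ 2 = (v^T *m v) 0 0.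
Proof. by rewrite sqr_enormE /mxtrace big_ord1. Qed.

(** The lower bound on the form bounds every eigenvalue from below, hence also their
    square roots. *)
Lemma psd_sqrt_exists n (G : 'M[R]_n) (c : R) : 0 <= c -> G^T = G ->
  (forall v : 'cV[R]_n, c ^+ 2 * enorm v ^+ 2 <= (v^T *m G *m v) 0 0) ->
  exists B, [/\ psdmx B, B *m B = G &
    forall v : 'cV[R]_n, c * enorm v ^+ 2 <= (v^T *m B *m v) 0 0].
Proof.
move=> c0 Gsym Gc.
have [Q [d [Qo Qo' GE]]] := spectral_thm Gsym.
have cd i : c ^+ 2 <= d 0 i.
  pose v := Q^T *m delta_mx i (0 : 'I_1).
  have := Gc v; rewrite sqr_enorm_col /v GE !trmx_mul !trmxK trmx_delta.
  rewrite -!mulmxA [Q *m (Q^T *m _)]mulmxA Qo mul1mx.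
  rewrite [Q *m (Q^T *m _)]mulmxA Qo mul1mx mul_delta_mx mxE !eqxx/= mulr1.
  rewrite mul_diag_mx !mxE (bigD1 i)//= big1 ?addr0 => [|k ki]; last first.
    by rewrite !mxE (negbTE ki) andbF mul0r.
  by rewrite !mxE !eqxx/= mul1r mulr1.
have d0 i : 0 <= d 0 i by apply: le_trans (cd i); exact: sqr_ge0.
pose B := Q^T *m diag_mx (\row_i Num.sqrt (d 0 i)) *m Q.
have BT : B^T = B by rewrite /B !trmx_mul trmxK tr_diag_mx mulmxA.
have Bc (v : 'cV[R]_n) : c * enorm v ^+ 2 <= (v^T *m B *m v) 0 0.
  have -> : enorm v ^+ 2 = ((Q *m v)^T *m (Q *m v)) 0 0.
    by rewrite trmx_mul mulmxA -[_ *m Q^T *m Q]mulmxA Qo' mulmx1 sqr_enorm_col.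
  have -> : v^T *m B *m v = (Q *m v)^T *m diag_mx (\row_i Num.sqrt (d 0 i)) *m (Q *m v).
    by rewrite /B trmx_mul !mulmxA.
  rewrite -mulmxA mul_diag_mx !mxE mulr_sumr; apply: ler_sum => i _.
  rewrite !mxE; set t := \sum_(j < n) _.
  rewrite [leRHS]mulrCA ler_wpM2r//; first by rewrite -expr2 sqr_ge0.
  by rewrite -[leLHS](ger0_norm c0) -(sqrtr_sqr c) ler_wsqrtr.
exists B; split => //.
  split => // v; apply: le_trans (Bc v).
  by rewrite mulr_ge0// sqr_ge0.
rewrite /B -!mulmxA [Q *m (Q^T *m _)]mulmxA Qo mul1mx [diag_mx _ *m (diag_mx _ *m _)]mulmxA.
rewrite mulmx_diag GE -!mulmxA; congr (_ *m (diag_mx _ *m _)).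
by apply/rowP => i; rewrite !mxE -expr2 sqr_sqrtr.
Qed.

Lemma sqrtmxP n (G : 'M[R]_n) : G^T = G ->
  (forall v : 'cV[R]_n, 0 <= (v^T *m G *m v) 0 0) ->
  psdmx (sqrtmx G) /\ sqrtmx G *m sqrtmx G = G.
Proof.
move=> Gsym G0; have [B [Bpsd BB _]] : exists B, [/\ psdmx B, B *m B = G &
    forall v : 'cV[R]_n, 0 * enorm v ^+ 2 <= (v^T *m B *m v) 0 0].
  by apply: psd_sqrt_exists => // v; rewrite expr0n mul0r.
by rewrite /sqrtmx; apply: (@xgetPex _ 0 [set B | psdmx B /\ B *m B = G]); exists B.
Qed.

(** The trace is the sum of the values of the form on the columns of [D]. *)
Lemma tr_form_ge n (M D : 'M[R]_n) (c : R) :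
  (forall v : 'cV[R]_n, c * enorm v ^+ 2 <= (v^T *m M *m v) 0 0) ->
  c * enorm D ^+ 2 <= \tr (D^T *m M *m D).
Proof.
move=> Mc; have -> : enorm D ^+ 2 = \sum_j enorm (col j D) ^+ 2.
  rewrite sqr_enorm exchange_big; apply: eq_bigr => j _; rewrite sqr_enorm.
  by apply: eq_bigr => i _; rewrite big_ord1 mxE.
rewrite mulr_sumr; apply: ler_sum => j _; apply: (le_trans (Mc _)).
rewrite tr_col -row_mul colE mulmxA -colE mxE -row_mul mxE; exact: lexx.
Qed.

(** The square root is Lipschitz away from singular matrices:
    with [D = B - B0], the trace of [D (B ^+ 2 - B0 ^+ 2)] is the sum of those of
    [D B D] and [D B0 D], the second of which is at least [c |D| ^+ 2]. *)
Lemma sqrt_lipschitz n (B B0 : 'M[R]_n) (c : R) : psdmx B -> B0^T = B0 ->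
  (forall v : 'cV[R]_n, c * enorm v ^+ 2 <= (v^T *m B0 *m v) 0 0) ->
  c * enorm (B - B0) <= enorm (B *m B - B0 *m B0).
Proof.
move=> [BT B0psd] B0T B0c; set D := B - B0.
have DT : D^T = D by rewrite /D linearB/= BT B0T.
have [D0|D0] := eqVneq (enorm D) 0.
  by rewrite D0 mulr0 enorm_ge0.
have Dpos : 0 < enorm D by rewrite lt_neqAle eq_sym D0 enorm_ge0.
rewrite -(ler_pM2l Dpos) mulrCA -expr2.
apply: (le_trans _ (le_trans (ler_norm _) (tr_mulTmx_le D (B *m B - B0 *m B0)))).
have -> : B *m B - B0 *m B0 = B *m D + D *m B0.
  by rewrite /D mulmxBr mulmxBl addrA subrK.
rewrite mulmxDr raddfD/= -[leLHS]add0r lerD//.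
  rewrite mulmxA -(mul0r (enorm D ^+ 2)); apply: tr_form_ge => v.
  by rewrite mul0r.
rewrite mxtrace_mulC DT -[X in \tr (X *m _ *m _)]DT.
exact: tr_form_ge.
Qed.

End RealSpectral.

(** * Perturbation of Gram matrices *)

Section FormBounds.
Context {R : realType}.

Lemma form_le n (v w : 'cV[R]_n) : `|(v^T *m w) 0 0| <= enorm v * enorm w.
Proof. by have := tr_mulTmx_le v w; rewrite /mxtrace big_ord1. Qed.

Lemma mxE00 (c : 'M[R]_1) : c = (c 0 0)%:M.
Proof. by apply/matrixP => i j; rewrite !ord1 !mxE eqxx mulr1n. Qed.

Lemma sqrtn_ge1 p : 1 <= Num.sqrt (p.+1%:R : R).
Proof. by rewrite -[leLHS]sqrtr1 ler_wsqrtr// ler1n. Qed.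

Section LowerBound.
Context {p : nat} {K : 'M[R]_p.+1} {lam : R} (lam0 : 0 < lam).
Context (Klb : forall v : 'cV[R]_p.+1, lam * enorm v ^+ 2 <= (v^T *m K *m v) 0 0).

Lemma form_lb_mul (v : 'cV[R]_p.+1) : lam * enorm v <= enorm (K *m v).
Proof.
have [v0|v0] := eqVneq (enorm v) 0; first by rewrite v0 mulr0 enorm_ge0.
have vp : 0 < enorm v by rewrite lt_neqAle eq_sym v0 enorm_ge0.
rewrite -(ler_pM2l vp) mulrCA -expr2; apply: (le_trans (Klb v)).
rewrite -mulmxA; exact: le_trans (ler_norm _) (form_le _ _).
Qed.

Lemma form_lb_unit : K \in unitmx.
Proof.
rewrite -unitmx_tr -row_free_unit -kermx_eq0; apply/eqP/row_matrixP => i.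
have := form_lb_mul (row i (kermx K^T))^T.
have -> : K *m (row i (kermx K^T))^T = 0.
  apply: trmx_inj; rewrite trmx_mul trmxK trmx0 -row_mul mulmx_ker.
  by apply/rowP => j; rewrite !mxE.
rewrite enorm0 pmulr_rle0// enorm_trmx => r0; apply/eqP.
by rewrite row0 -enorm_eq0 eq_le r0 enorm_ge0.
Qed.

(** The columns of the inverse are preimages of unit vectors, hence no longer than
    [lam^-1]. *)
Lemma form_lb_inv : enorm (invmx K) <= Num.sqrt p.+1%:R / lam.
Proof.
have col_le j : enorm (col j (invmx K)) <= lam^-1.
  rewrite -(ler_pM2l lam0) divff ?gt_eqF//; apply: (le_trans (form_lb_mul _)).
  rewrite colE mulmxA mulmxV ?form_lb_unit// mul1mx.
  rewrite -(@ler_pXn2r _ 2) ?nnegrE ?enorm_ge0// sqr_enorm_col trmx_delta mul_delta_mx.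
  by rewrite mxE !eqxx expr1n.
rewrite -(@ler_pXn2r _ 2) ?nnegrE ?enorm_ge0 ?divr_ge0 ?sqrtr_ge0 ?(ltW lam0)//.
rewrite sqr_enorm exprMn sqr_sqrtr// exchange_big/=.
apply: (@le_trans _ _ (\sum_(j < p.+1) lam^-1 ^+ 2)); last first.
  by rewrite sumr_const card_ord mulr_natl.
apply: ler_sum => j _.
have h : enorm (col j (invmx K)) ^+ 2 <= lam^-1 ^+ 2.
  by rewrite ler_pXn2r ?nnegrE ?enorm_ge0 ?invr_ge0 ?(ltW lam0).
apply: le_trans h; rewrite sqr_enorm; apply: ler_sum => i _.
by rewrite big_ord1 mxE.
Qed.

End LowerBound.

Lemma unit_sym_inv p (K : 'M[R]_p) : K^T = K -> (invmx K)^T = invmx K.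
Proof. by move=> KT; rewrite trmx_inv KT. Qed.

Lemma scale_sub1_le p (r d : R) (N : 'M[R]_p.+1) :
  `|r - 1| <= d -> enorm (r *: N - 1%:M) <= d * enorm N + enorm (N - 1%:M).
Proof.
move=> rd; have -> : r *: N - 1%:M = (r - 1) *: N + (N - 1%:M).
  by rewrite scalerBl scale1r addrA subrK.
by rewrite (le_trans (enormD _ _))// lerD2r enormZ ler_wpM2r ?enorm_ge0.
Qed.

Lemma mul_sub1_le p (N Z : 'M[R]_p.+1) :
  enorm (N *m Z - 1%:M) <= enorm N * enorm (Z - 1%:M) + enorm (N - 1%:M).
Proof.
have -> : N *m Z - 1%:M = N *m (Z - 1%:M) + (N - 1%:M).
  by rewrite mulmxBr mulmx1 addrA subrK.
by rewrite (le_trans (enormD _ _))// lerD2r enormM.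
Qed.

Lemma enorm_le_sub1 p (N : 'M[R]_p) (d : R) :
  enorm (N - 1%:M) <= d -> enorm N <= Num.sqrt p%:R + d.
Proof.
move=> Nd; rewrite -[N in leLHS](subrK 1%:M) addrC (le_trans (enormD _ _))//.
by rewrite enorm1 lerD2l.
Qed.

Lemma invsqrt_near1 (x d : R) : `|x - 1| <= d -> d <= 2^-1 ->
  `|(Num.sqrt x)^-1 - 1| <= 2 * d.
Proof.
move=> xd d2; have x2 : 2^-1 <= x by move: xd; rewrite ler_norml; lra.
have x0 : 0 <= x by lra.
set r := Num.sqrt x; have r0 : 0 <= r by exact: sqrtr_ge0.
have rr : r ^+ 2 = x by rewrite sqr_sqrtr.
have rh : 2^-1 <= r by nra.
have rn0 : r != 0 by rewrite gt_eqF//; lra.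
have -> : r^-1 - 1 = - (x - 1) / (r * (1 + r)).
  rewrite -rr; field; rewrite rn0/= gt_eqF//; lra.
rewrite normrM normrN [X in _ * X]ger0_norm; last by rewrite invr_ge0 mulr_ge0//; lra.
rewrite ler_pdivrMr; last by rewrite mulr_gt0//; lra.
have : 2^-1 <= r * (1 + r) by nra.
by have := normr_ge0 (x - 1); nra.
Qed.

End FormBounds.

Lemma invmx_sandwich (R : realType) p (K A : 'M[R]_p) :
  K \in unitmx -> A \in unitmx ->
  invmx (K *m A *m K) = invmx K *m invmx A *m invmx K.
Proof.
move=> Ku Au; have Gu : K *m A *m K \in unitmx by rewrite !unitmx_mul Ku Au.
apply: (can_inj (mulKmx Gu)).
by rewrite mulmxV// -!mulmxA mulKVmx// mulKVmx// mulmxV.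
Qed.

Section Perturbation.
Context {R : realType} {p : nat} {K : 'M[R]_p.+1} {lam kap : R}.
Context (KT : K^T = K) (lam0 : 0 < lam)
  (Klb : forall v : 'cV[R]_p.+1, lam * enorm v ^+ 2 <= (v^T *m K *m v) 0 0)
  (Kub : enorm K <= kap * lam).
Let P : R := Num.sqrt p.+1%:R.
Let Ku : K \in unitmx := form_lb_unit lam0 Klb.
Let Kinv : enorm (invmx K) <= P / lam := form_lb_inv lam0 Klb.
Let P1 : 1 <= P := sqrtn_ge1 p.

Let kap0 : 0 <= kap.
Proof. by rewrite -(pmulr_lge0 _ lam0) (le_trans (enorm_ge0 _) Kub). Qed.

(** The matrix is the inverse of [N = invmx K *m B], and [N] is close to the identity
    because [B] and [K] are square roots of nearby matrices. *)
Lemma gram_root_near (A B : 'M[R]_p.+1) (d : R) :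
  enorm (A - 1%:M) <= d -> d <= 2^-1 -> P * kap ^+ 2 * d <= 2^-1 ->
  psdmx B -> B *m B = K *m A *m K ->
  enorm (B *m invmx (K *m A *m K) *m K - 1%:M) <= 2 * (P * kap ^+ 2 * d).
Proof.
move=> Ad d2 Pd Bpsd BB.
have d0 : 0 <= d by apply: le_trans Ad; exact: enorm_ge0.
have Au : A \in unitmx by apply: unitmx_near1; lra.
have BK : lam * enorm (B - K) <= enorm K ^+ 2 * d.
  apply: (le_trans (sqrt_lipschitz Bpsd KT Klb)).
  have -> : B *m B - K *m K = K *m (A - 1%:M) *m K.
    by rewrite BB mulmxBr mulmxBl mulmx1.
  rewrite (le_trans (enormM _ _))// (le_trans (ler_wpM2r _ (enormM _ _))) ?enorm_ge0//.
  by rewrite mulrAC -expr2 ler_wpM2l ?sqr_ge0.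
have Nd : enorm (invmx K *m B - 1%:M) <= P * kap ^+ 2 * d.
  have -> : invmx K *m B - 1%:M = invmx K *m (B - K) by rewrite mulmxBr mulVmx.
  rewrite (le_trans (enormM _ _))//.
  have e1 : enorm (B - K) <= kap ^+ 2 * lam * d.
    rewrite -(ler_pM2l lam0) (le_trans BK)//.
    rewrite [leRHS](_ : _ = (kap * lam) ^+ 2 * d); last ring.
    by rewrite ler_wpM2r// ler_pXn2r ?nnegrE ?enorm_ge0// mulr_ge0// ltW.
  rewrite (le_trans (ler_pM (enorm_ge0 _) (enorm_ge0 _) Kinv e1))//.
  by rewrite le_eqVlt; apply/orP; left; apply/eqP; field; rewrite gt_eqF.
have Nu : invmx K *m B \in unitmx by apply: unitmx_near1; lra.
have Bu : B \in unitmx by move: Nu; rewrite unitmx_mul => /andP[].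
have -> : B *m invmx (K *m A *m K) *m K = invmx (invmx K *m B).
  apply: (can_inj (mulKmx Nu)); rewrite mulmxV//.
  rewrite -BB -!mulmxA [B *m (B *m _)]mulmxA.
  by rewrite mulKVmx ?unitmx_mul ?Bu// mulVmx.
exact: invmx_near1.
Qed.

(** Perturbations smaller than the inverse of this constant stay in the range where the
    inverses and square roots below are controlled. *)
Definition const_root : R := 4 * P + 2 * P * kap ^+ 2 + 8.

Lemma const_rootP (d : R) : 0 <= d -> const_root * d <= 1 ->
  [/\ d <= 8^-1, P * d <= 4^-1 & P * kap ^+ 2 * d <= 2^-1].
Proof.
move=> d0; rewrite /const_root !mulrDl -!mulrA => dC.
have h1 : 0 <= P * d by rewrite mulr_ge0 ?sqrtr_ge0.
have h2 : 0 <= P * (kap ^+ 2 * d) by rewrite !mulr_ge0 ?sqrtr_ge0 ?sqr_ge0.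
by split; lra.
Qed.

(** [B] is the root of the sketched Gram matrix and [r2] the squared length of the
    sketched residual relative to the original one; the two factors are close to the
    identity separately. *)
Lemma student_near (A B : 'M[R]_p.+1) (g : 'cV[R]_p.+1) (e d : R) :
  enorm (A - 1%:M) <= d -> enorm g <= d -> `|e| <= d -> const_root * d <= 1 ->
  psdmx B -> B *m B = K *m A *m K ->
  let r2 := 1 + e - (g^T *m invmx A *m g) 0 0 in
  2^-1 <= r2 /\
  enorm ((Num.sqrt r2)^-1 *: (B *m invmx (K *m A *m K) *m K) - 1%:M) <=
     (4 * P + 4 + 2 * P * kap ^+ 2) * d.
Proof.
move=> Ad gd ed Cd Bpsd BB r2.
have d0 : 0 <= d by apply: le_trans Ad; exact: enorm_ge0.
have [d8 Pd Pkd] := const_rootP d0 Cd.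
have Ai : enorm (invmx A) <= P + 2 * d.
  by apply/enorm_le_sub1/invmx_near1 => //; lra.
have r2d : `|r2 - 1| <= 2 * d.
  rewrite /r2 (_ : _ - 1 = e - (g^T *m invmx A *m g) 0 0); last by ring.
  rewrite (le_trans (ler_normB _ _))//.
  have : `|(g^T *m invmx A *m g) 0 0| <= d * ((P + 2 * d) * d).
    rewrite -mulmxA (le_trans (form_le _ _))// ler_pM ?enorm_ge0//.
    by rewrite (le_trans (enormM _ _))// ler_pM ?enorm_ge0.
  by have := P1; nra.
split; first by move: r2d; rewrite ler_norml; lra.
have rN := invsqrt_near1 r2d.
have Nd := gram_root_near Ad _ Pkd Bpsd BB.
have {}Nd := Nd (_ : d <= 2^-1).
rewrite (le_trans (scale_sub1_le _ (rN _)))//; first lra.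
set N := B *m _ *m K; have N1 : enorm (N - 1%:M) <= 2 * (P * kap ^+ 2 * d).
  by apply: Nd; lra.
have N2 := enorm_le_sub1 N1; rewrite -/P in N2.
have N3 : enorm N <= P + 1 by lra.
have N4 := enorm_ge0 N.
have : 2 * (2 * d) * enorm N <= 2 * (2 * d) * (P + 1) by rewrite ler_wpM2l//; lra.
lra.
Qed.

End Perturbation.

Section PartialPerturbation.
Context {R : realType} {p : nat} {K : 'M[R]_p.+1} {lam kap : R}.
Context (KT : K^T = K) (lam0 : 0 < lam)
  (Klb : forall v : 'cV[R]_p.+1, lam * enorm v ^+ 2 <= (v^T *m K *m v) 0 0)
  (Kub : enorm K <= kap * lam).
Context {tau : 'cV[R]_p.+1} (tau1 : enorm tau = 1).
Let P : R := Num.sqrt p.+1%:R.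
Let Ku : K \in unitmx := form_lb_unit lam0 Klb.
Let Kinv : enorm (invmx K) <= P / lam := form_lb_inv lam0 Klb.
Let P1 : 1 <= P := sqrtn_ge1 p.

Let kap0 : 0 <= kap.
Proof. by rewrite -(pmulr_lge0 _ lam0) (le_trans (enorm_ge0 _) Kub). Qed.

Let K0 : 0 < enorm K.
Proof.
rewrite lt_neqAle enorm_ge0 andbT eq_sym enorm_eq0; apply/negP => /eqP K0.
by have := Ku; rewrite K0 unitmxE det0 unitr0.
Qed.

(** The matrix whose inverse root studentizes the partial estimator, when [A] is the
    sketched Gram matrix of the frame, up to the squared length of the fitted vector and
    the factors [invmx K] on both sides. *)
Definition partial_cov (A : 'M[R]_p.+1) : 'M[R]_p.+1 :=
  (tau^T *m invmx A *m tau) 0 0 *: invmx A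
  + 2 *: (invmx A *m tau *m (invmx A *m tau)^T).

(** The value of [partial_cov] at the identity, for a unit vector [tau]. *)
Definition limit_cov : 'M[R]_p.+1 := 1%:M + 2 *: (tau *m tau^T).

Let tt : enorm (tau *m tau^T) <= 1.
Proof. by rewrite (le_trans (enormM _ _))// enorm_trmx tau1 mulr1. Qed.

Let tt1 : tau^T *m tau = 1%:M.
Proof. by rewrite [LHS]mxE00 -sqr_enorm_col tau1 expr1n. Qed.

Lemma limit_cov_form (v : 'cV[R]_p.+1) :
  (v^T *m limit_cov *m v) 0 0 = enorm v ^+ 2 + 2 * (v^T *m tau) 0 0 ^+ 2.
Proof.
rewrite /limit_cov mulmxDr mulmxDl mulmx1 mxE -sqr_enorm_col; congr (_ + _).
rewrite -scalemxAr -scalemxAl mxE; congr (_ * _).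
have -> : v^T *m (tau *m tau^T) *m v = (v^T *m tau) *m (v^T *m tau)^T.
  by rewrite trmx_mul trmxK !mulmxA.
by rewrite [v^T *m tau]mxE00 mxE big_ord1 !mxE eqxx mulr1n expr2.
Qed.

Lemma limit_covT : limit_cov^T = limit_cov.
Proof. by rewrite /limit_cov linearD/= linearZ/= trmx1 trmx_mul trmxK. Qed.

(** The form of [limit_cov] dominates the squared norm, and [invmx K] contracts by at most
    the factor [enorm K]. *)
Lemma limit_root_exists : exists B0,
  [/\ psdmx B0, B0 *m B0 = invmx K *m limit_cov *m invmx K &
    forall v : 'cV[R]_p.+1, (enorm K)^-1 * enorm v ^+ 2 <= (v^T *m B0 *m v) 0 0].
Proof.
have KiT := unit_sym_inv KT.
apply: psd_sqrt_exists; first by rewrite invr_ge0 ltW.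
  by rewrite !trmx_mul limit_covT KiT mulmxA.
move=> v; have -> : v^T *m (invmx K *m limit_cov *m invmx K) *m v =
    (invmx K *m v)^T *m limit_cov *m (invmx K *m v).
  by rewrite trmx_mul KiT !mulmxA.
rewrite limit_cov_form; apply: (@le_trans _ _ (enorm (invmx K *m v) ^+ 2)); last first.
  by rewrite lerDl mulr_ge0 ?sqr_ge0.
rewrite -exprMn ler_pXn2r ?nnegrE ?mulr_ge0 ?invr_ge0 ?enorm_ge0//.
by rewrite ler_pdivrMl// -{1}(mulKVmx Ku v) enormM.
Qed.

(** Substitute [invmx A = 1 + F] and expand. *)
Lemma partial_cov_near (A : 'M[R]_p.+1) (d : R) :
  enorm (A - 1%:M) <= d -> d <= 8^-1 ->
  enorm (partial_cov A - limit_cov) <= 6 * (P + 2) * d.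
Proof.
move=> Ad d8; have d0 : 0 <= d by apply: le_trans Ad; exact: enorm_ge0.
have Fd : enorm (invmx A - 1%:M) <= 2 * d by apply: invmx_near1 => //; lra.
have Ai := enorm_le_sub1 Fd; rewrite -/P in Ai.
set F := invmx A - 1%:M in Fd; have AF : invmx A = 1%:M + F by rewrite addrC subrK.
set q := (tau^T *m invmx A *m tau) 0 0.
have q1 : `|q - 1| <= 2 * d.
  have -> : q - 1 = (tau^T *m (F *m tau)) 0 0.
    rewrite /q -mulmxA AF mulmxDl mul1mx mulmxDr tt1 mxE.
    by rewrite [X in X + _ - _]mxE eqxx mulr1n addrC addKr.
  by rewrite (le_trans (form_le _ _))// tau1 mul1r (le_trans (enormM _ _))// tau1 mulr1.
have -> : partial_cov A - limit_cov =
    (q *: invmx A - 1%:M) +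
    2 *: (F *m tau *m (invmx A *m tau)^T + tau *m (F *m tau)^T).
  rewrite /partial_cov /limit_cov -/q opprD addrACA; congr (_ + _).
  rewrite -scalerBr; congr (_ *: _).
  have -> : F *m tau = invmx A *m tau - tau by rewrite /F mulmxBl mul1mx.
  by rewrite linearB/= mulmxBl mulmxBr addrA subrK.
have := enorm_ge0 (invmx A) => a0.
have e1 : enorm (F *m tau *m (invmx A *m tau)^T) <= 2 * d * enorm (invmx A).
  rewrite (le_trans (enormM _ _))// enorm_trmx ler_pM ?enorm_ge0//.
    by rewrite (le_trans (enormM _ _))// tau1 mulr1.
  by rewrite (le_trans (enormM _ _))// tau1 mulr1.
have e2 : enorm (tau *m (F *m tau)^T) <= 2 * d.
  rewrite (le_trans (enormM _ _))// enorm_trmx tau1 mul1r.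
  by rewrite (le_trans (enormM _ _))// tau1 mulr1.
rewrite (le_trans (enormD _ _))// enormZ gtr0_norm//.
have e3 := scale_sub1_le (invmx A) q1.
have e4 := enormD (F *m tau *m (invmx A *m tau)^T) (tau *m (F *m tau)^T).
have : 2 * d * enorm (invmx A) <= 2 * d * (P + 1) by rewrite ler_wpM2l//; lra.
rewrite -/F in e3.
lra.
Qed.

Let C1 : R := P ^+ 3 * kap ^+ 2 * (6 * (P + 2)).
Let C2 : R := P ^+ 4 * kap ^+ 2 * (P + 2) * 2.
(** [C1] bounds the relative error of the studentizing root and [C2] that of the sketched
    Gram matrix seen through [K] and [B0]. *)
Definition const_partial : R := 2 * C1 + (P + 1) * C2 + 8.

Let C1_ge0 : 0 <= C1.
Proof. by rewrite !mulr_ge0 ?exprn_ge0 ?sqr_ge0 ?sqrtr_ge0// addr_ge0 ?sqrtr_ge0. Qed.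
Let C2_ge0 : 0 <= C2.
Proof. by rewrite !mulr_ge0 ?exprn_ge0 ?sqr_ge0 ?sqrtr_ge0// addr_ge0 ?sqrtr_ge0. Qed.

Lemma const_partial_ge8 : 8 <= const_partial.
Proof.
rewrite /const_partial lerDr addr_ge0// mulr_ge0 ?C1_ge0 ?C2_ge0//.
by rewrite addr_ge0// ltW// (lt_le_trans ltr01 P1).
Qed.

(** The product is [invmx N *m Z] with [N = invmx B0 *m B1] and [Z] the conjugate of
    [invmx A] by [K *m B0]; both are close to the identity, the first
    by the Lipschitz property of the square root, the second because the condition numbers
    of [K] and [B0] are bounded. *)
Lemma partial_near (A B0 B1 : 'M[R]_p.+1) (d : R) :
  enorm (A - 1%:M) <= d -> const_partial * d <= 1 ->
  psdmx B0 -> B0 *m B0 = invmx K *m limit_cov *m invmx K ->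
  (forall v : 'cV[R]_p.+1, (enorm K)^-1 * enorm v ^+ 2 <= (v^T *m B0 *m v) 0 0) ->
  psdmx B1 -> B1 *m B1 = invmx K *m partial_cov A *m invmx K ->
  B1 \in unitmx /\
  enorm (invmx B1 *m invmx K *m invmx A *m K *m B0 - 1%:M) <= const_partial * d.
Proof.
move=> Ad Cd B0psd B00 B0lb B1psd B11.
have d0 : 0 <= d by apply: le_trans Ad; exact: enorm_ge0.
have Pp := lt_le_trans ltr01 P1.
have C2d : 0 <= (P + 1) * C2 * d by rewrite !mulr_ge0 ?addr_ge0 ?(ltW Pp).
have C1d : 0 <= C1 * d by rewrite mulr_ge0.
have [d8 Cd1] : d <= 8^-1 /\ C1 * d <= 2^-1.
  by move: Cd; rewrite /const_partial !mulrDl -mulrA => Cd; split; lra.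
have Kn0 : 0 < (enorm K)^-1 by rewrite invr_gt0.
have B0u := form_lb_unit Kn0 B0lb.
have B0inv := form_lb_inv Kn0 B0lb; rewrite invrK -/P in B0inv.
have kl0 : 0 <= kap * lam by rewrite mulr_ge0// ltW.
have BB : (enorm K)^-1 * enorm (B1 - B0) <= (P / lam) ^+ 2 * (6 * (P + 2) * d).
  apply: (le_trans (sqrt_lipschitz B1psd B0psd.1 B0lb)).
  have -> : B1 *m B1 - B0 *m B0 = invmx K *m (partial_cov A - limit_cov) *m invmx K.
    by rewrite B11 B00 mulmxBr mulmxBl.
  rewrite (le_trans (enormM _ _))// (le_trans (ler_wpM2r _ (enormM _ _))) ?enorm_ge0//.
  rewrite mulrAC -expr2 ler_pM ?sqr_ge0 ?enorm_ge0//.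
    by rewrite ler_pXn2r ?nnegrE ?enorm_ge0// divr_ge0// ltW.
  exact: partial_cov_near.
have Nd : enorm (invmx B0 *m B1 - 1%:M) <= C1 * d.
  have -> : invmx B0 *m B1 - 1%:M = invmx B0 *m (B1 - B0) by rewrite mulmxBr mulVmx.
  rewrite (le_trans (enormM _ _))//.
  have e1 : enorm (B1 - B0) <= enorm K * ((P / lam) ^+ 2 * (6 * (P + 2) * d)).
    by rewrite -ler_pdivrMl.
  have e0 : 0 <= (P / lam) ^+ 2 * (6 * (P + 2) * d).
    by rewrite !mulr_ge0 ?sqr_ge0 ?addr_ge0 ?invr_ge0 ?(ltW lam0) ?(ltW Pp).
  apply: (@le_trans _ _ ((P * (kap * lam)) * ((kap * lam) * ((P / lam) ^+ 2 * (6 * (P + 2) * d))))).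
    apply: ler_pM; rewrite ?enorm_ge0//.
      by rewrite (le_trans B0inv)// ler_wpM2l// ltW.
    by rewrite (le_trans e1)// ler_wpM2r.
  rewrite le_eqVlt; apply/orP; left; apply/eqP; rewrite /C1; field.
  by rewrite gt_eqF.
have Nu : invmx B0 *m B1 \in unitmx by apply: unitmx_near1; lra.
have B1u : B1 \in unitmx by move: Nu; rewrite unitmx_mul => /andP[].
split => //.
have Fd : enorm (invmx A - 1%:M) <= 2 * d by apply: invmx_near1 => //; lra.
set N := invmx B0 *m B1.
set Z := invmx B0 *m (invmx K *m invmx A *m K) *m B0.
have -> : invmx B1 *m invmx K *m invmx A *m K *m B0 = invmx N *m Z.
  have NZ : N *m (invmx B1 *m invmx K *m invmx A *m K *m B0) = Z.
    by rewrite /N /Z -!mulmxA mulKVmx.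
  by rewrite -NZ mulKmx.
have Ninv : enorm (invmx N - 1%:M) <= 2 * (C1 * d) by apply: invmx_near1.
have N2 := enorm_le_sub1 Ninv; rewrite -/P in N2.
have B0n : enorm B0 <= P ^+ 2 * (P + 2) / lam.
  rewrite -(@ler_pXn2r _ 2) ?nnegrE ?enorm_ge0//; last first.
    by rewrite divr_ge0 ?(ltW lam0)// mulr_ge0 ?sqr_ge0// addr_ge0// ltW.
  rewrite sqr_enormE B0psd.1 B00 -[X in \tr X]mul1mx -[X in \tr (X *m _)]trmx1.
  rewrite (le_trans (ler_norm _))// (le_trans (tr_mulTmx_le _ _))// enorm1 -/P.
  apply: (@le_trans _ _ (P * ((P / lam) * (P + 2) * (P / lam)))).
    rewrite ler_wpM2l ?(ltW Pp)//.
    rewrite (le_trans (enormM _ _))// ler_pM ?enorm_ge0//.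
    rewrite (le_trans (enormM _ _))// ler_pM ?enorm_ge0//.
    rewrite (le_trans (enormD _ _))// enorm1 -/P lerD2l enormZ gtr0_norm//.
    by have := tt; lra.
  rewrite [leLHS](_ : _ = P ^+ 3 * (P + 2) * (lam^-1) ^+ 2); last by ring.
  rewrite [leRHS](_ : _ = (P ^+ 4 * (P + 2) ^+ 2) * (lam^-1) ^+ 2); last by ring.
  rewrite ler_wpM2r ?sqr_ge0//.
  have -> : P ^+ 4 * (P + 2) ^+ 2 = P ^+ 3 * (P + 2) * (P * (P + 2)) by ring.
  rewrite ler_peMr ?mulr_ge0 ?exprn_ge0 ?addr_ge0 ?(ltW Pp)//.
  by have := P1; nra.
have Zd : enorm (Z - 1%:M) <= C2 * d.
  have -> : Z - 1%:M = invmx B0 *m invmx K *m (invmx A - 1%:M) *m K *m B0.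
    rewrite /Z mulmxBr !mulmxBl mulmx1 !mulmxA; congr (_ - _).
    by rewrite mulmxKV// mulVmx.
  apply: (@le_trans _ _ ((P * (kap * lam)) * (P / lam) * (2 * d) * (kap * lam) *
     (P ^+ 2 * (P + 2) / lam))).
    rewrite (le_trans (enormM _ _))// ler_pM ?enorm_ge0//.
    rewrite (le_trans (enormM _ _))// ler_pM ?enorm_ge0//.
    rewrite (le_trans (enormM _ _))// ler_pM ?enorm_ge0//.
    rewrite (le_trans (enormM _ _))// ler_pM ?enorm_ge0//.
    by rewrite (le_trans B0inv)// ler_wpM2l// ltW.
  rewrite le_eqVlt; apply/orP; left; apply/eqP; rewrite /C2; field.
  by rewrite gt_eqF.
rewrite (le_trans (mul_sub1_le _ _))//.
apply: (@le_trans _ _ ((P + 1) * (C2 * d) + 2 * (C1 * d))).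
  rewrite lerD// ler_pM ?enorm_ge0//; lra.
rewrite /const_partial !mulrDl -!mulrA; lra.
Qed.

End PartialPerturbation.

(** * Linearisation of the studentized errors *)

Section Pivots.
Context {R : realType} {n p : nat} {U : 'M[R]_(n, p.+1)} {K : 'M[R]_p.+1}
  {lam kap : R}.
Context (UU : U^T *m U = 1%:M) (KT : K^T = K) (lam0 : 0 < lam)
  (Klb : forall v : 'cV[R]_p.+1, lam * enorm v ^+ 2 <= (v^T *m K *m v) 0 0)
  (Kub : enorm K <= kap * lam).
Context (S : 'M[R]_n) (y : 'cV[R]_n) (m : nat).
Let P : R := Num.sqrt p.+1%:R.
Let Ku : K \in unitmx := form_lb_unit lam0 Klb.

Definition sketch_error : 'M[R]_n := S^T *m S - 1%:M.
Local Notation E := sketch_error.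
Definition pivot_scale : R := Num.sqrt (m%:R / (1 - m%:R / n%:R)).

Lemma sketch_gramE : gram (S *m U) = 1%:M + U^T *m E *m U.
Proof.
by rewrite /gram /E trmx_mul mulmxBr mulmxBl mulmx1 UU !mulmxA addrC subrK.
Qed.

Lemma gram_factor (V : 'M[R]_n) :
  gram (V *m (U *m K)) = K *m gram (V *m U) *m K.
Proof. by rewrite /gram !trmx_mul KT !mulmxA. Qed.

Lemma psd_gram q r (Z : 'M[R]_(q, r)) : psdmx (gram Z).
Proof.
split=> [|v]; first by rewrite /gram trmx_mul trmxK.
have -> : v^T *m gram Z *m v = (Z *m v)^T *m (Z *m v).
  by rewrite /gram trmx_mul !mulmxA.
by rewrite -sqr_enorm_col sqr_ge0.
Qed.

Let gramX : gram (U *m K) = K *m K.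
Proof. by rewrite /gram trmx_mul KT -!mulmxA [U^T *m _]mulmxA UU mul1mx. Qed.

Let KKu : K *m K \in unitmx. Proof. by rewrite unitmx_mul Ku. Qed.

Lemma ols_normal_eq : U^T *m y = K *m ols (U *m K) y.
Proof.
rewrite /ols gramX trmx_mul KT.
have -> : invmx (K *m K) = invmx K *m invmx K.
  apply: (can_inj (mulKmx KKu)).
  by rewrite mulmxV// -mulmxA mulKVmx// mulmxV.
by rewrite -!mulmxA mulKmx// mulKVmx.
Qed.

Lemma residual_orth : U^T *m residual (U *m K) y (ols (U *m K) y) = 0.
Proof.
rewrite /residual mulmxBr ols_normal_eq -!mulmxA [U^T *m _]mulmxA UU mul1mx.
by rewrite subrr.
Qed.

Lemma gram_sub1 : gram (S *m U) - 1%:M = U^T *m E *m U.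
Proof. by rewrite sketch_gramE addrC addKr. Qed.

Section Sketched.
Let beta := ols (U *m K) y.
Let eps := residual (U *m K) y beta.
Let c := (enorm eps)^-1 *: eps.

(** The residual [eps] is orthogonal to the frame, so the normal equations give
    [b - beta = enorm eps *: (invmx G *m K *m (U^T *m E *m c))] with [G] the sketched Gram
    matrix, and the squared length of the sketched residual is a quadratic expression in
    the compressions of [E]. *)
Lemma pivot_s_near (b : 'cV[R]_p.+1) (d : R) :
  eps != 0 ->
  (gram (S *m (U *m K)) \in unitmx -> b = ols (S *m (U *m K)) (S *m y)) ->
  enorm (U^T *m E *m U) <= d -> enorm (U^T *m E *m c) <= d ->
  `|(c^T *m E *m c) 0 0| <= d -> const_root (p := p) (kap := kap) * d <= 1 ->
  exists2 M, pivot_s m S (U *m K) y b = M *m (pivot_scale *: (U^T *m E *m c)) &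
    enorm (M - 1%:M) <= (4 * P + 4 + 2 * P * kap ^+ 2) * d.
Proof.
move=> eps0 bE Ad gd ed Cd.
have d0 : 0 <= d by apply: le_trans Ad; exact: enorm_ge0.
have [d8 _ _] := const_rootP lam0 Kub d0 Cd.
set A := gram (S *m U); have A1 : enorm (A - 1%:M) <= d by rewrite gram_sub1.
have Au : A \in unitmx by apply: unitmx_near1; lra.
set G := gram (S *m (U *m K)); have GE : G = K *m A *m K by rewrite /G gram_factor.
have Gu : G \in unitmx by rewrite GE !unitmx_mul Ku Au.
have [Bpsd BB] := sqrtmxP (psd_gram (S *m (U *m K))).1 (psd_gram (S *m (U *m K))).2.
rewrite -/G in Bpsd BB; have {}BB : sqrtmx G *m sqrtmx G = K *m A *m K by rewrite BB.
have := student_near KT lam0 Klb Kub A1 gd ed Cd Bpsd BB.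
set g := U^T *m E *m c in gd *; set r2 := 1 + _ - _ => -[r2h Md].
exists ((Num.sqrt r2)^-1 *: (sqrtmx G *m invmx (K *m A *m K) *m K)) => //.
have ne0 : enorm eps != 0 by rewrite enorm_eq0.
have Ue : U^T *m eps = 0 := residual_orth.
have yE : y = (U *m K) *m beta + eps by rewrite /eps /residual addrC subrK.
have betaE : ols (U *m K) y = beta by [].
clearbody eps beta.
have epsE : eps = enorm eps *: c by rewrite scalerA divff// scale1r.
have UEe : U^T *m (S^T *m (S *m eps)) = enorm eps *: g.
  rewrite /g scalemxAr -epsE /E [X in _ = X *m eps]mulmxBr mulmx1 mulmxBl.
  by rewrite Ue subr0 !mulmxA.
have XSy : (S *m (U *m K))^T *m (S *m y) = G *m beta + enorm eps *: (K *m g).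
  rewrite {1}yE !mulmxDr /G /gram -!mulmxA; congr (_ + _).
  by rewrite !trmx_mul KT -!mulmxA UEe -scalemxAr.
have bb : b - beta = enorm eps *: (invmx G *m K *m g).
  rewrite bE// /ols -/G -mulmxA XSy mulmxDr mulKmx// addrC addKr.
  by rewrite -scalemxAr mulmxA.
have UEc : U^T *m (S^T *m (S *m c)) = g.
  by rewrite /c -!scalemxAr UEe scalerA mulVf// scale1r.
have AE : gram (S *m U) = A by [].
have AT : A^T = A by have [] := psd_gram (S *m U).
have AiT : (invmx A)^T = invmx A by exact: unit_sym_inv.
clearbody A g.
have resE : residual (S *m (U *m K)) (S *m y) b =
    enorm eps *: (S *m c - S *m U *m (invmx A *m g)).
  have -> : residual (S *m (U *m K)) (S *m y) b =
      S *m eps - (S *m (U *m K)) *m (b - beta).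
    rewrite /residual {1}yE mulmxDr mulmxBr opprB addrA mulmxA.
    by rewrite [S *m eps + _]addrC.
  rewrite bb scalerBr -!scalemxAr; congr (_ - _ *: _).
    by rewrite ?/c -?scalemxAr scalerA divff// scale1r.
  by rewrite GE invmx_sandwich// -!mulmxA mulKmx// mulKVmx.
have c1 : c^T *m c = 1%:M.
  rewrite [LHS]mxE00 -sqr_enorm_col /c enormZ ger0_norm ?invr_ge0 ?enorm_ge0//.
  by rewrite mulVf// expr1n.
have res2 : enorm (S *m c - S *m U *m (invmx A *m g)) ^+ 2 = r2.
  set h := invmx A *m g.
  have hg : h^T *m A *m h = g^T *m invmx A *m g.
    by rewrite /h trmx_mul AiT -!mulmxA mulKVmx.
  have e1 : (S *m c)^T *m (S *m c) = 1%:M + c^T *m E *m c.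
    by rewrite /E mulmxBr mulmxBl mulmx1 c1 addrC subrK trmx_mul !mulmxA.
  have e2 : (S *m U *m h)^T *m (S *m c) = g^T *m invmx A *m g.
    by rewrite !trmx_mul AiT -!mulmxA UEc.
  have e3 : (S *m c)^T *m (S *m U *m h) = g^T *m invmx A *m g.
    apply: trmx_inj; rewrite trmx_mul trmxK e2 !trmx_mul trmxK AiT mulmxA.
    by [].
  have e4 : (S *m U *m h)^T *m (S *m U *m h) = g^T *m invmx A *m g.
    by rewrite -hg -AE /gram [in LHS]trmx_mul !mulmxA.
  rewrite sqr_enorm_col [(_ - _)^T]linearB/= mulmxBl !mulmxBr e1 e2 e3 e4 subrr subr0.
  rewrite /r2; set q := g^T *m invmx A *m g; set q' := c^T *m E *m c.
  by rewrite !mxE.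
have resN : enorm (residual (S *m (U *m K)) (S *m y) b) = enorm eps * Num.sqrt r2.
  rewrite resE enormZ ger0_norm ?enorm_ge0// -res2 sqrtr_sqr ger0_norm//.
  exact: enorm_ge0.
rewrite /pivot_s betaE resN bb -/G GE -/pivot_scale -!scalemxAr -scalemxAl !scalerA.
rewrite !mulmxA; congr (_ *: _).
rewrite invfM; field; rewrite ne0 sqrtr_eq0 -ltNge; lra.
Qed.

End Sketched.

Section Partial.
Let beta := ols (U *m K) y.
Let theta := K *m beta.
Let tau := (enorm theta)^-1 *: theta.
Let c := - (U *m tau).

(** Here [b] and [beta] are [enorm theta] times [invmx K *m invmx A *m tau] and
    [invmx K *m tau], and [(invmx A - 1) *m tau = invmx A *m (U^T *m E *m c)]. *)
Lemma pivot_pa_near (b : 'cV[R]_p.+1) (B0 : 'M[R]_p.+1) (d : R) :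
  theta != 0 ->
  (gram (S *m (U *m K)) \in unitmx -> b = partial_ols S (U *m K) y) ->
  enorm (U^T *m E *m U) <= d -> const_partial (p := p) (kap := kap) * d <= 1 ->
  psdmx B0 -> B0 *m B0 = invmx K *m limit_cov (tau := tau) *m invmx K ->
  (forall v : 'cV[R]_p.+1, (enorm K)^-1 * enorm v ^+ 2 <= (v^T *m B0 *m v) 0 0) ->
  exists2 M, pivot_pa m S (U *m K) y b =
      M *m (pivot_scale *: ((U *m invmx K *m invmx B0)^T *m E *m c)) &
    enorm (M - 1%:M) <= const_partial (p := p) (kap := kap) * d.
Proof.
move=> th0 bE Ad Cd B0psd B00 B0lb.
have nth0 : enorm theta != 0 by rewrite enorm_eq0.
have nthp : 0 < enorm theta by rewrite lt_neqAle eq_sym nth0 enorm_ge0.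
have tau1 : enorm tau = 1.
  by rewrite /tau enormZ ger0_norm ?invr_ge0 ?enorm_ge0// mulVf.
have thE : theta = enorm theta *: tau by rewrite scalerA divff// scale1r.
set A := gram (S *m U); have A1 : enorm (A - 1%:M) <= d by rewrite gram_sub1.
have d0 : 0 <= d by apply: le_trans Ad; exact: enorm_ge0.
have d8 : d <= 8^-1.
  have C8 := const_partial_ge8 lam0 Kub.
  have : 8 * d <= 1 by apply: le_trans Cd; rewrite ler_wpM2r.
  lra.
have Kn0 : 0 < (enorm K)^-1.
  rewrite invr_gt0 lt_neqAle enorm_ge0 andbT eq_sym enorm_eq0; apply/negP => /eqP K0.
  by have := Ku; rewrite K0 unitmxE det0 unitr0.
have B0u : B0 \in unitmx := form_lb_unit Kn0 B0lb.
have KiT := unit_sym_inv KT.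
have B0iT : (invmx B0)^T = invmx B0 by apply: unit_sym_inv; exact: B0psd.1.
have Au : A \in unitmx by apply: unitmx_near1; lra.
have AT : A^T = A by have [] := psd_gram (S *m U).
have AiT : (invmx A)^T = invmx A by exact: unit_sym_inv.
set G := gram (S *m (U *m K)); have GE : G = K *m A *m K by rewrite /G gram_factor.
have GG : G = gram (S *m (U *m K)) by [].
have [GT Gpos] := psd_gram (S *m (U *m K)); rewrite -/G in GT Gpos.
have Gu : G \in unitmx by rewrite GE !unitmx_mul Ku Au.
have GiE : invmx G = invmx K *m invmx A *m invmx K by rewrite GE invmx_sandwich.
have betaE : beta = enorm theta *: (invmx K *m tau).
  by rewrite scalemxAr -thE mulKmx.
have bE' : b = enorm theta *: (invmx K *m (invmx A *m tau)).
  rewrite bE// /partial_ols -/G GiE trmx_mul KT -!mulmxA ols_normal_eq -/beta -/theta.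
  by rewrite mulKmx// {1}thE -!scalemxAr.
have A1E : A = 1%:M + U^T *m E *m U by exact: sketch_gramE.
have cE : invmx A *m tau - tau = invmx A *m (U^T *m E *m c).
  have -> : U^T *m E *m c = - ((A - 1%:M) *m tau).
    by rewrite /c mulmxN [A in A - _]A1E addrC addKr !mulmxA.
  by rewrite mulmxN mulmxA mulmxBr mulVmx// mulmx1 mulmxBl mul1mx opprB.
have olsE : ols (U *m K) y = beta by [].
clearbody A G c tau theta beta.
set Sig := enorm (S *m (U *m K) *m b) ^+ 2 *: invmx G + 2 *: (b *m b^T).
have GiT : (invmx G)^T = invmx G by exact: unit_sym_inv.
have SigT : Sig^T = Sig.
  rewrite /Sig [LHS]linearD/= ![(_ *: _)^T]linearZ/= GiT trmx_mul trmxK.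
  by [].
have Sigpos (v : 'cV[R]_p.+1) : 0 <= (v^T *m Sig *m v) 0 0.
  rewrite /Sig mulmxDr mulmxDl mxE -!scalemxAr -!scalemxAl.
  rewrite [X in 0 <= X + _]mxE [X in 0 <= _ + X]mxE.
  apply: addr_ge0; apply: mulr_ge0 => //; first exact: sqr_ge0.
    by have := Gpos (invmx G *m v); rewrite trmx_mul GiT -!mulmxA mulKVmx.
  have -> : v^T *m (b *m b^T) *m v = (b^T *m v)^T *m (b^T *m v).
    by rewrite trmx_mul trmxK !mulmxA.
  by rewrite -sqr_enorm_col sqr_ge0.
have SigE : Sig = enorm theta ^+ 2 *: (invmx K *m partial_cov (tau := tau) A *m invmx K).
  rewrite /Sig /partial_cov.
  have -> : enorm (S *m (U *m K) *m b) ^+ 2 =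
      enorm theta ^+ 2 * (tau^T *m invmx A *m tau) 0 0.
    rewrite sqr_enorm_col trmx_mul.
    have -> : b^T *m (S *m (U *m K))^T *m (S *m (U *m K) *m b) = b^T *m (K *m A *m K) *m b.
      by rewrite -GE GG /gram !mulmxA.
    rewrite bE' [(_ *: _)^T]linearZ/= -!scalemxAr -!scalemxAl scalerA mxE -expr2.
    congr (_ * _).
    by rewrite !trmx_mul KiT AiT -!mulmxA mulKVmx// mulKmx// mulKVmx.
  rewrite mulmxDr mulmxDl scalerDr; congr (_ + _).
    by rewrite GiE -scalemxAr -scalemxAl scalerA.
  rewrite bE' [(_ *: _)^T]linearZ/= -!scalemxAr -!scalemxAl !scalerA.
  congr (_ *: _); first by ring.
  by rewrite !trmx_mul KiT !mulmxA.
have [Rpsd RR] := sqrtmxP SigT Sigpos.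
set Rt := sqrtmx Sig in Rpsd RR.
pose B1 := (enorm theta)^-1 *: Rt.
have B1psd : psdmx B1.
  split; first by rewrite /B1 linearZ/= Rpsd.1.
  move=> v; rewrite /B1 -scalemxAr -scalemxAl mxE mulr_ge0 ?invr_ge0 ?enorm_ge0//.
  exact: Rpsd.2.
have B11 : B1 *m B1 = invmx K *m partial_cov (tau := tau) A *m invmx K.
  rewrite /B1 -scalemxAl -scalemxAr scalerA RR SigE scalerA -expr2 -exprMn.
  by rewrite mulVf// expr1n scale1r.
have [B1u Md] := partial_near lam0 Klb Kub tau1 A1 Cd B0psd B00 B0lb B1psd B11.
exists (invmx B1 *m invmx K *m invmx A *m K *m B0) => //.
have RtE : Rt = enorm theta *: B1 by rewrite /B1 scalerA divff// scale1r.
rewrite /pivot_pa -/pivot_scale -GG -/Sig -/Rt RtE olsE invmxZ; last by rewrite unitmxZ ?unitfE.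
rewrite bE' betaE -scalerBr -mulmxBr cE !trmx_mul B0iT KiT.
rewrite -scalemxAl -scalemxAr [_^-1 *: _]scalerA mulVf// scale1r -!scalemxAr.
by congr (_ *: _); rewrite -!mulmxA mulKVmx// mulKVmx.
Qed.

End Partial.
End Pivots.

(** * Moments and cosines of Bernoulli sums *)

Section RademacherMoment.
Context {R : realType} {I : finType}.

Local Notation half := (fun=> 2^-1 : R).

Lemma half01 (J : Type) (i : J) : 0 <= (2^-1 : R) <= 1.
Proof. by apply/andP; split; lra. Qed.

(** The exponential moment factorises over the coordinates. *)
Lemma bexp_expR_le (b : I -> R) : \sum_i b i ^+ 2 <= 2^-1 ->
  bexp half (fun x => expR (\sum_i sgn (x i) * b i)) <= expR 1.
Proof.
move=> b2.
rewrite (eq_bexp _ (G := fun x => \prod_i expR (sgn (x i) * b i))); last first.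
  by move=> x; rewrite expR_sum.
rewrite (bexp_prod _ (fun i c => expR (sgn c * b i))).
apply: (@le_trans _ _ (\prod_i expR (2 * b i ^+ 2))).
  apply: ler_prod => i _; apply/andP; split.
    by rewrite addr_ge0// mulr_ge0 ?expR_ge0//; lra.
  have bi : b i ^+ 2 <= 2^-1.
    by apply: le_trans b2; rewrite (bigD1 i)//= lerDl sumr_ge0// => *; exact: sqr_ge0.
  have := cosh_le bi; rewrite /sgn expr1 expr0 mulN1r mul1r; lra.
by rewrite -expR_sum ler_expR -mulr_sumr; lra.
Qed.

Definition moment8_const : R := 8 ^+ 8 * (2 * expR 1) * 2 ^+ 4.

(** Rescaling to [\sum_i b i ^+ 2 = 2^-1], where the exponential moment is bounded. *)
Lemma rademacher_moment8 (b : I -> R) (B : R) : 0 < B -> \sum_i b i ^+ 2 <= B ->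
  bexp half (fun x => (\sum_i sgn (x i) * b i) ^+ 8) <= moment8_const * B ^+ 4.
Proof.
move=> B0 bB; pose r := Num.sqrt (2 * B).
have r2 : r ^+ 2 = 2 * B by rewrite sqr_sqrtr// mulr_ge0// ltW.
have r0 : r != 0 by rewrite gt_eqF// sqrtr_gt0 mulr_gt0.
have bE x : \sum_i sgn (x i) * b i = r * \sum_i sgn (x i) * (b i / r).
  by rewrite mulr_sumr; apply: eq_bigr => i _; field.
rewrite (eq_bexp _ (G := fun x => r ^+ 8 * (\sum_i sgn (x i) * (b i / r)) ^+ 8)); last first.
  by move=> x; rewrite bE exprMn.
have -> : moment8_const * B ^+ 4 = (2 * B) ^+ 4 * (8 ^+ 8 * (2 * expR 1)).
  by rewrite /moment8_const; ring.
rewrite bexpZ -r2 -exprM ler_wpM2l ?exprn_ge0 ?sqrtr_ge0//.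
have b1 : \sum_i (b i / r) ^+ 2 <= 2^-1.
  under eq_bigr do rewrite exprMn exprVn r2.
  rewrite -mulr_suml ler_pdivrMr ?mulr_gt0//; lra.
have b1' : \sum_i (- (b i / r)) ^+ 2 <= 2^-1.
  by under eq_bigr do rewrite sqrrN.
have e1 := bexp_expR_le b1; have e2 := bexp_expR_le b1'.
apply: (le_trans (ler_bexp (half01 (J := I)) (fun x => expr8_le_exp _))).
rewrite bexpZ ler_wpM2l ?exprn_ge0// bexpD.
rewrite [X in _ + X](eq_bexp _ (G := fun x => expR (\sum_i sgn (x i) * - (b i / r)))).
  lra.
by move=> x; rewrite -sumrN; congr expR; apply: eq_bigr => i _; rewrite mulrN.
Qed.

End RademacherMoment.

Section BernoulliVariance.
Context {R : realType} {I : finType}.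

(** The cross terms vanish by independence. *)
Lemma bexp_centered2 (q x : I -> R) :
  bexp q (fun b => (\sum_i ((b i)%:R - q i) * x i) ^+ 2) =
  \sum_i q i * (1 - q i) * x i ^+ 2.
Proof.
rewrite (eq_bexp _ (G := fun b : {ffun I -> bool} => \sum_i \sum_j
    (x i * x j) * (((b i)%:R - q i) * ((b j)%:R - q j)))); last first.
  move=> b; rewrite expr2 mulr_suml; apply: eq_bigr => i _.
  by rewrite mulr_sumr; apply: eq_bigr => j _; ring.
rewrite bexp_sum; apply: eq_bigr => i _; rewrite bexp_sum.
rewrite (bigD1 i)//= big1 ?addr0 => [|j ji]; rewrite bexpZ.
  rewrite (eq_bexp _ (G := fun b : {ffun I -> bool} => \prod_k
     (if k == i then ((b k)%:R - q k) * ((b k)%:R - q k) else 1))); last first.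
    by move=> b; rewrite -big_mkcond big_pred1_eq.
  rewrite (bexp_prod _ (fun k c => if k == i then (c%:R - q k) * (c%:R - q k) else 1)).
  rewrite (bigD1 i)//= eqxx big1 => [|k /negPf ->]; ring.
rewrite (eq_bexp _ (G := fun b : {ffun I -> bool} => \prod_k
     (if k == i then (b k)%:R - q k else if k == j then (b k)%:R - q k else 1))); last first.
  move=> b; rewrite (bigD1 i)//= eqxx (bigD1 j)//= (negPf ji) eqxx big1 ?mulr1//.
  by move=> k /andP[/negPf -> /negPf ->].
rewrite (bexp_prod _ (fun k c => if k == i then c%:R - q k else if k == j then c%:R - q k else 1)).
by rewrite (bigD1 i)//= eqxx; ring.
Qed.

End BernoulliVariance.

Section BernoulliCosine.
Context {R : realType} {I : finType} {g : R} (g01 : 0 <= g <= 1).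

(** In the Taylor expansions of [sin] and [cos] at the two values, the first order terms
    cancel and the second order terms form the variance. *)
Lemma two_point_cos (phi z : R) :
  `|g * cos (phi + (1 - g) * z) + (1 - g) * cos (phi + - g * z)
    - cos phi * expR (- (g * (1 - g) * z ^+ 2 / 2))|
  <= g * (`|z| ^+ 3 + 2 * z ^+ 4).
Proof.
have [g0 g1] := andP g01; have q0 : 0 <= 1 - g by rewrite subr_ge0.
set x1 := (1 - g) * z; set x0 := - g * z; set v := g * (1 - g) * z ^+ 2 / 2.
have v0 : 0 <= v.
  by apply: divr_ge0 => //; apply: mulr_ge0; [apply: mulr_ge0; rewrite ?subr_ge0|exact: sqr_ge0].
have c1 := norm_cos_sub x1; have c0 := norm_cos_sub x0.
have s1 := norm_sin_sub x1; have s0 := norm_sin_sub x0.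
have ev := norm_expRN_sub v0.
set dc1 := cos x1 - _ in c1; set dc0 := cos x0 - _ in c0.
set ds1 := sin x1 - _ in s1; set ds0 := sin x0 - _ in s0.
set de := expR _ - _ in ev.
have -> : g * cos (phi + x1) + (1 - g) * cos (phi + x0) - cos phi * expR (- v) =
   cos phi * (g * dc1 + (1 - g) * dc0 - de) - sin phi * (g * ds1 + (1 - g) * ds0).
  by rewrite !cosD /dc1 /dc0 /ds1 /ds0 /de /x1 /x0 /v; field.
rewrite (le_trans (ler_normB _ _))// !normrM.
have cphi : `|cos phi| <= 1 by rewrite ler_norml cos_geN1 cos_le1.
have sphi : `|sin phi| <= 1 by rewrite ler_norml sin_geN1 sin_le1.
have z4 : 0 <= z ^+ 4 by rewrite (_ : z ^+ 4 = (z ^+ 2) ^+ 2) ?sqr_ge0//; ring.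
have z3 : 0 <= `|z| ^+ 3 by rewrite exprn_ge0.
have b1 : `|g * dc1 + (1 - g) * dc0 - de| <= 2 * (g * z ^+ 4).
  rewrite (le_trans (ler_normB _ _))// (le_trans (lerD (ler_normD _ _) ev))//.
  rewrite !normrM (ger0_norm g0) (ger0_norm q0).
  apply: (@le_trans _ _ (g * x1 ^+ 4 + (1 - g) * x0 ^+ 4 + v ^+ 2)).
    by rewrite lerD2r lerD// ler_wpM2l// subr_ge0.
  rewrite (_ : _ + _ = (g * z ^+ 4) * ((1 - g) ^+ 4 + (1 - g) * g ^+ 3 + g * (1 - g) ^+ 2 / 4)).
    rewrite [leLHS]mulrC ler_wpM2r ?(mulr_ge0 g0 z4)//.
    have q1 : 1 - g <= 1 by lra.
    have h1 : (1 - g) ^+ 4 <= 1 by rewrite exprn_ile1.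
    have h2 : g ^+ 3 <= 1 by rewrite exprn_ile1.
    have h2' : 0 <= g ^+ 3 by rewrite exprn_ge0.
    have h3 : (1 - g) ^+ 2 <= 1 by rewrite exprn_ile1.
    have h3' := sqr_ge0 (1 - g).
    have h4 : (1 - g) * g ^+ 3 <= (1 - g) * 1 by rewrite ler_wpM2l.
    have h5 : g * (1 - g) ^+ 2 <= g * 1 by rewrite ler_wpM2l.
    lra.
  by rewrite /x1 /x0 /v; field.
have b2 : `|g * ds1 + (1 - g) * ds0| <= g * `|z| ^+ 3.
  rewrite (le_trans (ler_normD _ _))// !normrM (ger0_norm g0) (ger0_norm q0).
  apply: (@le_trans _ _ (g * `|x1| ^+ 3 + (1 - g) * `|x0| ^+ 3)).
    by rewrite lerD// ler_wpM2l// subr_ge0.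
  rewrite /x1 /x0 !normrM normrN (ger0_norm g0) (ger0_norm q0).
  rewrite (_ : _ + _ = (g * `|z| ^+ 3) * ((1 - g) ^+ 3 + (1 - g) * g ^+ 2)); last by ring.
  rewrite ler_piMr ?(mulr_ge0 g0 z3)//.
  have h1 : (1 - g) ^+ 3 <= 1 - g.
    by rewrite exprS ler_piMr// exprn_ile1//; lra.
  have h2 : (1 - g) * g ^+ 2 <= g.
    by rewrite expr2 mulrA ler_piMl// mulr_ile1//; lra.
  lra.
have n1 := normr_ge0 (cos phi); have n2 := normr_ge0 (sin phi).
apply: (@le_trans _ _ (1 * (2 * (g * z ^+ 4)) + 1 * (g * `|z| ^+ 3))); last by lra.
by rewrite lerD// ler_pM.
Qed.

(** Lindeberg's replacement of one variable at a time: conditioning on a coordinate shifts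
    the phase, which is why the phase is arbitrary. *)
Lemma bernoulli_cos_seq (z : I -> R) (r : seq I) : uniq r -> forall phi,
  `|bexp (fun=> g) (fun b : {ffun I -> bool} =>
       cos (phi + \sum_(i <- r) ((b i)%:R - g) * z i))
    - cos phi * expR (- (g * (1 - g) * (\sum_(i <- r) z i ^+ 2) / 2))|
  <= g * \sum_(i <- r) (`|z i| ^+ 3 + 2 * z i ^+ 4).
Proof.
have [g0 g1] := andP g01; have q0 : 0 <= 1 - g by rewrite subr_ge0.
elim: r => [_ phi|i r IH /= /andP[ir ur] phi].
  rewrite !big_nil mulr0 mul0r oppr0 expR0 mulr1 mulr0.
  rewrite (eq_bexp _ (G := fun=> cos phi)) ?bexp_cst ?subrr ?normr0//.
  by move=> b; rewrite big_nil addr0.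
pose F (c : bool) (b : {ffun I -> bool}) :=
  cos (phi + (c%:R - g) * z i + \sum_(j <- r) ((b j)%:R - g) * z j).
rewrite (eq_bexp _ (G := fun b : {ffun I -> bool} => F (b i) b)); last first.
  by move=> b; rewrite big_cons addrA.
rewrite bexp_cond; last first.
  move=> c x; rewrite /F; congr (cos (_ + _)); apply: eq_big_seq => j jr.
  by rewrite ffunE; case: eqP jr ir => // -> ->.
rewrite bexpD !bexpZ !big_cons.
have t := IH ur (phi + (1 - g) * z i); have f := IH ur (phi + - g * z i).
set v := g * (1 - g) * (\sum_(j <- r) _) / 2 in t f *.
set Et := bexp _ _ in t; set Ef := bexp _ _ in f.
set err := g * \sum_(j <- r) _ in t f *.
have -> : bexp (fun=> g) (F true) = Et by [].
have -> : bexp (fun=> g) (F false) = Ef.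
  by apply: eq_bexp => b; rewrite /F mulrDl mul0r add0r.
have -> : expR (- (g * (1 - g) * (z i ^+ 2 + \sum_(j <- r) z j ^+ 2) / 2)) =
    expR (- (g * (1 - g) * z i ^+ 2 / 2)) * expR (- v).
  by rewrite -expRD /v; congr expR; field.
have v0 : 0 <= v.
  by rewrite !mulr_ge0 ?subr_ge0// sumr_ge0// => j _; exact: sqr_ge0.
have ev : 0 <= expR (- v) <= 1.
  by rewrite expR_ge0 -expR0 ler_expR oppr_le0 v0.
have one := two_point_cos phi (z i).
set c1 := cos (phi + (1 - g) * z i) in t one; set c0 := cos (phi + - g * z i) in f one.
set ei := expR (- (g * (1 - g) * z i ^+ 2 / 2)) in one *.
have -> : g * Et + (1 - g) * Ef - cos phi * (ei * expR (- v)) =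
  (g * (Et - c1 * expR (- v)) + (1 - g) * (Ef - c0 * expR (- v)))
  + (g * c1 + (1 - g) * c0 - cos phi * ei) * expR (- v) by ring.
rewrite [leRHS]mulrDr -/err [leRHS]addrC (le_trans (ler_normD _ _))// lerD//.
  rewrite (le_trans (ler_normD _ _))// !normrM (ger0_norm g0) (ger0_norm q0).
  rewrite (_ : err = g * err + (1 - g) * err); last by ring.
  by rewrite lerD// ler_wpM2l// subr_ge0.
rewrite normrM (ger0_norm (andP ev).1) -[leRHS]mulr1 ler_pM// ?(andP ev).1 ?(andP ev).2//.
Qed.

Lemma bernoulli_cos (z : I -> R) (phi : R) :
  `|bexp (fun=> g) (fun b : {ffun I -> bool} =>
       cos (phi + \sum_i ((b i)%:R - g) * z i))
    - cos phi * expR (- (g * (1 - g) * (\sum_i z i ^+ 2) / 2))|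
  <= g * \sum_i (`|z i| ^+ 3 + 2 * z i ^+ 4).
Proof. exact: bernoulli_cos_seq (index_enum_uniq _) phi. Qed.

End BernoulliCosine.

(** * The conditional variance of the sketch *)

Section HadamardChaos.
Context {R : realType} {n : nat} (h : 'I_n -> 'I_n -> R) (n0 : (0 < n)%N).
Context (hsq : forall i j, h i j * h i j = 1)
  (hcol : forall j k, \sum_i h i j * h i k = n%:R * (j == k)%:R)
  (hrow : forall i k, \sum_j h i j * h k j = n%:R * (i == k)%:R).
Implicit Types (a c : 'I_n -> R) (x : {ffun 'I_n -> bool}).

Let nR0 : n%:R != 0 :> R. Proof. by rewrite pnatr_eq0 -lt0n. Qed.

Definition randomized a x (i : 'I_n) : R := \sum_j h i j * sgn (x j) * a j.

Lemma randomized_moment8 a (B : R) i : 0 < B -> \sum_j a j ^+ 2 <= B ->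
  bexp (fun=> 2^-1) (fun x => randomized a x i ^+ 8) <= moment8_const * B ^+ 4.
Proof.
move=> B0 aB.
rewrite (eq_bexp _ (G := fun x => (\sum_j sgn (x j) * (h i j * a j)) ^+ 8)); last first.
  by move=> x; congr (_ ^+ 8); apply: eq_bigr => j _; ring.
apply: rademacher_moment8 => //; apply: le_trans aB; apply: ler_sum => j _.
by rewrite exprMn expr2 hsq mul1r.
Qed.

(** The correlation of four columns; for Walsh functions it tells whether their product
    is constant. *)
Definition quad (j1 j2 j3 j4 : 'I_n) : R :=
  n%:R^-1 * \sum_i h i j1 * h i j2 * h i j3 * h i j4.

Lemma quad12 j1 j2 j3 j4 : quad j1 j2 j3 j4 = quad j2 j1 j3 j4.
Proof. by congr (_ * _); apply: eq_bigr => i _; ring. Qed.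

Lemma quad23 j1 j2 j3 j4 : quad j1 j2 j3 j4 = quad j1 j3 j2 j4.
Proof. by congr (_ * _); apply: eq_bigr => i _; ring. Qed.

Lemma quad1234 j1 j2 j3 j4 : quad j1 j2 j3 j4 = quad j3 j4 j1 j2.
Proof. by congr (_ * _); apply: eq_bigr => i _; ring. Qed.

Lemma quad_pair j k l : quad j j k l = (k == l)%:R.
Proof.
rewrite /quad; under eq_bigr do rewrite hsq mul1r.
by rewrite hcol mulrA mulVf// mul1r.
Qed.

(** Parseval: these are the coordinates of a vector of signs in the basis of the columns. *)
Lemma sum_quad2 j2 j3 j4 : \sum_j quad j j2 j3 j4 ^+ 2 = 1.
Proof.
pose t i := h i j2 * h i j3 * h i j4.
have tt i : t i * t i = 1.
  have -> : t i * t i = (h i j2 * h i j2) * (h i j3 * h i j3) * (h i j4 * h i j4).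
    by rewrite /t; ring.
  by rewrite !hsq !mulr1.
have -> : \sum_j quad j j2 j3 j4 ^+ 2 =
    n%:R^-1 ^+ 2 * \sum_i \sum_k t i * t k * (\sum_j h i j * h k j).
  rewrite mulr_sumr.
  transitivity (\sum_j \sum_i \sum_k n%:R^-1 ^+ 2 * (t i * t k * (h i j * h k j))).
    apply: eq_bigr => j _; rewrite /quad exprMn [(\sum_i _) ^+ 2]expr2 mulr_suml mulr_sumr.
    apply: eq_bigr => i _; rewrite mulr_sumr mulr_sumr; apply: eq_bigr => k _.
    by rewrite /t; ring.
  rewrite exchange_big; apply: eq_bigr => i _; rewrite exchange_big mulr_sumr.
  by apply: eq_bigr => k _; rewrite !mulr_sumr.
have -> : \sum_i \sum_k t i * t k * (\sum_j h i j * h k j) = \sum_(i < n) n%:R.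
  apply: eq_bigr => i _; rewrite (bigD1 i)//= hrow eqxx tt mul1r mulr1 big1 ?addr0//.
  by move=> k ki; rewrite hrow eq_sym (negPf ki) !mulr0.
by rewrite sumr_const card_ord -[_ *+ n]mulr_natr; field.
Qed.

Definition distinct4 (j1 j2 j3 j4 : 'I_n) := uniq [:: j1; j2; j3; j4].

(** Unless the four indices are distinct, the signs cancel in pairs; the last term corrects
    for counting the fully diagonal index three times. *)
Lemma quad_sgn j1 j2 j3 j4 x :
  quad j1 j2 j3 j4 * (sgn (x j1) * sgn (x j2) * sgn (x j3) * sgn (x j4)) =
  (distinct4 j1 j2 j3 j4)%:R * quad j1 j2 j3 j4 *
    (sgn (x j1) * sgn (x j2) * sgn (x j3) * sgn (x j4)) +
  ((j1 == j2)%:R * (j3 == j4)%:R + (j1 == j3)%:R * (j2 == j4)%:R +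
   (j1 == j4)%:R * (j2 == j3)%:R - 2 * ((j1 == j2)%:R * (j1 == j3)%:R * (j1 == j4)%:R)).
Proof.
have pair k l : (k == l)%:R * (sgn (x k) * sgn (x l)) = (k == l)%:R :> R.
  by case: eqP => [->|_]; rewrite ?sgn_sqr ?mulr1 ?mul0r.
have pairE (j k l : 'I_n) : quad j j k l * (sgn (x j) * sgn (x j) * (sgn (x k) * sgn (x l))) =
    (k == l)%:R.
  by rewrite quad_pair sgn_sqr mul1r pair.
have [e|n12] := eqVneq j1 j2.
  subst j2; rewrite /distinct4/= inE eqxx/= !mul0r add0r !mul1r -[_ * _ * _ * _]mulrA pairE.
  ring.
have [e|n13] := eqVneq j1 j3.
  subst j3; rewrite /distinct4/= !inE eqxx orbT/= !mul0r add0r.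
  rewrite quad23 (_ : sgn (x j1) * _ * _ * _ =
     sgn (x j1) * sgn (x j1) * (sgn (x j2) * sgn (x j4))); last by ring.
  by rewrite pairE (eq_sym j2 j1) (negPf n12)/=; ring.
have [e|n14] := eqVneq j1 j4.
  subst j4; rewrite /distinct4/= !inE eqxx !orbT/= !mul0r add0r.
  rewrite (_ : quad j1 j2 j3 j1 = quad j1 j1 j2 j3); last first.
    by rewrite quad12 quad23 quad1234.
  rewrite (_ : sgn (x j1) * _ * _ * _ =
     sgn (x j1) * sgn (x j1) * (sgn (x j2) * sgn (x j3))); last by ring.
  by rewrite pairE; ring.
have [e|n23] := eqVneq j2 j3.
  subst j3; rewrite /distinct4/= !inE eqxx !andbF/= !mul0r add0r.
  rewrite (_ : quad j1 j2 j2 j4 = quad j2 j2 j1 j4); last by rewrite quad12 quad23.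
  rewrite (_ : sgn (x j1) * _ * _ * _ =
     sgn (x j2) * sgn (x j2) * (sgn (x j1) * sgn (x j4))); last by ring.
  by rewrite pairE (negPf n14)/=; ring.
have [e|n24] := eqVneq j2 j4.
  subst j4; rewrite /distinct4/= !inE eqxx orbT !andbF/= !mul0r add0r.
  rewrite (_ : quad j1 j2 j3 j2 = quad j2 j2 j1 j3); last first.
    by rewrite quad23 quad1234.
  rewrite (_ : sgn (x j1) * _ * _ * _ =
     sgn (x j2) * sgn (x j2) * (sgn (x j1) * sgn (x j3))); last by ring.
  by rewrite pairE (negPf n13)/=; ring.
have [e|n34] := eqVneq j3 j4.
  subst j4; rewrite /distinct4/= !inE eqxx !andbF/= !mul0r add0r.
  rewrite quad1234 (_ : sgn (x j1) * _ * _ * _ =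
     sgn (x j3) * sgn (x j3) * (sgn (x j1) * sgn (x j2))); last by ring.
  by rewrite pairE (negPf n12)/=; ring.
by rewrite /distinct4/= !inE (negPf n12) (negPf n13) (negPf n14) (negPf n23) (negPf n24) (negPf n34)/=; ring.
Qed.

(** Up to a constant factor, the variance of the sketched inner product of [a] and [c]
    given the signs. *)
Definition fourth a c x : R := n%:R^-1 * \sum_i (randomized a x i * randomized c x i) ^+ 2.

Definition chaos_coef a c (j : 'I_n * 'I_n * 'I_n * 'I_n) : R :=
  (distinct4 j.1.1.1 j.1.1.2 j.1.2 j.2)%:R * quad j.1.1.1 j.1.1.2 j.1.2 j.2 *
    (a j.1.1.1 * a j.1.1.2 * c j.1.2 * c j.2).

Definition chaos_set (j : 'I_n * 'I_n * 'I_n * 'I_n) : {set 'I_n} :=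
  [set j.1.1.1; j.1.1.2; j.1.2; j.2]%SET.

Lemma quad_sum (F : 'I_n -> 'I_n -> 'I_n -> 'I_n -> R) :
  \sum_(j : 'I_n * 'I_n * 'I_n * 'I_n) F j.1.1.1 j.1.1.2 j.1.2 j.2 =
  \sum_j1 \sum_j2 \sum_j3 \sum_j4 F j1 j2 j3 j4.
Proof.
rewrite -(pair_bigA _ (fun p j4 => F p.1.1 p.1.2 p.2 j4))/=.
rewrite -(pair_bigA _ (fun p j3 => \sum_j4 F p.1 p.2 j3 j4))/=.
by rewrite -(pair_bigA _ (fun j1 j2 => \sum_j3 \sum_j4 F j1 j2 j3 j4)).
Qed.

(** The three ways to pair the four indices, minus the fully diagonal terms counted in
    excess. *)
Definition fourth_mean a c : R :=
  (\sum_j a j ^+ 2) * (\sum_j c j ^+ 2) + 2 * (\sum_j a j * c j) ^+ 2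
  - 2 * \sum_j a j ^+ 2 * c j ^+ 2.

Lemma fourth_expand a c x :
  fourth a c x = fourth_mean a c + \sum_j chaos_coef a c j * chi (chaos_set j) x.
Proof.
have -> : fourth a c x = \sum_j1 \sum_j2 \sum_j3 \sum_j4
    (quad j1 j2 j3 j4 * (sgn (x j1) * sgn (x j2) * sgn (x j3) * sgn (x j4))) *
    (a j1 * a j2 * c j3 * c j4).
  transitivity (\sum_i \sum_j1 \sum_j2 \sum_j3 \sum_j4
     n%:R^-1 * ((h i j1 * h i j2 * h i j3 * h i j4) *
     ((sgn (x j1) * sgn (x j2) * sgn (x j3) * sgn (x j4)) * (a j1 * a j2 * c j3 * c j4)))).
    rewrite /fourth mulr_sumr; apply: eq_bigr => i _.
    rewrite exprMn !expr2 /randomized 2!big_distrlr/= mulr_suml mulr_sumr.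
    apply: eq_bigr => j1 _; rewrite mulr_suml mulr_sumr.
    apply: eq_bigr => j2 _; rewrite mulr_sumr mulr_sumr.
    apply: eq_bigr => j3 _; rewrite mulr_sumr mulr_sumr.
    by apply: eq_bigr => j4 _; ring.
  rewrite exchange_big; apply: eq_bigr => j1 _.
  rewrite exchange_big; apply: eq_bigr => j2 _.
  rewrite exchange_big; apply: eq_bigr => j3 _.
  rewrite exchange_big; apply: eq_bigr => j4 _.
  by rewrite /quad mulr_sumr !mulr_suml; apply: eq_bigr => i _; ring.
pose D (j1 j2 j3 j4 : 'I_n) : R := (j1 == j2)%:R * (j3 == j4)%:R + (j1 == j3)%:R * (j2 == j4)%:R +
   (j1 == j4)%:R * (j2 == j3)%:R - 2 * ((j1 == j2)%:R * (j1 == j3)%:R * (j1 == j4)%:R).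
have delta (F : 'I_n -> R) k : \sum_j (k == j)%:R * F j = F k.
  rewrite (bigD1 k)//= eqxx mul1r big1 ?addr0// => j jk.
  by rewrite eq_sym (negPf jk) mul0r.
have -> : fourth_mean a c = \sum_j1 \sum_j2 \sum_j3 \sum_j4
    D j1 j2 j3 j4 * (a j1 * a j2 * c j3 * c j4).
  transitivity (\sum_j1 \sum_j2 \sum_j3
     ((j1 == j2)%:R * (a j1 * a j2 * c j3 ^+ 2) +
      (j1 == j3)%:R * ((a j1 * c j3) * (a j2 * c j2)) +
      (j2 == j3)%:R * ((a j1 * c j1) * (a j2 * c j3)) -
      (j1 == j2)%:R * ((j1 == j3)%:R * (2 * (a j1 * a j2 * c j3 * c j1))))).
    transitivity (\sum_j1 ((a j1 ^+ 2 * \sum_j c j ^+ 2) +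
       a j1 * c j1 * (\sum_j a j * c j) + a j1 * c j1 * (\sum_j a j * c j)
       - 2 * (a j1 ^+ 2 * c j1 ^+ 2))).
      rewrite sumrB !big_split/= -!mulr_suml -mulr_sumr /fourth_mean; ring.
    apply: eq_bigr => j1 _.
    transitivity (\sum_j2 ((j1 == j2)%:R * (a j1 * a j2 * \sum_j c j ^+ 2)
       + a j1 * c j1 * (a j2 * c j2) + a j1 * c j1 * (a j2 * c j2)
       - (j1 == j2)%:R * (2 * (a j1 * a j2 * c j1 * c j1)))).
      by rewrite sumrB !big_split/= !delta -mulr_sumr; congr (_ + _ - _); ring.
    apply: eq_bigr => j2 _; rewrite sumrB !big_split/=.
    by rewrite (delta (fun i => a j1 * c i * (a j2 * c j2)))
      (delta (fun i => a j1 * c j1 * (a j2 * c i))) -!mulr_sumr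
      (delta (fun i => 2 * (a j1 * a j2 * c i * c j1))).
  apply: eq_bigr => j1 _; apply: eq_bigr => j2 _; apply: eq_bigr => j3 _.
  transitivity (\sum_j4 ((j3 == j4)%:R * ((j1 == j2)%:R * (a j1 * a j2 * c j3 * c j4))
    + (j2 == j4)%:R * ((j1 == j3)%:R * (a j1 * a j2 * c j3 * c j4))
    + (j1 == j4)%:R * ((j2 == j3)%:R * (a j1 * a j2 * c j3 * c j4))
    - (j1 == j4)%:R * ((j1 == j2)%:R * (j1 == j3)%:R * (2 * (a j1 * a j2 * c j3 * c j4))))).
    by rewrite sumrB !big_split/= !delta; ring.
  by apply: eq_bigr => j4 _; rewrite /D; ring.
rewrite (quad_sum (fun j1 j2 j3 j4 => chaos_coef a c (j1, j2, j3, j4) *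
  chi (chaos_set (j1, j2, j3, j4)) x)) -big_split/=.
apply: eq_bigr => j1 _; rewrite -big_split/=; apply: eq_bigr => j2 _.
rewrite -big_split/=; apply: eq_bigr => j3 _; rewrite -big_split/=.
apply: eq_bigr => j4 _; rewrite quad_sgn -/(D j1 j2 j3 j4) mulrDl addrC; congr (_ + _).
rewrite /chaos_coef/= /distinct4; case: (boolP (uniq [:: j1; j2; j3; j4])) => [d4|_]; last by rewrite !mul0r.
have -> : @chi R _ (chaos_set (j1, j2, j3, j4)) x = sgn (x j1) * sgn (x j2) * sgn (x j3) * sgn (x j4).
  transitivity (\prod_(i <- [:: j1; j2; j3; j4]) @sgn R (x i)).
    rewrite big_uniq//; apply: eq_bigl => i.
    by rewrite /chaos_set/= !inE !orbA.
  by rewrite !big_cons big_nil mulr1 !mulrA.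
by rewrite mul1r; ring.
Qed.

(** A set of at most four elements arises from at most [4 ^ 4] quadruples. *)
Lemma chaos_fiber (j : 'I_n * 'I_n * 'I_n * 'I_n) :
  (#|[set k | chaos_set k == chaos_set j]%SET| <= 256)%N.
Proof.
set S := chaos_set j.
have S4 : (#|S| <= 4)%N.
  rewrite /S /chaos_set.
  apply: leq_trans (leq_card_setU _ _) _; rewrite cards1 (@leq_add _ _ 3 1)//.
  apply: leq_trans (leq_card_setU _ _) _; rewrite cards1 (@leq_add _ _ 2 1)//.
  by apply: leq_trans (leq_card_setU _ _) _; rewrite !cards1.
apply: (@leq_trans #|finset.setX (finset.setX (finset.setX S S) S) S|); last first.
  by rewrite !cardsX (@leq_mul _ _ 64 4)// (@leq_mul _ _ 16 4)// (@leq_mul _ _ 4 4).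
apply/subset_leq_card/fintype.subsetP => -[[[k1 k2] k3] k4]; rewrite inE => /eqP <-.
by rewrite !finset.in_setX /chaos_set/= !inE !eqxx !orbT.
Qed.

Lemma sum_chaos_coef a c : \sum_j chaos_coef a c j ^+ 2 <=
  \sum_j1 \sum_j2 \sum_j3 \sum_j4
    quad j1 j2 j3 j4 ^+ 2 * (a j1 ^+ 2 * a j2 ^+ 2 * c j3 ^+ 2 * c j4 ^+ 2).
Proof.
rewrite -(quad_sum (fun j1 j2 j3 j4 => quad j1 j2 j3 j4 ^+ 2 *
   (a j1 ^+ 2 * a j2 ^+ 2 * c j3 ^+ 2 * c j4 ^+ 2))).
apply: ler_sum => j _; rewrite /chaos_coef; case: distinct4; last first.
  by rewrite !mul0r expr0n/= -!exprMn sqr_ge0.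
by rewrite mul1r !exprMn.
Qed.

(** Flatness of either vector makes the chaos small: the row sums of the squared
    correlations are one, so summing out the index of the flat vector first leaves
    its largest entry. *)
Lemma chaos_coef_small a c (al B : R) : 0 <= al -> 0 <= B ->
  \sum_j a j ^+ 2 <= B -> \sum_j c j ^+ 2 = 1 ->
  (forall j, a j ^+ 2 <= al) \/ (forall j, c j ^+ 2 <= al) ->
  \sum_j chaos_coef a c j ^+ 2 <= al * (B + B ^+ 2).
Proof.
move=> al0 B0 aB c1 flat; apply: (le_trans (sum_chaos_coef a c)).
have le4 (u v w t : R) : [&& 0 <= v, 0 <= w & 0 <= t] -> u <= al ->
    u * v * w * t <= al * v * w * t.
  by move=> /and3P[v0 w0 t0] ual; rewrite 3?ler_wpM2r.
case: flat => flat.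
  apply: (@le_trans _ _ (\sum_j2 \sum_j3 \sum_j4 (al * a j2 ^+ 2 * c j3 ^+ 2 * c j4 ^+ 2))).
    rewrite exchange_big; apply: ler_sum => j2 _.
    rewrite exchange_big; apply: ler_sum => j3 _.
    rewrite exchange_big; apply: ler_sum => j4 _.
    rewrite -[leRHS]mul1r -(sum_quad2 j2 j3 j4) mulr_suml; apply: ler_sum => j1 _.
    rewrite ler_wpM2l ?sqr_ge0//; apply: le4; last exact: flat.
    by rewrite !sqr_ge0.
  have -> : \sum_j2 \sum_j3 \sum_j4 (al * a j2 ^+ 2 * c j3 ^+ 2 * c j4 ^+ 2) =
      al * \sum_j a j ^+ 2.
    rewrite mulr_sumr; apply: eq_bigr => j2 _.
    transitivity (\sum_j3 al * a j2 ^+ 2 * c j3 ^+ 2).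
      by apply: eq_bigr => j3 _; rewrite -mulr_sumr c1 mulr1.
    by rewrite -mulr_sumr c1 mulr1.
  by rewrite ler_wpM2l// (le_trans aB)// lerDl sqr_ge0.
apply: (@le_trans _ _ (\sum_j1 \sum_j2 \sum_j4 (al * a j1 ^+ 2 * a j2 ^+ 2 * c j4 ^+ 2))).
  apply: ler_sum => j1 _; apply: ler_sum => j2 _.
  rewrite exchange_big; apply: ler_sum => j4 _.
  rewrite -[leRHS]mul1r -(sum_quad2 j4 j1 j2) mulr_suml; apply: ler_sum => j3 _.
  rewrite quad1234 ler_wpM2l ?sqr_ge0//.
  rewrite [leLHS](_ : _ = c j3 ^+ 2 * a j1 ^+ 2 * a j2 ^+ 2 * c j4 ^+ 2); last by ring.
  by apply: le4; [rewrite !sqr_ge0|exact: flat].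
have -> : \sum_j1 \sum_j2 \sum_j4 (al * a j1 ^+ 2 * a j2 ^+ 2 * c j4 ^+ 2) =
    al * (\sum_j a j ^+ 2) ^+ 2.
  rewrite expr2 mulr_suml mulr_sumr; apply: eq_bigr => j1 _.
  rewrite !mulr_sumr; apply: eq_bigr => j2 _.
  by rewrite -mulr_sumr c1 mulr1 mulrA.
rewrite ler_wpM2l// (le_trans (_ : _ <= B ^+ 2)) ?lerDr//.
by rewrite ler_pXn2r ?nnegrE// sumr_ge0// => j _; exact: sqr_ge0.
Qed.

(** The chaos and the diagonal term of the mean are both small by flatness. *)
Lemma fourth_concentrates a c (al B : R) : 0 <= al -> 0 <= B ->
  \sum_j a j ^+ 2 <= B -> \sum_j c j ^+ 2 = 1 ->
  (forall j, a j ^+ 2 <= al) \/ (forall j, c j ^+ 2 <= al) ->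
  bexp (fun=> 2^-1) (fun x => `|fourth a c x -
     (\sum_j a j ^+ 2 + 2 * (\sum_j a j * c j) ^+ 2)|) <=
  16 * Num.sqrt (al * (B + B ^+ 2)) + 2 * (al * (B + 1)).
Proof.
move=> al0 B0 aB c1 flat.
have flat2 : 0 <= \sum_j a j ^+ 2 * c j ^+ 2 <= al * (B + 1).
  apply/andP; split; first by apply: sumr_ge0 => j _; rewrite -exprMn sqr_ge0.
  case: flat => flat.
    apply: (@le_trans _ _ (al * \sum_j c j ^+ 2)).
      by rewrite mulr_sumr; apply: ler_sum => j _; rewrite ler_wpM2r ?sqr_ge0.
    by rewrite c1 ler_wpM2l//; lra.
  apply: (@le_trans _ _ (al * \sum_j a j ^+ 2)).
    by rewrite mulr_sumr; apply: ler_sum => j _; rewrite mulrC ler_wpM2r ?sqr_ge0.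
  by rewrite ler_wpM2l//; lra.
pose Z x := \sum_j chaos_coef a c j * chi (chaos_set j) x.
apply: (@le_trans _ _ (bexp (fun=> 2^-1) (fun x => `|Z x| + 2 * (al * (B + 1))))).
  apply: ler_bexp; first exact: half01.
  move=> x; rewrite fourth_expand /fourth_mean c1 mulr1 -/(Z x).
  set s := \sum_j a j ^+ 2 * c j ^+ 2 in flat2 *.
  rewrite (_ : _ - _ = Z x - 2 * s); last by ring.
  rewrite (le_trans (ler_normB _ _))// lerD2l ger0_norm; lra.
rewrite bexpD bexp_cst lerD2r.
have Z2 : bexp (fun=> 2^-1) (fun x => `|Z x|) ^+ 2 <= 256 * (al * (B + B ^+ 2)).
  apply: (le_trans (sqr_bexp (half01 (J := 'I_n)) _)).
  rewrite (eq_bexp _ (G := fun x => Z x ^+ 2)); last first.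
    by move=> x; rewrite real_normK ?num_real.
  apply: (le_trans (chaos_moment2 _ chaos_fiber)).
  by rewrite ler_wpM2l//; exact: chaos_coef_small.
have Z0 : 0 <= bexp (fun=> 2^-1) (fun x => `|Z x|).
  by apply: bexp_ge0 => //; exact: half01.
have a0 : 0 <= al * (B + B ^+ 2) by rewrite mulr_ge0// addr_ge0// sqr_ge0.
rewrite -(@ler_pXn2r _ 2) ?nnegrE ?mulr_ge0 ?sqrtr_ge0//.
by rewrite exprMn sqr_sqrtr// (le_trans Z2)// (_ : 16 ^+ 2 = 256)//; ring.
Qed.

End HadamardChaos.

(** * Central limit theorem for one bilinear form *)

Section SketchExpectation.
Context {R : realType} {n : nat}.
Implicit Types F G : {ffun 'I_n -> bool} -> {ffun 'I_n -> bool} -> R.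

(** Selectors of parameter [g] and fair signs. *)
Definition sketch_exp (g : R) F : R :=
  bexp (fun=> g) (fun b => bexp (fun=> 2^-1) (fun x => F b x)).

Context {g : R} (g01 : 0 <= g <= 1).

Lemma eq_sketch_exp F G : (forall b x, F b x = G b x) ->
  sketch_exp g F = sketch_exp g G.
Proof. by move=> FG; do 2 (apply: eq_bexp => ?); exact: FG. Qed.

Lemma sketch_expC F : sketch_exp g F =
  bexp (fun=> 2^-1) (fun x => bexp (fun=> g) (fun b => F b x)).
Proof.
rewrite /sketch_exp /bexp.
under eq_bigr do rewrite mulr_sumr.
rewrite exchange_big; apply: eq_bigr => x _; rewrite mulr_sumr.
by apply: eq_bigr => b _; rewrite mulrCA.
Qed.

Lemma sketch_expD F G :
  sketch_exp g (fun b x => F b x + G b x) = sketch_exp g F + sketch_exp g G.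
Proof. by rewrite -bexpD; apply: eq_bexp => b; rewrite bexpD. Qed.

Lemma sketch_expZ k F : sketch_exp g (fun b x => k * F b x) = k * sketch_exp g F.
Proof. by rewrite -bexpZ; apply: eq_bexp => b; rewrite bexpZ. Qed.

Lemma sketch_exp_cst k : sketch_exp g (fun _ _ => k) = k.
Proof. by rewrite /sketch_exp bexp_cst bexp_cst. Qed.

Lemma ler_sketch_exp F G : (forall b x, F b x <= G b x) ->
  sketch_exp g F <= sketch_exp g G.
Proof.
move=> FG; apply: ler_bexp => // b; apply: ler_bexp => //; exact: half01.
Qed.

End SketchExpectation.

Section SketchCLT.
Context {R : realType} {n : nat} (h : 'I_n -> 'I_n -> R) (n0 : (0 < n)%N).
Context (hsq : forall i j, h i j * h i j = 1)
  (hcol : forall j k, \sum_i h i j * h i k = n%:R * (j == k)%:R)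
  (hrow : forall i k, \sum_j h i j * h k j = n%:R * (i == k)%:R).
Context {g : R} (g0 : 0 < g) (g1 : g < 1).
Implicit Types (a c : 'I_n -> R) (b x : {ffun 'I_n -> bool}).

Let m : R := g * n%:R.
Let nR : 0 < n%:R :> R. Proof. by rewrite ltr0n. Qed.
Let m0 : 0 < m. Proof. by rewrite mulr_gt0. Qed.
Let g01 : 0 <= g <= 1. Proof. by rewrite !ltW. Qed.

(** The error of the sketch in preserving the inner product of [a] and [c], for a sketch of
    expected size [m]. *)
Definition ip_error a c b x : R :=
  m^-1 * \sum_i ((b i)%:R - g) * (randomized h a x i * randomized h c x i).

Definition moment_const (B : R) : R := 1 + moment8_const * B ^+ 4.

Lemma moment_const_ge1 B : 0 <= B -> 1 <= moment_const B.
Proof.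
by move=> B0; rewrite lerDl !mulr_ge0 ?exprn_ge0 ?expR_ge0.
Qed.

(** The moments that are needed, of products of two Rademacher sums, are all dominated by
    eighth moments. *)
Lemma product_moment a c (B : R) (F : R -> R -> R) i : 0 < B ->
  \sum_j a j ^+ 2 <= B -> \sum_j c j ^+ 2 <= B ->
  (forall w e, F w e <= 1 + (w ^+ 8 + e ^+ 8) / 2) ->
  bexp (fun=> 2^-1) (fun x => F (randomized h a x i) (randomized h c x i))
    <= moment_const B.
Proof.
move=> B0 aB cB Fle.
apply: (le_trans (ler_bexp (half01 (J := 'I_n)) (fun x => Fle _ _))).
rewrite bexpD bexp_cst lerD2l.
rewrite (eq_bexp _ (G := fun x => 2^-1 * (randomized h a x i ^+ 8 + randomized h c x i ^+ 8))); last first.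
  by move=> x; rewrite mulrC.
have := randomized_moment8 hsq i B0 aB; have := randomized_moment8 hsq i B0 cB.
rewrite bexpZ bexpD; lra.
Qed.

Let even8 (w : R) : [/\ w ^+ 4 <= 1 + w ^+ 8, `|w| ^+ 6 <= 1 + w ^+ 8 & 0 <= w ^+ 8].
Proof.
pose u : R := `|w|; rewrite -/u; have u0 : 0 <= u by exact: normr_ge0.
have e2 : w ^+ 2 = u ^+ 2 by rewrite real_normK ?num_real.
have -> : w ^+ 4 = u ^+ 4 by rewrite (exprM w 2 2) e2 -exprM.
have -> : w ^+ 8 = u ^+ 8 by rewrite (exprM w 2 4) e2 -exprM.
have le_pow k : (k <= 8)%N -> u ^+ k <= 1 + u ^+ 8.
  move=> k8; have [u1|/ltW u1] := leP u 1.
    by apply: (@le_trans _ _ 1); [exact: exprn_ile1|rewrite lerDl exprn_ge0].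
  by rewrite (le_trans (ler_weXn2l u1 k8))// lerDr.
by split; rewrite ?le_pow// exprn_ge0.
Qed.

(** Given the signs, the error is a sum of independent centred terms. *)
Lemma ip_error_moment2 a c (B : R) : 0 < B ->
  \sum_j a j ^+ 2 <= B -> \sum_j c j ^+ 2 <= B ->
  sketch_exp g (fun b x => ip_error a c b x ^+ 2) <= moment_const B / m.
Proof.
move=> B0 aB cB; rewrite sketch_expC.
rewrite (eq_bexp _ (G := fun x => m^-1 ^+ 2 * (g * (1 - g)) *
    \sum_i (randomized h a x i * randomized h c x i) ^+ 2)); last first.
  move=> x; rewrite -mulrA mulr_sumr -(bexp_centered2 (fun=> g)) -bexpZ.
  by apply: eq_bexp => b; rewrite exprMn.
rewrite bexpZ bexp_sum.
apply: (@le_trans _ _ (m^-1 ^+ 2 * g * \sum_(i < n) moment_const B)).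
  apply: ler_pM.
  - by rewrite !mulr_ge0 ?invr_ge0 ?subr_ge0 ?ltW.
  - apply: sumr_ge0 => i _; apply: bexp_ge0; first exact: half01.
    by move=> x; exact: sqr_ge0.
  - rewrite ler_wpM2l ?sqr_ge0// ler_piMr ?(ltW g0)//; have := g0; lra.
  apply: ler_sum => i _.
  apply: (product_moment (F := fun w e => (w * e) ^+ 2) i B0 aB cB) => w e.
  have [w4 _ _] := even8 w; have [e4 _ _] := even8 e.
  have := sqr_ge0 (w ^+ 2 - e ^+ 2); rewrite exprMn.
  have -> : (w ^+ 2 - e ^+ 2) ^+ 2 = w ^+ 4 + e ^+ 4 - 2 * (w ^+ 2 * e ^+ 2) by ring.
  lra.
rewrite sumr_const card_ord -[_ *+ n]mulr_natr le_eqVlt; apply/orP; left; apply/eqP.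
by rewrite /m; field; rewrite !gt_eqF.
Qed.

Let scale : R := Num.sqrt (m / (1 - g)).
Let r : R := Num.sqrt (m * (1 - g))^-1.

Let scaleE : scale = m * r.
Proof.
have q0 : 0 < 1 - g by rewrite subr_gt0.
have -> : m * r = Num.sqrt (m ^+ 2) * r by rewrite sqrtr_sqr ger0_norm// ltW.
rewrite /r -sqrtrM ?sqr_ge0//; congr Num.sqrt; field.
by rewrite !gt_eqF.
Qed.

Let r2E : r ^+ 2 = (m * (1 - g))^-1.
Proof. by rewrite sqr_sqrtr// invr_ge0 mulr_ge0 ?subr_ge0 ?ltW. Qed.

(** Quantitative central limit theorem on characteristic functions: given the
    signs the subsampling is a sum of independent centred terms whose total
    variance concentrates, by flatness, around its expectation. *)
Lemma sketch_clt a c (al B phi : R) : 0 <= al -> 1 <= B ->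
  \sum_j a j ^+ 2 <= B -> \sum_j c j ^+ 2 = 1 ->
  (forall j, a j ^+ 2 <= al) \/ (forall j, c j ^+ 2 <= al) ->
  `|sketch_exp g (fun b x => cos (phi + scale * ip_error a c b x)) -
    cos phi * expR (- ((\sum_j a j ^+ 2 + 2 * (\sum_j a j * c j) ^+ 2) / 2))| <=
  (r + 2 * r ^+ 2) / (1 - g) * moment_const B
    + (8 * Num.sqrt (al * (B + B ^+ 2)) + al * (B + 1)).
Proof.
move=> al0 B1 aB c1 flat; have B0 : 0 < B by apply: lt_le_trans B1.
set T := _ + 2 * _; have q0 : 0 < 1 - g by rewrite subr_gt0.
pose w x i := randomized h a x i * randomized h c x i.
pose Q x := n%:R^-1 * \sum_i w x i ^+ 2.
have r0 : 0 <= r := sqrtr_ge0 _.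
have T0 : 0 <= T.
  apply: addr_ge0; last by apply: mulr_ge0 => //; exact: sqr_ge0.
  by apply: sumr_ge0 => j _; exact: sqr_ge0.
have Q0 x : 0 <= Q x.
  apply: mulr_ge0; first by rewrite invr_ge0 ltW.
  by apply: sumr_ge0 => j _; exact: sqr_ge0.
pose err x := g * \sum_i (`|r * w x i| ^+ 3 + 2 * (r * w x i) ^+ 4).
have step x : `|bexp (fun=> g) (fun b => cos (phi + scale * ip_error a c b x))
    - cos phi * expR (- (T / 2))| <= err x + 2^-1 * `|Q x - T|.
  have := bernoulli_cos g01 (fun i => r * w x i) phi.
  have -> : g * (1 - g) * (\sum_i (r * w x i) ^+ 2) = Q x.
    under eq_bigr do rewrite exprMn.
    rewrite -mulr_sumr r2E /Q /m; field; by rewrite !gt_eqF.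
  rewrite (eq_bexp _ (G := fun b => cos (phi + scale * ip_error a c b x))); last first.
    move=> b; congr (cos (_ + _)); rewrite /ip_error scaleE.
    rewrite mulrA [m * r]mulrC mulfK ?gt_eqF// mulr_sumr.
    by apply: eq_bigr => i _; rewrite /w; ring.
  set Eb := bexp _ _ => H.
  have -> : Eb - cos phi * expR (- (T / 2)) =
    (Eb - cos phi * expR (- (Q x / 2))) + cos phi * (expR (- (Q x / 2)) - expR (- (T / 2))) by ring.
  rewrite (le_trans (ler_normD _ _))// lerD// normrM.
  have cphi : `|cos phi| <= 1 by rewrite ler_norml cos_geN1 cos_le1.
  rewrite (le_trans (ler_piMl _ cphi))//.
  rewrite (le_trans (expRN_lip _ _)) ?divr_ge0//.
  by rewrite -mulrBl mulrC normrM gtr0_norm ?invr_gt0.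
rewrite sketch_expC -[X in _ - X](bexp_cst (I := 'I_n) (fun=> 2^-1)) -bexpB.
apply: (le_trans (ler_norm_bexp (half01 (J := 'I_n)) _)).
apply: (le_trans (ler_bexp (half01 (J := 'I_n)) step)).
rewrite bexpD lerD//; last first.
  rewrite bexpZ.
  have : bexp (fun=> 2^-1) (fun x => `|Q x - T|) <=
      16 * Num.sqrt (al * (B + B ^+ 2)) + 2 * (al * (B + 1)).
    exact: (fourth_concentrates n0 hsq hcol hrow al0 (ltW B0) aB c1 flat).
  set E := bexp _ _ => EQ; apply: (@le_trans _ _ (2^-1 * (16 * Num.sqrt (al * (B + B ^+ 2)) + 2 * (al * (B + 1))))); last by lra.
  by rewrite ler_wpM2l.
rewrite /err bexpZ bexp_sum.
apply: (@le_trans _ _ (g * \sum_(i < n) ((r ^+ 3 + 2 * r ^+ 4) * moment_const B))).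
  rewrite ler_wpM2l ?(ltW g0)//; apply: ler_sum => i _.
  rewrite bexpD [X in _ + X]bexpZ [leRHS]mulrDl lerD//.
    rewrite (eq_bexp _ (G := fun x => r ^+ 3 * `|w x i| ^+ 3)); last first.
      by move=> x; rewrite normrM exprMn (ger0_norm r0).
    rewrite bexpZ ler_wpM2l ?exprn_ge0//.
    apply: (product_moment (F := fun u e => `|u * e| ^+ 3) i B0 aB _) => [|u e].
      by rewrite c1.
    have [_ u6 _] := even8 u; have [_ e6 _] := even8 e.
    rewrite normrM exprMn.
    have := sqr_ge0 (`|u| ^+ 3 - `|e| ^+ 3).
    have -> : (`|u| ^+ 3 - `|e| ^+ 3) ^+ 2 = `|u| ^+ 6 + `|e| ^+ 6 - 2 * (`|u| ^+ 3 * `|e| ^+ 3) by ring.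
    lra.
  rewrite -mulrA ler_wpM2l//.
  rewrite (eq_bexp _ (G := fun x => r ^+ 4 * w x i ^+ 4)); last first.
    by move=> x; rewrite exprMn.
  rewrite bexpZ ler_wpM2l ?exprn_ge0//.
  apply: (product_moment (F := fun u e => (u * e) ^+ 4) i B0 aB _) => [|u e].
    by rewrite c1.
  have := sqr_ge0 (u ^+ 4 - e ^+ 4); rewrite exprMn.
  have -> : (u ^+ 4 - e ^+ 4) ^+ 2 = u ^+ 8 + e ^+ 8 - 2 * (u ^+ 4 * e ^+ 4) by ring.
  lra.
rewrite sumr_const card_ord -[_ *+ n]mulr_natr le_eqVlt; apply/orP; left; apply/eqP.
have -> : g * ((r ^+ 3 + 2 * r ^+ 4) * moment_const B * n%:R) =
   m * r ^+ 2 * (r + 2 * r ^+ 2) * moment_const B by rewrite /m; ring.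
by rewrite r2E; field; rewrite !gt_eqF.
Qed.

End SketchCLT.

(** * The error of a Hadamard sketch *)

Section HadamardSketch.
Context {R : realType}.

Lemma castmx_orthogonal n n' (e : n = n') (A : 'M[R]_n) :
  A^T *m A = 1%:M -> (castmx (e, e) A)^T *m castmx (e, e) A = 1%:M.
Proof. by case: _ / e; rewrite castmx_id. Qed.

Lemma hadamard_orthogonal t : (@hadamard R t)^T *m hadamard t = 1%:M.
Proof.
elim: t => [|t IH]; first by rewrite /= trmx1 mulmx1.
rewrite /=; apply: castmx_orthogonal.
rewrite [(_ *: _)^T]linearZ/= -scalemxAl -scalemxAr scalerA tr_block_mx linearN/= mulmx_block.
rewrite mulmxN mulNmx mulNmx mulmxN opprK IH subrr.
have s2 : (Num.sqrt 2)^-1 * (Num.sqrt 2)^-1 = 2^-1 :> R.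
  by rewrite -invfM -expr2 sqr_sqrtr.
have -> : 1%:M + 1%:M = 2%:M :> 'M[R]_(2 ^ t) by rewrite -raddfD.
by rewrite s2 -scalar_mx_block scale_scalar_mx mulVf.
Qed.

Lemma hadamard_sqr t i j : @hadamard R t i j ^+ 2 = (2 ^ t)%N%:R^-1.
Proof.
elim: t i j => [i j|t IH i j].
  by rewrite /= mxE !ord1 eqxx expr1n invr1.
have -> : ((2 ^ t.+1)%N%:R : R)^-1 = 2^-1 * (2 ^ t)%N%:R^-1 by rewrite expnS natrM invfM.
rewrite /= castmxE mxE exprMn exprVn sqr_sqrtr//; congr (_ * _).
rewrite /block_mx mxE; case: (fintype.split _) => k; rewrite mxE; case: (fintype.split _) => k'.
all: by rewrite ?mxE ?sqrrN IH.
Qed.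

Context (l : nat).
Let n := (2 ^ l)%N.
Let nR : 0 < n%:R :> R. Proof. by rewrite ltr0n expn_gt0. Qed.

(** The Hadamard matrix normalised to entries of absolute value one. *)
Definition hsign (i j : 'I_(2 ^ l)) : R := Num.sqrt (2 ^ l)%N%:R * hadamard l i j.

Lemma hsign_sqr i j : hsign i j * hsign i j = 1.
Proof.
by rewrite -expr2 exprMn hadamard_sqr sqr_sqrtr ?(ltW nR)// mulfV// gt_eqF.
Qed.

Lemma hsign_col j k : \sum_i hsign i j * hsign i k = (2 ^ l)%N%:R * (j == k)%:R.
Proof.
have /matrixP/(_ j k) := hadamard_orthogonal l; rewrite !mxE => <-.
rewrite mulr_sumr; apply: eq_bigr => i _; rewrite mxE /hsign mulrACA -expr2.
by rewrite sqr_sqrtr// ltW.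
Qed.

Lemma hsign_row i k : \sum_j hsign i j * hsign k j = (2 ^ l)%N%:R * (i == k)%:R.
Proof.
have /matrixP/(_ i k) := mulmx1C (hadamard_orthogonal l); rewrite !mxE => <-.
rewrite mulr_sumr; apply: eq_bigr => j _; rewrite mxE /hsign mulrACA -expr2.
by rewrite sqr_sqrtr// ltW.
Qed.

Context (m : nat) (m0 : (0 < m)%N).
Let g : R := m%:R / n%:R.

Definition srht_error (b x : {ffun 'I_(2 ^ l) -> bool}) : 'M[R]_(2 ^ l) :=
  sketch_error (srht m b x).

(** As [H D] is orthogonal, it preserves the inner product of [a] and [c], and the error
    comes from the subsampling alone. *)
Lemma srht_errorE (a c : 'cV[R]_(2 ^ l)) b x :
  (a^T *m srht_error b x *m c) 0 0 =
  ip_error hsign (g := g) (fun j => a j 0) (fun j => c j 0) b x.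
Proof.
pose D : 'M[R]_(2 ^ l) := diag_mx (\row_i (-1) ^+ x i).
pose B : 'M[R]_(2 ^ l) := diag_mx (\row_i (b i)%:R).
pose w (v : 'cV[R]_(2 ^ l)) i := randomized hsign (fun j => v j 0) x i.
have HD v i : (hadamard l *m D *m v) i 0 = (Num.sqrt n%:R)^-1 * w v i.
  rewrite /w /randomized mulr_sumr -mulmxA mxE; apply: eq_bigr => j _.
  rewrite mul_diag_mx !mxE /hsign /sgn.
  by field; rewrite gt_eqF// sqrtr_gt0.
have DT : D^T = D by rewrite tr_diag_mx.
have DD : D *m D = 1%:M.
  rewrite mulmx_diag -[RHS]diag_const_mx; congr diag_mx; apply/rowP => i.
  by rewrite !mxE -expr2 sqrr_sign.
have HDo : (hadamard l *m D)^T *m (hadamard l *m D) = 1%:M.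
  by rewrite trmx_mul DT -mulmxA [_^T *m _]mulmxA hadamard_orthogonal mul1mx DD.
have form (M : 'M[R]_(2 ^ l)) : a^T *m M *m c = a^T *m (M *m c) by rewrite mulmxA.
rewrite /srht_error /sketch_error mulmxBr mulmxBl mulmx1 mxE [X in _ + X]mxE.
have -> : a^T *m c = (hadamard l *m D *m a)^T *m (hadamard l *m D *m c).
  by rewrite [in RHS]trmx_mul -[RHS]mulmxA [(hadamard l *m D)^T *m _]mulmxA HDo mul1mx.
have -> : a^T *m ((srht m b x)^T *m srht m b x) *m c =
    (n%:R / m%:R) *: ((hadamard l *m D *m a)^T *m (B *m (hadamard l *m D *m c))).
  rewrite /srht -/D -/B -/n [(_ *: _)^T]linearZ/= -!(scalemxAl, scalemxAr) !scalerA -expr2.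
  rewrite sqr_sqrtr ?divr_ge0//; congr (_ *: _).
  have BB : B^T *m B = B.
    rewrite tr_diag_mx mulmx_diag; congr diag_mx; apply/rowP => i.
    by rewrite !mxE -natrM; case: (b i).
  rewrite -!mulmxA !trmx_mul -!mulmxA; congr (_ *m (_ *m (_ *m _))).
  by rewrite mulmxA BB.
rewrite mxE [X in _ * X - _]mxE [X in _ - X]mxE /ip_error.
rewrite !mulr_sumr -sumrB; apply: eq_bigr => i _.
rewrite [X in n%:R / m%:R * (X * _)]mxE [X in _ - X * _]mxE mul_diag_mx [(\matrix_(_, _) _) i 0]mxE.
rewrite [X in X * (_ *m _ *m _) _ _]mxE !HD -/(w a i) -/(w c i).
have sn : Num.sqrt n%:R ^+ 2 = n%:R :> R by rewrite sqr_sqrtr// ltW.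
have -> : n%:R / m%:R * ((Num.sqrt n%:R)^-1 * w a i * ((b i)%:R * ((Num.sqrt n%:R)^-1 * w c i)))
    = n%:R / m%:R * (w a i * ((b i)%:R * w c i)) * (Num.sqrt n%:R ^+ 2)^-1 by rewrite -exprVn; ring.
have -> : (Num.sqrt n%:R)^-1 * w a i * ((Num.sqrt n%:R)^-1 * w c i) =
    w a i * w c i * (Num.sqrt n%:R ^+ 2)^-1 by rewrite -exprVn; ring.
rewrite sn /g; field.
by rewrite !gt_eqF// ltr0n.
Qed.

End HadamardSketch.

(** * Approximation by trigonometric polynomials *)

Section UniformContinuity.
Context {R : realType} {p : nat}.

(** The point [v] ranges over a compact box, but the nearby [u] may leave it: in the
    applications [u] is random. *)
Lemma uniform_on_box (f : 'cV[R]_p -> R) (phi : R -> R) (r : R) :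
  continuous f -> (forall t, - r <= t <= r -> {for t, continuous phi}) ->
  forall eps, 0 < eps -> exists2 d, 0 < d &
    forall u v : 'I_p -> R, (forall a, - r <= v a <= r) ->
      (forall a, `|u a - v a| < d) ->
      `|f (\col_a phi (u a)) - f (\col_a phi (v a))| < eps.
Proof.
move=> cf cphi eps eps0.
pose K : set 'rV[R]_p := [set v | forall i, `[- r, r]%classic (v ord0 i)].
have cK : compact K.
  by apply: (@rV_compact R p (fun=> `[- r, r]%classic)) => i; exact: segment_compact.
pose fphi (v : 'rV[R]_p) := f (\col_a phi (v 0 a)).
pose Q (d : R) (v : 'rV[R]_p) := forall u : 'rV[R]_p,
  (forall a, `|u 0 a - v 0 a| < d) -> `|fphi u - fphi v| < eps.
have local (x : 'rV[R]_p) : K x -> exists2 r0, 0 < r0 & forall w : 'rV[R]_p,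
    (forall a, `|w 0 a - x 0 a| < r0) -> `|fphi w - fphi x| < eps / 2.
  move=> Kx.
  have eps20 : 0 < eps / 2 by rewrite divr_gt0.
  have /cvgrPdist_lt/(_ _ eps20)/nbhs_ballP[e1/= e10 fe1] := cf (\col_a phi (x 0 a)).
  have nr : \forall d \near (0:R)^'+, forall a w, `|w - x 0 a| < d -> `|phi w - phi (x 0 a)| < e1.
    apply: filter_forall => a.
    have xa : - r <= x 0 a <= r by have := Kx a; rewrite /= in_itv.
    have /cvgrPdist_lt/(_ _ e10)/nbhs_ballP[e2/= e20 pe2] := cphi _ xa.
    near=> d => w wx; rewrite distrC; apply: pe2.
    by rewrite /ball/= distrC (lt_trans wx)//; near: d; exact: nbhs_right_lt.
  near (0:R)^'+ => d.
  exists d => // w wx; rewrite distrC; apply: fe1; split => // i j.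
  by rewrite !mxE /ball/= distrC; apply: (near nr d).
have KQ : \forall d \near (0:R)^'+, K `<=` Q d.
  apply: (compact_near_coveringP K).1 => // x Kx.
  have [r0 r00 hr] := local x Kx.
  have r02 : 0 < r0 / 2 by rewrite divr_gt0.
  exists (ball x (r0 / 2), [set d | d < r0 / 2]).
    by split; [exact: nbhsx_ballx|exact: nbhs_right_lt].
  move=> [v d] /= [[_ bv] dr] u uv.
  have vx a : `|v 0 a - x 0 a| < r0 / 2 by rewrite distrC; exact: bv.
  have e1 : `|fphi u - fphi x| < eps / 2.
    apply: hr => a; have := vx a; have := uv a.
    have := ler_normD (u 0 a - v 0 a) (v 0 a - x 0 a).
    rewrite addrA subrK; lra.
  have e2 : `|fphi v - fphi x| < eps / 2.
    by apply: hr => a; have := vx a; lra.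
  have := ler_normB (fphi u - fphi x) (fphi v - fphi x).
  rewrite opprB addrA subrK; lra.
near (0:R)^'+ => d.
exists d => // u v vr uv.
have := near KQ d; move=> /(_ _ (\row_a v a)) H.
have -> : f (\col_a phi (u a)) = fphi (\row_a u a).
  by congr f; apply/matrixP => i j; rewrite !mxE.
have -> : f (\col_a phi (v a)) = fphi (\row_a v a).
  by congr f; apply/matrixP => i j; rewrite !mxE.
apply: H => // => [i|a]; rewrite ?mxE//=.
by rewrite in_itv/=; exact: vr.
Unshelve. all: by end_near. Qed.

End UniformContinuity.

Section TrigPolynomials.
Context {R : realType} {p : nat}.
Implicit Types (f g : 'cV[R]_p -> R) (t x : 'cV[R]_p).

Definition dotv t x : R := \sum_a t a 0 * x a 0.

Definition trig_poly f := exists s : seq (R * 'cV[R]_p * R),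
  forall x, f x = \sum_(q <- s) q.1.1 * cos (q.2 + dotv q.1.2 x).

Lemma dotvD t t' x : dotv (t + t') x = dotv t x + dotv t' x.
Proof. by rewrite /dotv -big_split; apply: eq_bigr => a _; rewrite mxE mulrDl. Qed.

Lemma dotvN t x : dotv (- t) x = - dotv t x.
Proof. by rewrite /dotv -sumrN; apply: eq_bigr => a _; rewrite mxE mulNr. Qed.

Lemma trig_ext f g : f =1 g -> trig_poly f -> trig_poly g.
Proof. by move=> fg [s sE]; exists s => x; rewrite -fg. Qed.

Lemma trig_cos t phi : trig_poly (fun x => cos (phi + dotv t x)).
Proof. by exists [:: (1, t, phi)] => x; rewrite big_seq1 mul1r. Qed.

Lemma trig_cst c : trig_poly (fun=> c).
Proof.
exists [:: (c, 0, 0)] => x; rewrite big_seq1/= add0r /dotv big1 ?cos0 ?mulr1//.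
by move=> a _; rewrite mxE mul0r.
Qed.

Lemma trig_add f g : trig_poly f -> trig_poly g -> trig_poly (fun x => f x + g x).
Proof. by move=> [s sE] [r rE]; exists (s ++ r) => x; rewrite big_cat/= sE rE. Qed.

Lemma trig_mul f g : trig_poly f -> trig_poly g -> trig_poly (fun x => f x * g x).
Proof.
move=> [s sE] [r rE].
exists ([seq (q.1.1 * q'.1.1 / 2, q.1.2 + q'.1.2, q.2 + q'.2) | q <- s, q' <- r] ++
  [seq (q.1.1 * q'.1.1 / 2, q.1.2 - q'.1.2, q.2 - q'.2) | q <- s, q' <- r]) => x.
rewrite big_cat/= !big_allpairs_dep/= -big_split/= sE rE mulr_suml.
apply: eq_bigr => q _; rewrite mulr_sumr -big_split/=; apply: eq_bigr => q' _.
rewrite !dotvD dotvN.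
set A := q.2 + dotv q.1.2 x; set B := q'.2 + dotv q'.1.2 x.
have -> : q.2 + q'.2 + (dotv q.1.2 x + dotv q'.1.2 x) = A + B by rewrite /A /B; ring.
have -> : q.2 - q'.2 + (dotv q.1.2 x - dotv q'.1.2 x) = A - B by rewrite /A /B; ring.
by rewrite cosD cosB; field.
Qed.

Lemma trig_sum (I : finType) (F : I -> 'cV[R]_p -> R) :
  (forall i, trig_poly (F i)) -> trig_poly (fun x => \sum_i F i x).
Proof.
move=> tF; elim: (index_enum I) => [|i r IH].
  by apply: trig_ext (trig_cst 0) => x; rewrite big_nil.
by apply: trig_ext (trig_add (tF i) IH) => x; rewrite big_cons.
Qed.

Lemma trig_prod (I : finType) (F : I -> 'cV[R]_p -> R) :
  (forall i, trig_poly (F i)) -> trig_poly (fun x => \prod_i F i x).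
Proof.
move=> tF; elim: (index_enum I) => [|i r IH].
  by apply: trig_ext (trig_cst 1) => x; rewrite big_nil.
by apply: trig_ext (trig_mul (tF i) IH) => x; rewrite big_cons.
Qed.

Lemma trig_sin_coord (L : R) a : trig_poly (fun x => sin (x a 0 / L)).
Proof.
apply: trig_ext (trig_cos (\col_b (if b == a then L^-1 else 0)) (- (pi / 2))) => x.
rewrite /dotv (bigD1 a)//= mxE eqxx big1 ?addr0; last first.
  by move=> b /negPf ba; rewrite mxE ba mul0r.
by rewrite addrC cosD cosN sinN cos_pihalf sin_pihalf mulr0 add0r mulrN1 opprK mulrC.
Qed.

(** Bernstein approximation in the variables [(1 + sin (x_a / (2 L))) / 2]: it is
    bounded by the bound of the function everywhere, being an average of its
    values, and close to it on the box of radius [L]. *)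
Theorem trig_approx f (M L eps : R) : continuous f -> (forall x, `|f x| <= M) ->
  0 < L -> 0 < eps ->
  exists g, [/\ trig_poly g, forall x, `|g x| <= M &
    forall x, (forall a, `|x a 0| <= L) -> `|f x - g x| <= eps].
Proof.
move=> cf fM L0 eps0.
have M0 : 0 <= M := le_trans (normr_ge0 _) (fM 0).
have ph1 := @pihalf_ge1 R.
(* doubling the radius keeps [x_a / L2] in [[-1/2, 1/2]], where [sin] is invertible with
   a continuous inverse *)
pose L2 := 2 * L; have L20 : 0 < L2 by rewrite mulr_gt0.
pose r : R := sin 2^-1.
have half_in : (2^-1 : R) \in `[- (pi / 2), pi / 2]%R by rewrite in_itv/=; apply/andP; split; lra.
have halfN_in : (- 2^-1 : R) \in `[- (pi / 2), pi / 2]%R by rewrite in_itv/=; apply/andP; split; lra.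
have r1 : r < 1.
  rewrite /r -[ltRHS]sin_pihalf ltr_sin//; first lra.
  by rewrite in_itv/=; apply/andP; split; lra.
pose phi (t : R) := L2 * asin t.
have cphi (t : R) : - r <= t <= r -> {for t, continuous phi}.
  move=> /andP[t1 t2]; apply: continuousM; first exact: cst_continuous.
  by apply: continuous_asin; apply/andP; split; lra.
have [d d0 fd] := uniform_on_box cf cphi (divr_gt0 eps0 (ltr0n R 2)).
(* more than [X] Bernoulli variables per coordinate make the Chebyshev bound smaller than
   [eps / 2] *)
pose X := 16 * M * p%:R / (d ^+ 2 * eps).
have X0 : 0 <= X.
  by rewrite /X divr_ge0// ?mulr_ge0 ?ler0n ?(ltW eps0) ?(ltW d0).
have [N NX] : exists N : nat, X < N%:R by exists (Num.bound X); exact: archi_boundP.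
have N0 : 0 < N%:R :> R by apply: le_lt_trans NX.
pose v x a := (1 + sin (x a 0 / L2)) / 2.
have v01 x a : 0 <= v x a <= 1.
  have := sin_geN1 (x a 0 / L2); have := sin_le1 (x a 0 / L2).
  by rewrite /v => ? ?; apply/andP; split; lra.
pose q x (aj : 'I_p * 'I_N) := v x aj.1.
have q01 x aj : 0 <= q x aj <= 1 by exact: v01.
pose u (b : {ffun 'I_p * 'I_N -> bool}) a : R := 2 * (N%:R^-1 * \sum_j (b (a, j))%:R) - 1.
pose g x := bexp (q x) (fun b => f (\col_a phi (u b a))).
exists g; split.
- apply: trig_sum => b; apply: trig_mul; last exact: trig_cst.
  apply: trig_prod => aj.
  have tv : trig_poly (fun x => q x aj).
    apply: trig_ext (trig_mul (trig_add (trig_cst 1) (trig_sin_coord L2 aj.1)) (trig_cst 2^-1)) => x.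
    by [].
  case: (b aj) => //.
  by apply: trig_ext (trig_add (trig_cst 1) (trig_mul (trig_cst (-1)) tv)) => x; rewrite mulN1r.
- move=> x; apply: (le_trans (ler_norm_bexp (q01 x) _)).
  by apply: bexp_le_cst => // b; exact: fM.
move=> x xL; pose w a := sin (x a 0 / L2).
have xin a : - 2^-1 <= x a 0 / L2 <= 2^-1.
  have := xL a; rewrite ler_norml => /andP[x1 x2].
  by rewrite ler_pdivlMr// ler_pdivrMr// /L2; apply/andP; split; lra.
have xin' a : x a 0 / L2 \in `[- (pi / 2), pi / 2]%R.
  by have /andP[? ?] := xin a; rewrite in_itv/=; apply/andP; split; lra.
have wr a : - r <= w a <= r.
  have /andP[x1 x2] := xin a.
  have mono (s t : R) : s \in `[- (pi / 2), pi / 2]%R -> t \in `[- (pi / 2), pi / 2]%R ->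
      s <= t -> sin s <= sin t :> R.
    move=> sI tI; rewrite le_eqVlt => /orP[/eqP ->//|st].
    by rewrite ltW// ltr_sin.
  by rewrite /r -sinN; apply/andP; split; apply: mono.
have fx : f x = f (\col_a phi (w a)).
  congr f; apply/matrixP => a j; rewrite mxE (ord1 j) /phi /w sinK//.
  by rewrite mulrC divfK// gt_eqF.
have uw b a : u b a - w a = 2 * (N%:R^-1 * \sum_j ((b (a, j))%:R - v x a)).
  rewrite sumrB sumr_const card_ord -[_ *+ N]mulr_natr /u /v -/(w a); field.
  by rewrite gt_eqF.
have point b : `|f (\col_a phi (u b a)) - f x| <=
    eps / 2 + 2 * M / d ^+ 2 * \sum_a (u b a - w a) ^+ 2.
  have c0 : 0 <= 2 * M / d ^+ 2 by rewrite divr_ge0 ?sqr_ge0// mulr_ge0.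
  have s0 : 0 <= \sum_a (u b a - w a) ^+ 2 by apply: sumr_ge0 => a _; exact: sqr_ge0.
  have [near_|/existsNP[a /negP]] := pselect (forall a, `|u b a - w a| < d).
    rewrite fx (le_trans (ltW (fd _ _ wr near_)))// lerDl mulr_ge0//.
  rewrite -leNgt => da.
  apply: (@le_trans _ _ (2 * M)).
    by rewrite (le_trans (ler_normB _ _))//; have := fM (\col_a phi (u b a)); have := fM x; lra.
  rewrite (le_trans _ (_ : 2 * M / d ^+ 2 * \sum_a (u b a - w a) ^+ 2 <= _)) ?lerDr//; last first.
    by rewrite divr_ge0// ltW.
  rewrite -mulrA ler_peMr ?mulr_ge0//.
  rewrite ler_pdivlMl ?exprn_gt0// mulr1 (bigD1 a)//= -[leLHS]addr0 lerD//.
    by rewrite -[leRHS]real_normK ?num_real// ler_pXn2r ?nnegrE ?(ltW d0).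
  by apply: sumr_ge0 => *; exact: sqr_ge0.
rewrite distrC -(bexp_cst (q x) (f x)) -bexpB.
apply: (le_trans (ler_norm_bexp (q01 x) _)).
apply: (le_trans (ler_bexp (q01 x) point)).
rewrite bexpD bexp_cst bexpZ bexp_sum.
have pairE (F : 'I_p * 'I_N -> R) : \sum_aj F aj = \sum_c \sum_j F (c, j).
  by rewrite pair_bigA; apply: eq_bigr => -[].
have var a : bexp (q x) (fun b => (u b a - w a) ^+ 2) <= 4 / N%:R.
  rewrite (eq_bexp _ (G := fun b => 4 * (\sum_aj ((b aj)%:R - q x aj) *
      (if aj.1 == a then N%:R^-1 else 0)) ^+ 2)); last first.
    move=> b; rewrite uw exprMn; congr (_ * _); first by ring.
    congr (_ ^+ 2); rewrite pairE/= (bigD1 a)//= eqxx [X in _ + X]big1 ?addr0; last first.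
      by move=> c /negPf ->; apply: big1 => j _; rewrite mulr0.
    by rewrite mulr_sumr; apply: eq_bigr => j _; rewrite mulrC.
  rewrite bexpZ bexp_centered2 ler_wpM2l//.
  rewrite pairE/= (bigD1 a)//= eqxx [X in _ + X]big1 ?addr0; last first.
    by move=> c /negPf ->; apply: big1 => j _; rewrite expr0n mulr0.
  apply: (@le_trans _ _ (\sum_(j < N) N%:R^-1 ^+ 2)).
    apply: ler_sum => j _; rewrite ler_piMl ?sqr_ge0//.
    have /andP[? ?] := v01 x a; rewrite /q/=; nra.
  rewrite sumr_const card_ord -[_ *+ N]mulr_natr le_eqVlt; apply/orP; left; apply/eqP.
  by field; rewrite gt_eqF.
have : 2 * M / d ^+ 2 * \sum_a bexp (q x) (fun b => (u b a - w a) ^+ 2) <=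
    2 * M / d ^+ 2 * \sum_(a < p) (4 / N%:R).
  rewrite ler_wpM2l ?divr_ge0 ?sqr_ge0 ?mulr_ge0//.
  by apply: ler_sum => a _; exact: var.
rewrite sumr_const card_ord -[_ *+ p]mulr_natr.
have : 2 * M / d ^+ 2 * (4 / N%:R * p%:R) <= eps / 2.
  have d20 : 0 < d ^+ 2 by rewrite exprn_gt0.
  move/ltW: NX; rewrite /X ler_pdivrMr ?mulr_gt0// => NX.
  have -> : 2 * M / d ^+ 2 * (4 / N%:R * p%:R) = (16 * M * p%:R) / (2 * (d ^+ 2 * N%:R)).
    by field; rewrite !gt_eqF.
  by rewrite ler_pdivrMr ?mulr_gt0//; lra.
lra.
Qed.

End TrigPolynomials.

(** * The characteristic function of the Gaussian law *)

Section GaussianCharacteristic.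
Context {R : realType}.
Let mu := @lebesgue_measure R.
Let pdf : R -> R := normal_pdf 0 1.

Let one0 : (1 : R) != 0. Proof. exact: oner_neq0. Qed.

Lemma std_normal_pdfE x : pdf x = normal_peak 1 * expR (- (x ^+ 2 / 2)).
Proof.
rewrite /pdf normal_pdfE// /normal_fun subr0 expr1n.
by congr (_ * expR _); rewrite mulNr.
Qed.

Lemma integral_normal01 (f : R -> R) :
  measurable_fun setT f -> (exists M, forall x, `|f x| <= M) ->
  (\int[normal_prob 0 1]_x (f x)%:E = \int[mu]_x (f x * pdf x)%:E)%E.
Proof.
move=> mf [M fM].
have dom := @normal_prob_dominates R 0 1.
have intf : (normal_prob (0:R) 1).-integrable setT (EFin \o f).
  apply: measurable_bounded_integrable => //.
    exact: (le_lt_trans (probability_le1 _ measurableT) (ltry 1)).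
  exists M; split; first exact: num_real.
  by move=> y My x _ /=; apply: (le_trans (fM x)); exact: ltW.
rewrite -(Radon_Nikodym_change_of_variables dom)//=.
under [RHS]eq_integral do rewrite EFinM.
have mfE : measurable_fun setT (EFin \o f) by exact/measurable_EFinP.
have mpdf : measurable_fun setT (EFin \o pdf).
  by apply/measurable_EFinP; exact: measurable_normal_pdf.
have mRN : measurable_fun setT
    (Radon_Nikodym (charge_of_finite_measure (normal_prob (0:R) 1)) (@lebesgue_measure R)).
  by apply: (measurable_int mu); exact: Radon_Nikodym_integrable.
apply: ae_eq_integral => //.
- exact: (emeasurable_funM mfE mRN).
- exact: (emeasurable_funM mfE mpdf).
- apply: ae_eqe_mul2l => /=.
  rewrite Radon_NikodymE//=.
  case: cid => /= h [h1 h2 h3].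
  apply: integral_ae_eq => //=.
  by move=> E E01 mE; rewrite -h3.
Qed.

(** The integrand is dominated by a multiple of the normal density of variance two. *)
Lemma integrable_normal01_moment : mu.-integrable setT (fun x => (`|x| * pdf x)%:E).
Proof.
have s0 : Num.sqrt 2 != 0 :> R by rewrite gt_eqF// sqrtr_gt0.
pose c : R := 2 * normal_peak 1 / normal_peak (Num.sqrt 2).
have ic : mu.-integrable setT (fun x : R => (c * normal_pdf 0 (Num.sqrt 2) x)%:E).
  under eq_fun do rewrite EFinM.
  by apply: integrableZl => //; exact: integrable_normal_pdf.
apply: le_integrable ic => //=.
  apply/measurable_EFinP; apply: measurable_funM; first exact: normr_measurable.
  exact: measurable_normal_pdf.
move=> x _; rewrite lee_fin.
have pk := normal_peak_gt0 one0; have pk2 := normal_peak_gt0 s0.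
rewrite [leLHS]ger0_norm; last by rewrite mulr_ge0// normal_pdf_ge0.
rewrite [leRHS]ger0_norm; last first.
  by rewrite mulr_ge0 ?normal_pdf_ge0// divr_ge0 ?mulr_ge0 ?normal_peak_ge0.
rewrite std_normal_pdfE normal_pdfE// /normal_fun subr0 sqr_sqrtr//.
have -> : expR (- (x ^+ 2 / 2)) = expR (- x ^+ 2 / (2 *+ 2)) * expR (- x ^+ 2 / (2 *+ 2)).
  by rewrite -expRD; congr expR; rewrite mulNr; field.
set e := expR _; have e0 : 0 < e by exact: expR_gt0.
have xe : `|x| * e <= 2.
  have := expR_ge1Dx (x ^+ 2 / (2 *+ 2)).
  have -> : expR (x ^+ 2 / (2 *+ 2)) = e^-1 by rewrite /e mulNr expRN invrK.
  move=> H; rewrite -ler_pdivlMr//; apply: (@le_trans _ _ (2 * (1 + x ^+ 2 / (2 *+ 2)))).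
    have x2 : x ^+ 2 = `|x| ^+ 2 by rewrite real_normK ?num_real.
    rewrite x2; have := sqr_ge0 (`|x| - 1).
    have -> : 2 * (1 + `|x| ^+ 2 / (2 *+ 2)) = 2 + `|x| ^+ 2 / 2 by field.
    nra.
  by rewrite ler_wpM2l.
have -> : c * (normal_peak (Num.sqrt 2) * e) = 2 * (normal_peak 1 * e).
  by rewrite /c; field; rewrite gt_eqF.
have -> : `|x| * (normal_peak 1 * (e * e)) = (`|x| * e) * (normal_peak 1 * e) by ring.
by rewrite ler_wpM2r// mulr_ge0 ?ltW.
Qed.

Lemma is_derive_normal01 (x : R) : is_derive x (1 : R) pdf (- x * pdf x).
Proof.
have -> : pdf = (fun x => normal_peak 1 * expR (- (x ^+ 2 / 2))).
  by apply/funext => z; exact: std_normal_pdfE.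
have d1 : is_derive x (1 : R) (fun z : R => - (z ^+ 2 / 2)) (- x).
  by apply: is_derive_eq; rewrite /GRing.scale/=; lra.
have d2 := @is_derive1_comp _ expR _ _ _ _ (is_derive_expR _) d1.
apply: is_derive_eq; rewrite /GRing.scale/=; ring.
Qed.

Lemma continuous_normal01 : continuous pdf.
Proof. exact: continuous_normal_pdf. Qed.

Section Fourier.
Context (phi : R).

Let wave (g : R -> R) (t x : R) := g (phi + t * x) * pdf x.

Let continuous_wave (g : R -> R) t : continuous g -> continuous (wave g t).
Proof.
move=> cg x; apply: continuousM; last exact: continuous_normal01.
apply: continuous_comp; last exact: cg.
by apply: continuousD; [exact: cst_continuous|apply: continuousM => //; exact: cst_continuous].
Qed.

Let measurable_wave (g : R -> R) t : continuous g -> measurable_fun setT (wave g t).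
Proof. by move=> cg; apply: continuous_measurable_fun; exact: continuous_wave. Qed.

Let integrable_pdf : mu.-integrable setT (EFin \o pdf).
Proof. exact: integrable_normal_pdf. Qed.

Let pdf_ge0 x : 0 <= pdf x. Proof. exact: normal_pdf_ge0. Qed.

Let integrable_wave (g : R -> R) t : continuous g -> (forall x, `|g x| <= 1) ->
  mu.-integrable setT (EFin \o wave g t).
Proof.
move=> cg g1; apply: le_integrable integrable_pdf => //=.
  by apply/measurable_EFinP; exact: measurable_wave.
by move=> x _; rewrite lee_fin /wave normrM !(ger0_norm (pdf_ge0 x)) ler_piMl.
Qed.

Let integrable_xwave (g : R -> R) t : continuous g -> (forall x, `|g x| <= 1) ->
  mu.-integrable setT (fun x => (x * wave g t x)%:E).
Proof.
move=> cg g1; apply: le_integrable integrable_normal01_moment => //=.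
  by apply/measurable_EFinP; apply: measurable_funM => //; exact: measurable_wave.
move=> x _; rewrite lee_fin /wave !normrM normr_id (ger0_norm (pdf_ge0 x)).
by rewrite ler_wpM2l// ler_piMl.
Qed.

Let cos1 x : `|cos x| <= 1 :> R. Proof. by rewrite ler_norml cos_geN1 cos_le1. Qed.
Let sin1 x : `|sin x| <= 1 :> R. Proof. by rewrite ler_norml sin_geN1 sin_le1. Qed.
Let ccos : continuous (@cos R). Proof. exact: continuous_cos. Qed.
Let csin : continuous (@sin R). Proof. exact: continuous_sin. Qed.

Let F t := (\int[mu]_x wave cos t x)%R.

Let wave_derive (t x : R) : is_derive t (1 : R) (fun s => wave cos s x) (- (x * wave sin t x)).
Proof.
have d1 : is_derive t (1 : R) (fun s : R => phi + s * x) x.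
  by apply: is_derive_eq; rewrite /GRing.scale/=; lra.
have d2 := @is_derive1_comp _ cos _ _ _ _ (is_derive_cos _) d1.
rewrite /wave; apply: is_derive_eq; rewrite /GRing.scale/=; ring.
Qed.

Lemma fourier_derive t : is_derive t (1 : R) F (- (\int[mu]_x (x * wave sin t x))%R).
Proof.
have It : `]t - 1, t + 1[%classic t by rewrite /= in_itv/=; apply/andP; split; lra.
have G0 y : 0 <= `|y| * pdf y by rewrite mulr_ge0.
have part (s x : R) : partial1of2 (wave cos) s x = - (x * wave sin s x).
  by rewrite partial1of2E; have [_ ->] := wave_derive s x.
have intf (s : R) : `]t - 1, t + 1[%classic s -> mu.-integrable setT (EFin \o wave cos s).
  by move=> _; exact: integrable_wave.
have derf (s y : R) : `]t - 1, t + 1[%classic s -> setT y -> derivable (wave cos ^~ y) s 1.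
  by move=> _ _; have [] := wave_derive s y.
have ub (s y : R) : `]t - 1, t + 1[%classic s -> setT y ->
    `|partial1of2 (wave cos) s y| <= `|y| * pdf y.
  move=> _ _; rewrite part normrN /wave !normrM (ger0_norm (pdf_ge0 y)).
  by rewrite ler_wpM2l// ler_piMl.
have dF := derivable_under_integral measurableT It intf derf G0 integrable_normal01_moment ub.
have eF := differentiation_under_integral measurableT It intf derf G0 integrable_normal01_moment ub.
apply: DeriveDef => //.
rewrite -derive1E eF; under eq_Rintegral do rewrite part.
by rewrite -mulN1r -RintegralZl//; [apply: eq_Rintegral => x _; rewrite mulN1r|exact: integrable_xwave].
Qed.

(** Integration by parts: the derivative of [sin (phi + t x) * pdf x] has a zero
    integral, its primitive vanishing at both ends. *)
Lemma fourier_parts t : (\int[mu]_x (x * wave sin t x))%R = t * F t.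
Proof.
pose s x := t * wave cos t x - x * wave sin t x.
have int1 : mu.-integrable setT (fun x => (t * wave cos t x)%:E).
  under eq_fun do rewrite EFinM.
  by apply: integrableZl => //; exact: integrable_wave.
have ints : mu.-integrable setT (EFin \o s).
  rewrite (_ : EFin \o s = (fun x => (t * wave cos t x)%:E - (x * wave sin t x)%:E)%E).
    by apply: integrableB => //; exact: integrable_xwave.
  by apply/funext => x; rewrite /= EFinB.
have sE (x : R) : is_derive x (1 : R) (wave sin t) (s x).
  have d1 : is_derive x (1 : R) (fun z : R => phi + t * z) t.
    by apply: is_derive_eq; rewrite /GRing.scale/=; lra.
  have d2 := @is_derive1_comp _ sin _ _ _ _ (is_derive_sin _) d1.
  have d3 := is_derive_normal01 x.
  rewrite /wave; apply: is_derive_eq; rewrite /s /wave /GRing.scale/=; ring.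
have cs : continuous s.
  move=> x; apply: (@continuousB _ _ _ (fun x => t * wave cos t x) (fun x => x * wave sin t x)).
    by apply: continuousM; [exact: cst_continuous|exact: continuous_wave].
  by apply: continuousM => //; exact: continuous_wave.
pose I (n : nat) : set R := `[- n.+1%:R, n.+1%:R]%classic.
have ftc n : (\int[mu]_(x in I n) (s x)%:E)%E =
    (wave sin t n.+1%:R - wave sin t (- n.+1%:R))%:E.
  rewrite EFinB; apply: continuous_FTC2.
  - by rewrite (@lt_trans _ _ 0) ?oppr_lt0 ?ltr0n.
  - exact: continuous_subspaceT.
  - split.
    + by move=> x _; have [] := sE x.
    + by apply: cvg_at_right_filter; exact: continuous_wave.
    + by apply: cvg_at_left_filter; exact: continuous_wave.
  - by move=> x _; rewrite derive1E; have [_ ->] := sE x.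
have lim0 : (wave sin t n.+1%:R - wave sin t (- n.+1%:R)) @[n --> \oo] --> (0 : R).
  have pk := @normal_peak_ge0 R 1.
  have bound n : `|wave sin t n.+1%:R - wave sin t (- n.+1%:R)| <= (4 * normal_peak 1) * harmonic n.
    have pdfN : pdf (- n.+1%:R) = pdf n.+1%:R by rewrite !std_normal_pdfE sqrrN.
    have pb : pdf n.+1%:R <= normal_peak 1 * (2 * harmonic n).
      rewrite std_normal_pdfE ler_wpM2l// expRN /harmonic/=.
      have n0 : 0 < n.+1%:R :> R by rewrite ltr0n.
      set k : R := n.+1%:R in n0 *.
      have := expR_ge1Dx (k ^+ 2 / 2) => e1.
      have : k / 2 <= expR (k ^+ 2 / 2).
        by apply: le_trans e1; have := sqr_ge0 (k - 1); nra.
      move=> e2; rewrite (_ : 2 * k^-1 = (k / 2)^-1); last by rewrite invfM invrK mulrC.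
      by rewrite lef_pV2 ?posrE ?expR_gt0 ?divr_gt0.
    rewrite (le_trans (ler_normB _ _))// /wave !normrM pdfN (ger0_norm (pdf_ge0 _)).
    have := sin1 (phi + t * n.+1%:R); have := sin1 (phi + t * - n.+1%:R).
    have := pdf_ge0 n.+1%:R; move: pb; set q := pdf _; set a := `|_|; set b := `|_|.
    nra.
  apply/norm_cvg0P.
  apply: (@squeeze_cvgr _ _ _ _ (fun=> 0) (fun n => (4 * normal_peak 1) * harmonic n)).
  - by near=> n; rewrite normr_ge0/=; exact: bound.
  - exact: cvg_cst.
  - rewrite -(mulr0 (4 * normal_peak 1)); apply: cvgM; first exact: cvg_cst.
    exact: cvg_harmonic.
have cv : ((\int[mu]_(x in setT) ((EFin \o s) \_ (I n)) x)%E @[n --> \oo]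
    --> (\int[mu]_(x in setT) (s x)%:E)%E).
  apply: (@dominated_cvg _ _ _ mu setT measurableT _ _ (fun x => `|(s x)%:E|%E)) => //.
  - move=> n; apply/(measurable_restrictT _ _).1; first exact: measurable_itv.
    apply: measurable_funTS; apply/measurable_EFinP; exact: continuous_measurable_fun.
  - move=> x _; apply: cvg_near_cst.
    have [N NX] : exists N : nat, `|x| < N%:R by exists (Num.bound `|x|); exact: archi_boundP.
    near=> n; rewrite patchE ifT// inE /I/= in_itv/=.
    rewrite -ler_norml (le_trans (ltW NX))// ler_nat.
    by near: n; exists N => // n /= Nn; exact: leq_trans Nn _.
  - exact: integrable_abse.
  - move=> n x _; rewrite patchE; case: ifP => // _.
    by rewrite abse0 abse_ge0.
have s00 : (\int[mu]_x (s x)%:E = 0)%E.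
  apply: (@cvg_unique _ _ _ _ _ _ cv) => //.
  have -> : (fun n => (\int[mu]_(x in setT) ((EFin \o s) \_ (I n)) x)%E) =
     (fun n => (wave sin t n.+1%:R - wave sin t (- n.+1%:R))%:E).
    by apply/funext => n; rewrite -ftc [RHS]integral_mkcond.
  by apply: cvg_EFin lim0; near=> n.
have : (\int[mu]_x (s x))%R = 0 by rewrite /Rintegral s00.
rewrite /s RintegralB//; last exact: integrable_xwave.
rewrite RintegralZl//; last exact: integrable_wave.
by rewrite -/(F t) => /eqP; rewrite subr_eq0 => /eqP.
Unshelve. all: by end_near. Qed.

(** By the two lemmas above, [F] solves [F' = - t F]. *)
Lemma fourier_normal01 t : F t = cos phi * expR (- (t ^+ 2 / 2)).
Proof.
pose H (t : R) := F t * expR (t ^+ 2 / 2).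
have dH (u : R) : is_derive u (1 : R) H 0.
  have d1 := fourier_derive u; rewrite fourier_parts in d1.
  have d2 : is_derive u (1 : R) (fun z : R => z ^+ 2 / 2) u.
    by apply: is_derive_eq; rewrite /GRing.scale/=; lra.
  have d3 := @is_derive1_comp _ expR _ _ _ _ (is_derive_expR _) d2.
  rewrite /H; apply: is_derive_eq; rewrite /GRing.scale/=; ring.
have := is_derive_0_is_cst t 0 dH; rewrite /H expr0n/= mul0r expR0 mulr1.
have -> : F 0 = cos phi.
  rewrite /F /wave; under eq_Rintegral do rewrite mul0r addr0.
  rewrite RintegralZl//.
  by rewrite /Rintegral integral_normal_pdf mulr1.
by move=> <-; rewrite -mulrA -expRD subrr expR0 mulr1.
Qed.

Lemma cos_normal01 t :
  (\int[normal_prob 0 1]_x (cos (phi + t * x))%:E =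
   (cos phi * expR (- (t ^+ 2 / 2)))%:E)%E.
Proof.
rewrite (integral_normal01 (f := fun x => cos (phi + t * x))).
- rewrite -fourier_normal01 /F /Rintegral fineK//.
  exact: (integrable_fin_num measurableT (integrable_wave t ccos cos1)).
- apply: continuous_measurable_fun => x; apply: continuous_comp; last exact: ccos.
  by apply: continuousD; [exact: cst_continuous|apply: continuousM => //; exact: cst_continuous].
- by exists 1.
Qed.

End Fourier.
End GaussianCharacteristic.

Section GaussianVector.
Context {R : realType}.
Local Notation TR := (measurableTypeR R).

Lemma bounded_integrable d (T : measurableType d) (P : probability T R) (f : T -> R) (M : R) :
  measurable_fun setT f -> (forall x, `|f x| <= M) -> P.-integrable setT (EFin \o f).
Proof.
move=> mf fM; apply: measurable_bounded_integrable => //.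
  exact: (le_lt_trans (probability_le1 P measurableT) (ltry 1)).
exists M; split; first exact: num_real.
by move=> y My x _ /=; apply: (le_trans (fM x)); exact: ltW.
Qed.

Lemma norm_cos_le1 (x : R) : `|cos x| <= 1.
Proof. by rewrite ler_norml cos_geN1 cos_le1. Qed.

Lemma measurable_wave p (phi : R) (t : 'I_p -> R) :
  measurable_fun setT (fun x : p.-tuple TR => cos (phi + \sum_a t a * tnth x a)).
Proof.
apply: (measurableT_comp (f := @cos R)).
  by apply: continuous_measurable_fun; exact: continuous_cos.
apply: measurable_funD => //.
apply: measurable_sum => a; apply: measurable_funM => //.
exact: measurable_tnth.
Qed.

(** Fubini, one coordinate at a time; the arbitrary phase absorbs the first coordinate. *)
Lemma cos_std_normal p (phi : R) (t : 'I_p -> R) :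
  (\int[std_normal R p]_x (cos (phi + \sum_a t a * tnth x a))%:E =
   (cos phi * expR (- ((\sum_a t a ^+ 2) / 2)))%:E)%E.
Proof.
elim: p phi t => [|p IH] phi t.
  rewrite big_ord0 mul0r oppr0 expR0 mulr1 /=.
  rewrite integral_dirac//; last first.
    by apply/measurable_EFinP; exact: measurable_wave.
  by rewrite diracT mul1e big_ord0 addr0.
pose f (z : TR * p.-tuple TR) : R :=
  cos (phi + t ord0 * z.1 + \sum_a t (lift ord0 a) * tnth z.2 a).
have fE z : cos (phi + \sum_a t a * tnth (@consT R p z) a) = f z.
  rewrite big_ord_recl addrA /f; congr (cos (_ + _ * _ + _)).
  by apply: eq_bigr => a _; rewrite /consT tnthS.
have mf : measurable_fun setT f.
  rewrite (_ : f = (fun x : p.+1.-tuple TR => cos (phi + \sum_a t a * tnth x a)) \o @consT R p).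
    by apply: measurableT_comp; [exact: measurable_wave|exact: measurable_consT].
  by apply/funext => z; rewrite /= fE.
rewrite /= integral_distribution; last 2 first.
- by apply/measurable_EFinP; exact: measurable_wave.
- apply: (@bounded_integrable _ _ _ _ 1); last by move=> x; exact: norm_cos_le1.
  by apply: (measurableT_comp (measurable_wave _ _)); exact: measurable_consT.
under eq_integral do rewrite /= fE.
rewrite -(integral12_prod_meas1 (f := EFin \o f)); last first.
  apply: (@bounded_integrable _ _ _ _ 1) => // x; exact: norm_cos_le1.
pose e := expR (- ((\sum_(a < p) t (lift ord0 a) ^+ 2) / 2)).
transitivity (\int[normal_prob 0 1]_x ((cos (phi + t ord0 * x))%:E * e%:E))%E.
  by apply: eq_integral => x _; rewrite /fubini_F /= /f /= IH EFinM.
rewrite integralZr//; last first.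
  refine (@bounded_integrable _ TR (normal_prob 0 1 : probability TR R)
    (fun x : TR => cos (phi + t ord0 * x)) 1 _ _); last by move=> x; exact: norm_cos_le1.
  apply: (measurableT_comp (f := @cos R)); last by do 2 apply: measurable_funD => //.
  by apply: continuous_measurable_fun; exact: continuous_cos.
rewrite cos_normal01 -EFinM; congr EFin; rewrite -mulrA -expRD; congr (_ * expR _).
by rewrite big_ord_recl mulrDl opprD.
Qed.

End GaussianVector.

(** * Convergence in law from cosines *)

(** Expectations before the limit are finite sums, those of the limit are integrals; the
    convergence theorems below only use these four properties of the former. *)
Record mean_functional (R : realType) (T : Type) (E : (T -> R) -> R) : Prop :=
  MeanFunctional {
    mean_add : forall f g, E (fun x => f x + g x) = E f + E g;
    mean_scale : forall c f, E (fun x => c * f x) = c * E f;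
    mean_le : forall f g, (forall x, f x <= g x) -> E f <= E g;
    mean_cst : forall c, E (fun=> c) = c }.

Section MeanFunctional.
Context {R : realType} {T : Type} {E : (T -> R) -> R} (EM : mean_functional E).

Lemma eq_mean f g : f =1 g -> E f = E g.
Proof. by move=> fg; apply/eqP; rewrite eq_le !(mean_le EM)// => x; rewrite fg. Qed.

Lemma mean_sum (J : Type) (r : seq J) (F : J -> T -> R) :
  E (fun x => \sum_(j <- r) F j x) = \sum_(j <- r) E (F j).
Proof.
elim: r => [|j r IH].
  by rewrite big_nil -[RHS](mean_cst EM); apply: eq_mean => x; rewrite big_nil.
rewrite big_cons -IH -(mean_add EM); apply: eq_mean => x; by rewrite big_cons.
Qed.

Lemma mean_sub f g : E (fun x => f x - g x) = E f - E g.
Proof.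
rewrite -mulN1r -(mean_scale EM) -(mean_add EM).
by apply: eq_mean => x; rewrite mulN1r.
Qed.

Lemma mean_dist_le f g h : (forall x, `|f x - g x| <= h x) -> `|E f - E g| <= E h.
Proof.
move=> fgh; rewrite -mean_sub ler_norml -mulN1r -(mean_scale EM).
by apply/andP; split; apply: (mean_le EM) => x; have := fgh x; rewrite ler_norml ?mulN1r => /andP[].
Qed.

End MeanFunctional.

Section WeakConvergence.
Context {R : realType} {p : nat}.
Local Notation TR := (measurableTypeR R).
Local Notation gauss := (std_normal R p).

Let tcol (x : p.-tuple TR) : 'cV[R]_p := \col_a tnth x a.

Let gmean (t : 'cV[R]_p) (phi : R) : R := cos phi * expR (- ((\sum_a t a 0 ^+ 2) / 2)).

Let trigE (q : R * 'cV[R]_p * R) (x : p.-tuple TR) :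
  cos (q.2 + dotv q.1.2 (tcol x)) = cos (q.2 + \sum_a q.1.2 a 0 * tnth x a).
Proof. by congr (cos (_ + _)); apply: eq_bigr => a _; rewrite mxE. Qed.

Lemma measurable_trig g : trig_poly g -> measurable_fun setT (g \o tcol).
Proof.
move=> [s sE].
rewrite (_ : g \o tcol = (fun x => \sum_(q <- s) q.1.1 * cos (q.2 + \sum_a q.1.2 a 0 * tnth x a))).
  by apply: measurable_sum => q; apply: measurable_funM => //; exact: measurable_wave.
by apply/funext => x; rewrite /= sE; apply: eq_bigr => q _; rewrite trigE.
Qed.

Lemma integral_trig (s : seq (R * 'cV[R]_p * R)) :
  (\int[gauss]_x (\sum_(q <- s) q.1.1 * cos (q.2 + dotv q.1.2 (tcol x)))%:E =
   (\sum_(q <- s) q.1.1 * gmean q.1.2 q.2)%:E)%E.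
Proof.
elim: s => [|q s IH].
  by rewrite big_nil; under eq_integral do rewrite big_nil; rewrite integral0.
have iq (r : R * 'cV[R]_p * R) : gauss.-integrable setT
    (fun x => (r.1.1 * cos (r.2 + dotv r.1.2 (tcol x)))%:E).
  apply: (@bounded_integrable _ _ _ _ _ `|r.1.1|).
    apply: measurable_funM => //; under eq_fun do rewrite trigE; exact: measurable_wave.
  by move=> x; rewrite normrM ler_piMr// norm_cos_le1.
under eq_integral do rewrite big_cons EFinD.
have is2 : gauss.-integrable setT
    (fun x => (\sum_(r <- s) r.1.1 * cos (r.2 + dotv r.1.2 (tcol x)))%:E).
  under eq_fun do rewrite -sumEFin.
  by apply: integrable_sum => // r _; exact: iq.
rewrite (integralD measurableT (iq q) is2) IH big_cons EFinD; congr (_ + _)%E.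
under eq_integral do rewrite EFinM trigE.
rewrite integralZl//; last first.
  by apply: (@bounded_integrable _ _ _ _ _ 1); [exact: measurable_wave|move=> x; exact: norm_cos_le1].
by rewrite cos_std_normal.
Qed.

(** Continuity theorem. On a large box the test function is close to a bounded
    trigonometric polynomial, off the box the second moments give little mass, and the
    integrals of the polynomials converge by dominated convergence. Cosines with all
    phases play the part of complex exponentials. *)
Theorem cvg_mean_normal (T : nat -> Type) (E : forall k, (T k -> R) -> R)
    (xi : forall k, T k -> 'cV[R]_p) (C : R) (f : 'cV[R]_p -> R) (M : R) :
  (\forall k \near \oo, mean_functional (E k)) ->
  (\forall k \near \oo, forall a, E k (fun w => xi k w a 0 ^+ 2) <= C) ->
  (forall phi t, E k (fun w => cos (phi + dotv t (xi k w))) @[k --> \oo] --> gmean t phi) ->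
  continuous f -> (forall x, `|f x| <= M) ->
  (E k (fun w => f (xi k w)))%:E @[k --> \oo] --> (\int[gauss]_x (f (tcol x))%:E)%E.
Proof.
move=> Emean tight cfc cf fM.
have M0 : 0 <= M := le_trans (normr_ge0 _) (fM 0).
have approx j : exists g : 'cV[R]_p -> R, [/\ trig_poly g, forall x, `|g x| <= M &
    forall x : 'cV[R]_p, (forall a, `|x a 0| <= j.+1%:R) -> `|f x - g x| <= j.+1%:R^-1].
  by apply: trig_approx => //; rewrite ?ltr0n ?invr_gt0 ?ltr0n.
have [g gP] := choice approx.
have gtrig j : trig_poly (g j) by have [] := gP j.
have gM j x : `|g j x| <= M by have [] := gP j.
have gf j (x : 'cV[R]_p) : (forall a, `|x a 0| <= j.+1%:R) -> `|f x - g j x| <= j.+1%:R^-1.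
  by have [_ _ h] := gP j; exact: h.
have gf_cvg x : g j (tcol x) @[j --> \oo] --> f (tcol x).
  apply/cvgrPdist_le => e e0.
  have [N NX] : exists N : nat, e^-1 + \sum_a `|tcol x a 0| < N%:R.
    exists (Num.bound (e^-1 + \sum_a `|tcol x a 0|)); apply: archi_boundP.
    by rewrite addr_ge0 ?invr_ge0 ?(ltW e0)// sumr_ge0.
  have ei : 0 < e^-1 by rewrite invr_gt0.
  near=> j; have jN : N%:R <= j.+1%:R :> R.
    by rewrite ler_nat; apply: leqW; near: j; exists N.
  apply: (le_trans (gf j _ _)) => [a|].
    apply: le_trans jN; apply: le_trans (ltW NX).
    by rewrite (bigD1 a)//= addrCA lerDl addr_ge0 ?(ltW ei)// sumr_ge0.
  rewrite -[leRHS]invrK lef_pV2 ?posrE ?ltr0n//.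
  apply: le_trans jN; apply: le_trans (ltW NX).
  by rewrite lerDl sumr_ge0.
have mf : measurable_fun setT (f \o tcol).
  apply: (@measurable_fun_cvg _ _ _ _ (fun j => g j \o tcol)).
    by move=> j; exact: measurable_trig.
  by move=> x _; exact: gf_cvg.
have gint : (\int[gauss]_x (g j (tcol x))%:E)%E @[j --> \oo] --> (\int[gauss]_x (f (tcol x))%:E)%E.
  apply: (@dominated_cvg _ _ _ gauss setT measurableT _ _ (fun=> M%:E)) => //.
  - by move=> j; apply/measurable_EFinP; exact: measurable_trig.
  - by move=> x _; apply: cvg_EFin; [exact: nearW|exact: gf_cvg].
  - by apply: (@bounded_integrable _ _ _ gauss (fun=> M) `|M|).
  - by move=> n x _; rewrite abse_EFin lee_fin; exact: gM.
have [c cE] : exists c, (\int[gauss]_x (f (tcol x))%:E)%E = c%:E.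
  exists (fine (\int[gauss]_x (f (tcol x))%:E)%E); rewrite fineK//.
  apply: integrable_fin_num => //.
  by apply: (@bounded_integrable _ _ _ gauss (f \o tcol) M) => // x; exact: fM.
have gs j : exists s, forall x, g j x = \sum_(q <- s) q.1.1 * cos (q.2 + dotv q.1.2 x).
  exact: gtrig.
have [s sE] := choice gs.
pose d j : R := \sum_(q <- s j) q.1.1 * gmean q.1.2 q.2.
have dE j : (\int[gauss]_x (g j (tcol x))%:E)%E = (d j)%:E.
  by rewrite -integral_trig; apply: eq_integral => x _; rewrite sE.
have dc : d j @[j --> \oo] --> c.
  move: gint; rewrite cE (_ : (fun j => _) = EFin \o d); last by apply/funext => j; rewrite dE.
  by move/fine_cvgP => [].
rewrite cE; apply: cvg_EFin; first exact: nearW.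
have Eg j : E k (fun w => g j (xi k w)) @[k --> \oo] --> d j.
  apply: (@cvg_trans _ ((\sum_(q <- s j) q.1.1 * E k (fun w => cos (q.2 + dotv q.1.2 (xi k w)))) @[k --> \oo])).
    apply: near_eq_cvg; near=> k.
    have Ek : mean_functional (E k) by near: k.
    rewrite (eq_mean Ek (g := fun w => \sum_(q <- s j) q.1.1 * cos (q.2 + dotv q.1.2 (xi k w)))).
      by rewrite (mean_sum Ek); apply: eq_bigr => q _; rewrite (mean_scale Ek).
    by move=> w; rewrite sE.
  apply: (@cvg_big R^o _ +%R 0 xpredT); first exact: add_continuous.
  by move=> q _; apply: cvgM; [exact: cvg_cst|exact: cfc].
apply/cvgrPdist_le => e e0.
pose X := 2 * M * p%:R * `|C|.
have X0 : 0 <= X by rewrite !mulr_ge0.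
have e40 : 0 < e / 4 by rewrite divr_gt0.
have [N NX] : exists N : nat, (1 + X) / (e / 4) < N%:R.
  by exists (Num.bound ((1 + X) / (e / 4))); apply: archi_boundP; rewrite divr_ge0 ?addr_ge0 ?(ltW e40).
have [j [jN dj]] : exists j, (N <= j)%N /\ `|c - d j| <= e / 4.
  move/cvgrPdist_le : dc => /(_ _ e40)[N' _ N'P].
  by exists (maxn N N'); rewrite leq_maxl; split => //; apply: N'P; rewrite /= leq_maxr.
have J0 : 0 < j.+1%:R :> R by rewrite ltr0n.
have small : j.+1%:R^-1 + X / j.+1%:R <= e / 4.
  rewrite -[X in X + _]mul1r -mulrDl ler_pdivrMr// mulrC -ler_pdivrMr//.
  by rewrite (le_trans (ltW NX))// ler_nat leqW.
near=> k.
have Ek : mean_functional (E k) by near: k.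
have tk : forall a, E k (fun w => xi k w a 0 ^+ 2) <= C by near: k.
have gk : `|d j - E k (fun w => g j (xi k w))| <= e / 4.
  by near: k; move: (Eg j) => /cvgrPdist_le; apply.
have fg : `|E k (fun w => f (xi k w)) - E k (fun w => g j (xi k w))| <= e / 4.
  have point w : `|f (xi k w) - g j (xi k w)| <=
     j.+1%:R^-1 + (2 * M / j.+1%:R ^+ 2) * \sum_a xi k w a 0 ^+ 2.
    have s0 : 0 <= \sum_a xi k w a 0 ^+ 2 by apply: sumr_ge0 => a _; exact: sqr_ge0.
    have c0 : 0 <= 2 * M / j.+1%:R ^+ 2 by rewrite divr_ge0 ?mulr_ge0 ?sqr_ge0.
    have [box|/existsNP[a /negP]] := pselect (forall a, `|xi k w a 0| <= j.+1%:R).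
      by rewrite (le_trans (gf _ _ box))// lerDl mulr_ge0.
    rewrite -ltNge => out; apply: (@le_trans _ _ (2 * M)).
      rewrite (le_trans (ler_normB _ _))//; have := fM (xi k w); have := gM j (xi k w); lra.
    apply: (@le_trans _ _ ((2 * M / j.+1%:R ^+ 2) * \sum_a xi k w a 0 ^+ 2)); last by rewrite lerDr invr_ge0 ltW.
    rewrite -mulrA ler_peMr ?mulr_ge0//.
    rewrite ler_pdivlMl ?exprn_gt0// mulr1 (bigD1 a)//= -[leLHS]addr0 lerD//.
    by rewrite -[leRHS]real_normK ?num_real// ler_pXn2r ?nnegrE ?(ltW J0)// ltW.
    by apply: sumr_ge0 => *; exact: sqr_ge0.
  apply: (le_trans (mean_dist_le Ek point)).
  rewrite (mean_add Ek) (mean_cst Ek) (mean_scale Ek) (mean_sum Ek).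
  apply: le_trans small; rewrite lerD2l.
  apply: (@le_trans _ _ (2 * M / j.+1%:R ^+ 2 * (p%:R * `|C|))).
    rewrite ler_wpM2l ?divr_ge0 ?mulr_ge0 ?sqr_ge0//.
    rewrite -[leRHS](_ : \sum_(a < p) `|C| = _); last by rewrite sumr_const card_ord mulr_natl.
    by apply: ler_sum => a _; apply: (le_trans (tk a)); exact: ler_norm.
  rewrite [leLHS](_ : _ = X * (j.+1%:R^-1 * j.+1%:R^-1)); last first.
    by rewrite /X -exprVn; move: (j.+1%:R^-1 : R) => q; ring.
  rewrite ler_wpM2l// ler_piMr ?invr_ge0// invf_le1// ler1n//.
have -> : c - E k (fun w => f (xi k w)) = (c - d j) + (d j - E k (fun w => g j (xi k w)))
   - (E k (fun w => f (xi k w)) - E k (fun w => g j (xi k w))) by ring.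
rewrite (le_trans (ler_normB _ _))//; have := ler_normD (c - d j) (d j - E k (fun w => g j (xi k w))).
move: fg gk dj; set a1 := `|_|; set a2 := `|_|; set a3 := `|_|; set a4 := `|_|; lra.
Unshelve. all: by end_near. Qed.

End WeakConvergence.

(** Slutsky's theorem in multiplicative form: a random matrix factor that tends to the
    identity does not change the Gaussian limit. The number [e k w] measures the
    perturbation; where it exceeds [d0], or where [xi] is large, the difference of the two
    values of [f] is bounded by [2 * M] and its contribution by Chebyshev's inequality. *)
Theorem cvg_mean_slutsky (R : realType) (p : nat) (T : nat -> Type)
    (E : forall k, (T k -> R) -> R) (xi eta : forall k, T k -> 'cV[R]_p)
    (e : forall k, T k -> R) (C A d0 : R) (f : 'cV[R]_p -> R) (M : R) :
  (\forall k \near \oo, mean_functional (E k)) ->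
  (\forall k \near \oo, forall a, E k (fun w => xi k w a 0 ^+ 2) <= C) ->
  (forall phi t, E k (fun w => cos (phi + dotv t (xi k w))) @[k --> \oo] -->
     (cos phi * expR (- ((\sum_a t a 0 ^+ 2) / 2)) : R)) ->
  0 < d0 ->
  (\forall k \near \oo, forall w, 0 <= e k w /\ (e k w <= d0 ->
     exists2 Q : 'M[R]_p, eta k w = Q *m xi k w & enorm (Q - 1%:M) <= A * e k w)) ->
  E k (fun w => e k w ^+ 2) @[k --> \oo] --> (0 : R) ->
  continuous f -> (forall x, `|f x| <= M) ->
  (E k (fun w => f (eta k w)))%:E @[k --> \oo] -->
    (\int[std_normal R p]_x (f (\col_a tnth x a))%:E)%E.
Proof.
move=> Emean tight cfc d00 near_id e_to0 cf fM.
have M0 : 0 <= M := le_trans (normr_ge0 _) (fM 0).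
have fxi := cvg_mean_normal Emean tight cfc cf fM.
suff diff : (E k (fun w => f (eta k w)) - E k (fun w => f (xi k w))) @[k --> \oo] --> (0 : R).
  rewrite (_ : (fun k => _) = (fun k => (E k (fun w => f (xi k w)))%:E +
     (E k (fun w => f (eta k w)) - E k (fun w => f (xi k w)))%:E)%E); last first.
    by apply/funext => k; rewrite -EFinD addrC subrK.
  rewrite -[X in _ --> X]adde0; apply: cvgeD.
  - exact: fin_num_adde_defl.
  - exact: fxi.
  - apply: cvg_EFin; last exact: diff.
    exact: nearW.
apply/cvgrPdist_le => eps eps0; have e30 : 0 < eps / 3 by rewrite divr_gt0.
pose X := 2 * M * p%:R * `|C|; have X0 : 0 <= X by rewrite !mulr_ge0.
(* the event that [xi] leaves the box of radius [L] costs at most [eps / 3] *)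
pose L := 1 + X / (eps / 3); have L1 : 1 <= L by rewrite lerDl divr_ge0 ?(ltW e30).
have L0 : 0 < L by exact: lt_le_trans L1.
have [dl dl0 fdl] := @uniform_on_box R p f id L cf (fun _ _ => @cvg_id _ _) _ e30.
(* in the box, a perturbation of size [d1] moves [xi] by less than [dl] *)
pose D := `|A| * (p%:R * L); have D0 : 0 <= D by rewrite !mulr_ge0// ltW.
pose d1 := Num.min d0 (dl / (D + 1)).
have d10 : 0 < d1 by rewrite lt_min d00 divr_gt0// ltr_wpDl.
pose Y := 2 * M / d1 ^+ 2; have Y0 : 0 <= Y by rewrite divr_ge0 ?sqr_ge0 ?mulr_ge0.
have Ysmall : 0 < (eps / 3) / (Y + 1) by rewrite divr_gt0// ltr_wpDl.
near=> k.
have Ek : mean_functional (E k) by near: k.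
have tk : forall a, E k (fun w => xi k w a 0 ^+ 2) <= C by near: k.
have ek : E k (fun w => e k w ^+ 2) <= (eps / 3) / (Y + 1).
  have : `|0 - E k (fun w => e k w ^+ 2)| <= (eps / 3) / (Y + 1).
    by near: k; move/cvgrPdist_le : e_to0; apply.
  by rewrite sub0r normrN; apply: le_trans; exact: ler_norm.
have nk w : 0 <= e k w /\ (e k w <= d0 ->
     exists2 Q : 'M[R]_p, eta k w = Q *m xi k w & enorm (Q - 1%:M) <= A * e k w).
  by move: w; near: k.
have point w : `|f (eta k w) - f (xi k w)| <=
    eps / 3 + (Y * e k w ^+ 2 + (2 * M / L ^+ 2) * \sum_a xi k w a 0 ^+ 2).
  have [ew0 ew] := nk w.
  have s0 : 0 <= \sum_a xi k w a 0 ^+ 2 by apply: sumr_ge0 => a _; exact: sqr_ge0.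
  have Z0 : 0 <= (2 * M / L ^+ 2) * \sum_a xi k w a 0 ^+ 2.
    by rewrite mulr_ge0// divr_ge0 ?sqr_ge0 ?mulr_ge0.
  have F0 : 0 <= Y * e k w ^+ 2 by rewrite mulr_ge0 ?sqr_ge0.
  have f2M : `|f (eta k w) - f (xi k w)| <= 2 * M.
    by rewrite (le_trans (ler_normB _ _))//; have := fM (xi k w); have := fM (eta k w); lra.
  have [ed1|ed1] := leP (e k w) d1; last first.
    have h : 2 * M <= Y * e k w ^+ 2.
      rewrite /Y -mulrA ler_peMr ?mulr_ge0// ler_pdivlMl ?exprn_gt0// mulr1.
      by rewrite ler_pXn2r ?nnegrE// ltW.
    by rewrite (le_trans f2M)// (le_trans h)// addrCA lerDl addr_ge0// ltW.
  have [box|/existsNP[a /negP]] := pselect (forall a, `|xi k w a 0| <= L); last first.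
    rewrite -ltNge => out.
    have h : 2 * M <= (2 * M / L ^+ 2) * \sum_a xi k w a 0 ^+ 2.
      rewrite -mulrA ler_peMr ?mulr_ge0//.
      rewrite ler_pdivlMl ?exprn_gt0// mulr1 (bigD1 a)//= -[leLHS]addr0 lerD//.
        by rewrite -[leRHS]real_normK ?num_real// ler_pXn2r ?nnegrE ?(ltW L0)// ltW.
      by apply: sumr_ge0 => *; exact: sqr_ge0.
    by rewrite (le_trans f2M)// (le_trans h)// addrA lerDr addr_ge0// ltW.
  have [|Q etaE Q1] := ew _; first by rewrite (le_trans ed1)// ge_min lexx.
  have close a : `|eta k w a 0 - xi k w a 0| < dl.
    have -> : eta k w a 0 - xi k w a 0 = ((Q - 1%:M) *m xi k w) a 0.
      by rewrite mulmxBl mul1mx etaE !mxE.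
    apply: (le_lt_trans (entry_le_enorm _ _ _)); apply: (le_lt_trans (enormM _ _)).
    have xiL : enorm (xi k w) <= p%:R * L.
      rewrite -[p in p%:R]muln1; apply: enorm_le_entries => i j.
      by rewrite ord1; exact: box.
    apply: (@le_lt_trans _ _ (`|A| * e k w * (p%:R * L))).
      apply: ler_pM => //; try exact: enorm_ge0.
      by rewrite (le_trans Q1)// ler_wpM2r// ler_norm.
    rewrite mulrAC -/D; apply: (@le_lt_trans _ _ (D * (dl / (D + 1)))).
      by rewrite ler_wpM2l// (le_trans ed1)// ge_min lexx orbT.
    rewrite mulrA ltr_pdivrMr ?ltr_wpDl//; nra.
  have colE (v : 'cV[R]_p) : \col_a (id (v a 0)) = v.
    by apply/colP => a; rewrite mxE.
  have := fdl (fun a => eta k w a 0) (fun a => xi k w a 0).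
  rewrite !colE => /(_ _ close) h.
  apply: (@le_trans _ _ (eps / 3)); first by apply/ltW/h => a; rewrite -ler_norml.
  by rewrite lerDl addr_ge0.
rewrite sub0r normrN; apply: (le_trans (mean_dist_le Ek point)).
rewrite !(mean_add Ek) (mean_cst Ek) !(mean_scale Ek) (mean_sum Ek).
have h1 : Y * E k (fun w => e k w ^+ 2) <= eps / 3.
  apply: (@le_trans _ _ (Y * ((eps / 3) / (Y + 1)))); first by rewrite ler_wpM2l.
  rewrite mulrA ler_pdivrMr ?ltr_wpDl//; nra.
have h2 : 2 * M / L ^+ 2 * (\sum_a E k (fun w => xi k w a 0 ^+ 2)) <= eps / 3.
  apply: (@le_trans _ _ (2 * M / L ^+ 2 * (p%:R * `|C|))).
    rewrite ler_wpM2l ?divr_ge0 ?sqr_ge0 ?mulr_ge0//.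
    rewrite -[leRHS](_ : \sum_(a < p) `|C| = _); last by rewrite sumr_const card_ord mulr_natl.
    by apply: ler_sum => a _; apply: (le_trans (tk a)); exact: ler_norm.
  rewrite (_ : 2 * M / L ^+ 2 * (p%:R * `|C|) = X / L ^+ 2); last first.
    by rewrite /X; move: (L ^+ 2)^-1 => q; ring.
  rewrite ler_pdivrMr ?exprn_gt0//.
  have LX : X <= (eps / 3) * L by rewrite mulrC -ler_pdivrMr// lerDr.
  apply: (le_trans LX); rewrite ler_wpM2l ?(ltW e30)// expr2 ler_peMl// ltW//.
lra.
Unshelve. all: by end_near. Qed.

(** * The law of the sketch *)

Section FiniteValued.
Context (R : realType) (d : measure_display) (T : measurableType d).
Context (P : probability T R).

Lemma expectation_finite (J : finType) (Z : T -> J) (F : J -> R) (q : J -> R) :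
  (forall j, measurable (Z @^-1` [set j])) ->
  (forall j, P (Z @^-1` [set j]) = (q j)%:E) ->
  ('E_P[fun w => F (Z w)] = (\sum_j q j * F j)%:E)%E.
Proof.
move=> mZ PZ; rewrite unlock.
have ind j : P.-integrable setT (fun w => (\1_(Z @^-1` [set j]) w : R)%:E).
  apply: (@bounded_integrable _ _ _ _ _ 1); first exact: measurable_indic.
  by move=> w; rewrite indicE; case: (_ \in _); rewrite ?normr1 ?normr0.
transitivity (\int[P]_w \sum_j (F j)%:E * (\1_(Z @^-1` [set j]) w : R)%:E)%E.
  apply: eq_integral => w _.
  rewrite (bigD1 (Z w))//= big1 ?adde0 => [|j jZ].
    by rewrite indicE mem_set//= mule1.
  by rewrite indicE memNset ?mule0//= => Zj; rewrite Zj eqxx in jZ.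
rewrite integral_sum//; last by move=> j; exact: integrableZl.
rewrite -sumEFin; apply: eq_bigr => j _.
by rewrite integralZl// integral_indic// setIT mulrC EFinM -PZ.
Qed.

End FiniteValued.

Section SketchLaw.
Context (R : realType) (d : measure_display) (T : measurableType d).
Context (P : probability T R).
Context (m l : nat) (b s : 'I_(2 ^ l) -> {RV P >-> bool}).
Local Notation g := (m%:R / (2 ^ l)%N%:R : R).

Lemma bernoulli_prob1 (q : R) v : 0 <= q <= 1 ->
  bernoulli_prob q [set v] = (if v then q else 1 - q)%:E.
Proof. by move=> q01; rewrite /bernoulli_prob q01 fsbig_set1. Qed.

(** Independence makes the probability of an outcome a product of Bernoulli weights. *)
Lemma expectation_srht (F : {ffun 'I_(2 ^ l) -> bool} -> {ffun 'I_(2 ^ l) -> bool} -> R) :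
  0 <= g <= 1 -> srht_law m b s ->
  ('E_P[fun w => F [ffun i => b i w] [ffun i => s i w]] = (sketch_exp g F)%:E)%E.
Proof.
move=> g01 [bE sE ind].
pose X (u : 'I_(2 ^ l) + 'I_(2 ^ l)) : {RV P >-> bool} :=
  match u with inl i => b i | inr i => s i end.
pose Z w := ([ffun i => b i w], [ffun i => s i w]).
pose C (z : {ffun 'I_(2 ^ l) -> bool} * {ffun 'I_(2 ^ l) -> bool}) (u : 'I_(2 ^ l) + 'I_(2 ^ l)) :=
  match u with inl i => [set z.1 i] | inr i => [set z.2 i] end.
have ZE z : Z @^-1` [set z] = \bigcap_(u in [set` [set: 'I_(2 ^ l) + 'I_(2 ^ l)]%SET])
    X u @^-1` C z u.
  case: z => z1 z2; apply/seteqP; split => w /=.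
    by move=> [<- <-] [i|i] _ /=; rewrite ffunE.
  move=> zw; congr (_, _); apply/ffunP => i; rewrite ffunE.
    by have := zw (inl i); rewrite /= inE; apply.
  by have := zw (inr i); rewrite /= inE; apply.
have mC z u : measurable (C z u) by [].
rewrite (@expectation_finite _ _ _ P _ Z (fun z => F z.1 z.2)
   (fun z => bweight (fun=> g) z.1 * bweight (fun=> 2^-1) z.2)).
- rewrite /sketch_exp /bexp; congr EFin.
  under [RHS]eq_bigr do rewrite mulr_sumr.
  by rewrite pair_bigA; apply: eq_bigr => z _; rewrite /= mulrA.
- move=> z; rewrite ZE; apply: fin_bigcap_measurable => // -[i|i] _.
    by rewrite -[X in measurable X]setTI; exact: measurable_funP.
  by rewrite -[X in measurable X]setTI; exact: measurable_funP.
- move=> z; rewrite ZE (ind _ (C z))// big_sumType/= /bweight EFinM -!prodEFin.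
  congr (_ * _)%E; apply: eq_big => [i|i _]; rewrite ?inE//.
    by rewrite -[LHS]/(distribution P (b i) _) bE bernoulli_prob1.
  rewrite -[LHS]/(distribution P (s i) _) sE bernoulli_prob1//.
  by rewrite invr_ge0 ler0n invf_le1// ler1n.
Qed.

End SketchLaw.

(** * Asymptotic normality of the sketch error *)

Section QuadraticForms.
Context {R : realType} {l m : nat}.
Local Notation n := (2 ^ l)%N.
Local Notation g := (m%:R / n%:R : R).
Context (m0 : (0 < m)%N) (g1 : g < 1).

Let n0 : (0 < n)%N. Proof. by rewrite expn_gt0. Qed.
Let nn : n%:R != 0 :> R. Proof. by rewrite pnatr_eq0 -lt0n. Qed.
Let g0 : 0 < g. Proof. by rewrite divr_gt0 ?ltr0n. Qed.
Let gn : g * n%:R = m%:R. Proof. by rewrite divfK. Qed.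

Let sumsq (a : 'cV[R]_n) : \sum_j a j 0 ^+ 2 = enorm a ^+ 2.
Proof. by rewrite sqr_enorm; apply: eq_bigr => i _; rewrite big_ord1. Qed.

Lemma srht_form_moment2 (a c : 'cV[R]_n) (B : R) : 0 < B ->
  enorm a ^+ 2 <= B -> enorm c ^+ 2 <= B ->
  sketch_exp g (fun b x => (a^T *m srht_error m b x *m c) 0 0 ^+ 2) <=
    moment_const B / m%:R.
Proof.
move=> B0 aB cB.
have := @ip_error_moment2 R n (@hsign R l) n0 (@hsign_sqr R l) g g0 g1
  (fun j => a j 0) (fun j => c j 0) B B0.
rewrite !sumsq gn => /(_ aB cB); apply: le_trans.
by rewrite le_eqVlt; apply/orP; left; apply/eqP/eq_sketch_exp => b x; rewrite srht_errorE.
Qed.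

Lemma srht_form_clt (a c : 'cV[R]_n) (al B phi : R) :
  let r := Num.sqrt (m%:R * (1 - g))^-1 in
  0 <= al -> 1 <= B -> enorm a ^+ 2 <= B -> enorm c = 1 ->
  (forall j, a j 0 ^+ 2 <= al) \/ (forall j, c j 0 ^+ 2 <= al) ->
  `|sketch_exp g (fun b x =>
      cos (phi + pivot_scale (n := n) m * (a^T *m srht_error m b x *m c) 0 0)) -
    cos phi * expR (- ((enorm a ^+ 2 + 2 * ((a^T *m c) 0 0) ^+ 2) / 2))| <=
  (r + 2 * r ^+ 2) / (1 - g) * moment_const B +
    (8 * Num.sqrt (al * (B + B ^+ 2)) + al * (B + 1)).
Proof.
move=> r al0 B1 aB c1 flat.
have c1' : \sum_j c j 0 ^+ 2 = 1 by rewrite sumsq c1 expr1n.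
have aB' : \sum_j a j 0 ^+ 2 <= B by rewrite sumsq.
have := @sketch_clt R n (@hsign R l) n0 (@hsign_sqr R l) (@hsign_col R l)
  (@hsign_row R l) g g0 g1 (fun j => a j 0) (fun j => c j 0) al B phi al0 B1 aB' c1' flat.
rewrite gn sumsq -/r.
rewrite (_ : \sum_j a j 0 * c j 0 = (a^T *m c) 0 0); last first.
  by rewrite mxE; apply: eq_bigr => j _; rewrite mxE.
apply: le_trans; rewrite le_eqVlt; apply/orP; left; apply/eqP; congr (`|_ - _|).
by apply: eq_sketch_exp => b x; rewrite srht_errorE.
Qed.

End QuadraticForms.

(** The form of [sketch_exp] to which [mean_functional] applies. *)
Definition pair_exp {R : realType} n (g : R)
    (F : {ffun 'I_n -> bool} * {ffun 'I_n -> bool} -> R) : R :=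
  sketch_exp g (fun b x => F (b, x)).

Lemma pair_exp_mean (R : realType) n (g : R) : 0 <= g <= 1 ->
  mean_functional (@pair_exp R n g).
Proof.
move=> g01; split => [f h|c f|f h fh|c].
- exact: sketch_expD.
- exact: sketch_expZ.
- by apply: ler_sketch_exp => // b x; exact: fh.
- exact: sketch_exp_cst.
Qed.

Lemma sqrt_cvg0 (R : realType) (u : nat -> R) :
  u k @[k --> \oo] --> (0 : R) -> Num.sqrt (u k) @[k --> \oo] --> (0 : R).
Proof.
move=> u0; rewrite -[X in _ --> X](@sqrtr0 R).
exact: (cvg_comp _ _ u0 (@sqrt_continuous R 0)).
Qed.

Section SketchLimit.
Context {R : realType} {p : nat} {m l : nat -> nat} {rho : R}.
Local Notation n k := (2 ^ l k)%N.
Local Notation g k := ((m k)%:R / (n k)%:R : R).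
Context (hm : m k @[k --> \oo] --> \oo) (rho1 : rho < 1)
  (hg : \forall k \near \oo, g k <= rho).

Lemma near_sample_pos : \forall k \near \oo, (0 < m k)%N.
Proof. by move/cvgnyPge : hm => /(_ 1%N). Qed.

Lemma near_fraction : \forall k \near \oo, 0 <= g k <= 1.
Proof.
near=> k; rewrite divr_ge0//= (le_trans _ (ltW rho1))//; near: k; exact: hg.
Unshelve. all: by end_near. Qed.

Lemma inv_sample_cvg0 : (m k)%:R^-1 @[k --> \oo] --> (0 : R).
Proof.
apply/cvgrPdist_le => e e0.
have [N NX] : exists N : nat, e^-1 < N%:R.
  by exists (Num.bound e^-1); apply: archi_boundP; rewrite invr_ge0 ltW.
near=> k; rewrite sub0r normrN ger0_norm ?invr_ge0// -[leRHS]invrK.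
have Nm : N%:R <= (m k)%:R :> R.
  by rewrite ler_nat; near: k; move/cvgnyPge : hm => /(_ N).
by rewrite lef_pV2 ?posrE ?invr_gt0 ?(lt_le_trans _ Nm) ?(le_trans (ltW NX))//;
  apply: lt_trans NX; rewrite invr_gt0.
Unshelve. all: by end_near. Qed.

Context {Phi : forall k, 'M[R]_(n k, p.+1)} {c : forall k, 'cV[R]_(n k)} {al : nat -> R}.
Context (limit1 : \forall k \near \oo,
  (Phi k)^T *m Phi k + 2 *: ((Phi k)^T *m c k *m ((Phi k)^T *m c k)^T) = 1%:M).
Context (c1 : \forall k \near \oo, enorm (c k) = 1).
Context (al0 : forall k, 0 <= al k) (al_to0 : al k @[k --> \oo] --> (0 : R)).
Context (flat : \forall k \near \oo, (forall j, enorm (row j (Phi k)) ^+ 2 <= al k) \/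
  (forall j, c k j 0 ^+ 2 <= al k)).

Let bits k := ({ffun 'I_(n k) -> bool} * {ffun 'I_(n k) -> bool})%type.
(** The linear part of the studentized errors. *)
Definition sketch_score k (w : bits k) : 'cV[R]_p.+1 :=
  pivot_scale (n := n k) (m k) *: ((Phi k)^T *m srht_error (m k) w.1 w.2 *m c k).

Lemma score_dotv k (w : bits k) (t : 'cV[R]_p.+1) : dotv t (sketch_score w) =
  pivot_scale (n := n k) (m k) * ((Phi k *m t)^T *m srht_error (m k) w.1 w.2 *m c k) 0 0.
Proof.
have -> : dotv t (sketch_score w) = (t^T *m sketch_score w) 0 0.
  by rewrite [RHS]mxE; apply: eq_bigr => a _; rewrite [t^T _ _]mxE.
by rewrite /sketch_score -scalemxAr mxE trmx_mul !mulmxA.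
Qed.

Lemma limit_form k (t : 'cV[R]_p.+1) :
  (Phi k)^T *m Phi k + 2 *: ((Phi k)^T *m c k *m ((Phi k)^T *m c k)^T) = 1%:M ->
  enorm (Phi k *m t) ^+ 2 + 2 * (((Phi k *m t)^T *m c k) 0 0) ^+ 2 = enorm t ^+ 2.
Proof.
move=> H; set u := (Phi k)^T *m c k in H *.
have -> : enorm t ^+ 2 = (t^T *m 1%:M *m t) 0 0 by rewrite mulmx1 sqr_enorm_col.
rewrite -H mulmxDr mulmxDl [RHS]mxE sqr_enorm_col trmx_mul !mulmxA; congr (_ + _).
rewrite -scalemxAr -scalemxAl [RHS]mxE; congr (_ * _).
rewrite -[t^T *m _ *m c k]mulmxA -/u -[RHS]/((t^T *m (u *m u^T) *m t) 0 0).
rewrite -[t^T *m (u *m u^T) *m t]mulmxA -[u *m u^T *m t]mulmxA mulmxA.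
rewrite (mxE00 (t^T *m u)) mul_scalar_mx [RHS]mxE expr2 -mxE00; congr (_ * _).
by rewrite -[u^T *m t]trmxK trmx_mul trmxK [RHS]mxE.
Qed.

Lemma score_tight : \forall k \near \oo, forall a,
  pair_exp (g k) (fun w => @sketch_score k w a 0 ^+ 2) <= moment_const 1 / (1 - rho).
Proof.
near=> k => a.
have m0 : (0 < m k)%N by near: k; exact: near_sample_pos.
have gr : g k <= rho by near: k; exact: hg.
have g1 : g k < 1 by exact: le_lt_trans rho1.
have ck : enorm (c k) = 1 by near: k.
have H : (Phi k)^T *m Phi k + 2 *: ((Phi k)^T *m c k *m ((Phi k)^T *m c k)^T) = 1%:M.
  by near: k.
pose t : 'cV[R]_p.+1 := delta_mx a 0.
have t1 : enorm t ^+ 2 = 1.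
  by rewrite sqr_enorm_col trmx_delta mul_delta_mx mxE eqxx.
have Pt : enorm (Phi k *m t) ^+ 2 <= 1.
  by rewrite -t1 -(limit_form _ H) lerDl mulr_ge0 ?sqr_ge0.
have tw w : @sketch_score k w a 0 = pivot_scale (n := n k) (m k) *
    ((Phi k *m t)^T *m srht_error (m k) w.1 w.2 *m c k) 0 0.
  rewrite -score_dotv /dotv (bigD1 a)//= big1 => [|i ia]; rewrite !mxE ?eqxx ?mul1r ?addr0//.
  by rewrite (negbTE ia) mul0r.
rewrite /pair_exp (eq_sketch_exp (G := fun b x => pivot_scale (n := n k) (m k) ^+ 2 *
    ((Phi k *m t)^T *m srht_error (m k) b x *m c k) 0 0 ^+ 2)); last first.
  by move=> b x; rewrite tw exprMn.
rewrite sketch_expZ.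
have g1' : 0 < 1 - g k by rewrite subr_gt0.
have mr : 0 < (m k)%:R :> R by rewrite ltr0n.
apply: (@le_trans _ _ (pivot_scale (n := n k) (m k) ^+ 2 * (moment_const 1 / (m k)%:R))).
  by rewrite ler_wpM2l ?sqr_ge0// srht_form_moment2// ck expr1n.
rewrite /pivot_scale sqr_sqrtr; last by rewrite divr_ge0 ?(ltW mr) ?(ltW g1').
rewrite mulrC mulrA divfK ?gt_eqF// ler_wpM2l//.
  by rewrite (le_trans ler01)// moment_const_ge1.
by rewrite lef_pV2 ?posrE ?subr_gt0// lerB.
Unshelve. all: by end_near. Qed.

Lemma score_clt phi t :
  pair_exp (g k) (fun w => cos (phi + dotv t (@sketch_score k w))) @[k --> \oo] -->
  (cos phi * expR (- ((\sum_a t a 0 ^+ 2) / 2)) : R).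
Proof.
pose B := 1 + enorm t ^+ 2; have t0 : 0 <= enorm t ^+ 2 by exact: sqr_ge0.
have B1 : 1 <= B by rewrite lerDl.
have B0 : 0 <= B by exact: le_trans B1.
have rho0 : 0 < 1 - rho by rewrite subr_gt0.
pose r k : R := Num.sqrt ((m k)%:R^-1 / (1 - rho)).
pose bd k := (r k + 2 * (r k * r k)) / (1 - rho) * moment_const B +
  (8 * Num.sqrt (al k * B * (B + B ^+ 2)) + al k * B * (B + 1)).
have bd0 : bd k @[k --> \oo] --> (0 : R).
  have r0 : r k @[k --> \oo] --> (0 : R).
    apply: sqrt_cvg0; rewrite -[X in _ --> X](mul0r (1 - rho)^-1).
    by apply: cvgMl; exact: inv_sample_cvg0.
  have s0 : Num.sqrt (al k * B * (B + B ^+ 2)) @[k --> \oo] --> (0 : R).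
    apply: sqrt_cvg0.
    rewrite -[X in _ --> X](mul0r (B + B ^+ 2)) -[X in X * (B + B ^+ 2)](mul0r B).
    by apply: cvgMl; apply: cvgMl.
  rewrite [X in _ --> X](_ : _ = (0 + 2 * (0 * 0)) / (1 - rho) * moment_const B +
    (8 * 0 + 0 * B * (B + 1))); last by rewrite !(mul0r, mulr0, addr0).
  apply: cvgD.
    by apply: cvgMl; apply: cvgMl; apply: cvgD => //; apply: cvgMr; apply: cvgM.
  by apply: cvgD; [exact: cvgMr|apply: cvgMl; exact: cvgMl].
apply/cvgrPdist_le => e e0; near=> k.
have m0 : (0 < m k)%N by near: k; exact: near_sample_pos.
have gr : g k <= rho by near: k; exact: hg.
have g1 : g k < 1 by exact: le_lt_trans rho1.
have ck : enorm (c k) = 1 by near: k.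
have H : (Phi k)^T *m Phi k + 2 *: ((Phi k)^T *m c k *m ((Phi k)^T *m c k)^T) = 1%:M.
  by near: k.
have fl : (forall j, enorm (row j (Phi k)) ^+ 2 <= al k) \/ (forall j, c k j 0 ^+ 2 <= al k).
  by near: k.
have bde : `|0 - bd k| <= e by near: k; move/cvgrPdist_le : bd0; apply.
have mr : 0 < (m k)%:R :> R by rewrite ltr0n.
have g1' : 0 < 1 - g k by rewrite subr_gt0.
rewrite distrC.
have tt : \sum_a t a 0 ^+ 2 = enorm t ^+ 2.
  by rewrite sqr_enorm; apply: eq_bigr => i _; rewrite big_ord1.
rewrite tt -(limit_form t H) /pair_exp.
rewrite (eq_sketch_exp (G := fun b x => cos (phi + pivot_scale (n := n k) (m k) *
    ((Phi k *m t)^T *m srht_error (m k) b x *m c k) 0 0))); last first.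
  by move=> b x; rewrite score_dotv.
apply: (le_trans (@srht_form_clt _ _ _ m0 g1 (Phi k *m t) (c k) (al k * B) B phi _ _ _ ck _)).
- by rewrite mulr_ge0.
- by [].
- apply: (@le_trans _ _ (enorm t ^+ 2)); last by rewrite lerDr.
  by rewrite -(limit_form t H) lerDl mulr_ge0 ?sqr_ge0.
- case: fl => [flP|flc]; [left|right] => j.
    have -> : (Phi k *m t) j 0 = (row j (Phi k) *m t) 0 0.
      by rewrite !mxE; apply: eq_bigr => i _; rewrite mxE.
    rewrite -[leLHS]real_normK ?num_real//; apply: (@le_trans _ _ ((enorm (row j (Phi k)) * enorm t) ^+ 2)).
      rewrite ler_pXn2r ?nnegrE ?mulr_ge0 ?enorm_ge0//.
      by rewrite (le_trans (entry_le_enorm _ _ _))// enormM.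
    by rewrite exprMn ler_pM ?sqr_ge0// lerDr.
  by rewrite (le_trans (flc j))// ler_peMr.
apply: le_trans bde; rewrite sub0r normrN; apply: (le_trans _ (ler_norm _)).
have rr : Num.sqrt ((m k)%:R * (1 - g k))^-1 <= r k.
  rewrite ler_wsqrtr// invfM ler_wpM2l ?invr_ge0 ?(ltW mr)//.
  by rewrite lef_pV2 ?posrE// lerB.
have mc0 : 0 <= moment_const B by rewrite (le_trans ler01)// moment_const_ge1.
rewrite /bd lerD2r ler_wpM2r//; apply: ler_pM.
- by rewrite addr_ge0 ?mulr_ge0 ?sqr_ge0 ?sqrtr_ge0.
- by rewrite invr_ge0 ltW.
- by rewrite lerD// ler_wpM2l// -expr2 ler_pXn2r ?nnegrE ?sqrtr_ge0.
- by rewrite lef_pV2 ?posrE// lerB.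
Unshelve. all: by end_near. Qed.

End SketchLimit.

Section Blocks.
Context {R : realType}.

Lemma enorm_usubmx m1 m2 n (A : 'M[R]_(m1 + m2, n)) : enorm (usubmx A) <= enorm A.
Proof.
rewrite ler_wsqrtr// [leRHS]big_split_ord/= -[leLHS]addr0 lerD//; last first.
  by do 2 (apply: sumr_ge0 => ? _); exact: sqr_ge0.
by apply: ler_sum => i _; apply: ler_sum => j _; rewrite mxE.
Qed.

Lemma enorm_dsubmx m1 m2 n (A : 'M[R]_(m1 + m2, n)) : enorm (dsubmx A) <= enorm A.
Proof.
rewrite ler_wsqrtr// [leRHS]big_split_ord/= -[leLHS]add0r lerD//.
  by do 2 (apply: sumr_ge0 => ? _); exact: sqr_ge0.
by apply: ler_sum => i _; apply: ler_sum => j _; rewrite mxE.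
Qed.

Lemma enorm_lsubmx m n1 n2 (A : 'M[R]_(m, n1 + n2)) : enorm (lsubmx A) <= enorm A.
Proof. by rewrite -enorm_trmx trmx_lsub -(enorm_trmx A) enorm_usubmx. Qed.

Lemma enorm_rsubmx m n1 n2 (A : 'M[R]_(m, n1 + n2)) : enorm (rsubmx A) <= enorm A.
Proof. by rewrite -enorm_trmx trmx_rsub -(enorm_trmx A) enorm_dsubmx. Qed.

Lemma enorm_row_mx m n1 n2 (A : 'M[R]_(m, n1)) (B : 'M[R]_(m, n2)) :
  enorm (row_mx A B) ^+ 2 = enorm A ^+ 2 + enorm B ^+ 2.
Proof.
rewrite !sqr_enorm -big_split; apply: eq_bigr => i _; rewrite big_split_ord/=.
by congr (_ + _); apply: eq_bigr => j _; rewrite ?row_mxEl ?row_mxEr.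
Qed.

(** Joining the two matrices gives a single norm that controls all the compressions. *)
Lemma compressed_blocks n q r (A : 'M[R]_(n, q)) (B : 'M[R]_(n, r)) (E : 'M[R]_n) :
  let W := row_mx A B in
  [/\ enorm (A^T *m E *m A) <= enorm (W^T *m E *m W),
      enorm (A^T *m E *m B) <= enorm (W^T *m E *m W) &
      enorm (B^T *m E *m B) <= enorm (W^T *m E *m W)].
Proof.
rewrite /= tr_row_mx mul_col_mx mul_mx_row !mul_col_mx.
set a := A^T *m E *m A; set b := A^T *m E *m B.
set c := B^T *m E *m A; set d := B^T *m E *m B.
have h1 := enorm_lsubmx (row_mx (col_mx a c) (col_mx b d)).
have h2 := enorm_rsubmx (row_mx (col_mx a c) (col_mx b d)).
rewrite row_mxKl in h1; rewrite row_mxKr in h2; split.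
- by apply: le_trans h1; rewrite -{1}(col_mxKu a c) enorm_usubmx.
- by apply: le_trans h2; rewrite -{1}(col_mxKu b d) enorm_usubmx.
- by apply: le_trans h2; rewrite -{1}(col_mxKd b d) enorm_dsubmx.
Qed.

Lemma enorm_col_le m n (A : 'M[R]_(m, n)) j : enorm (col j A) <= enorm A.
Proof.
rewrite ler_wsqrtr//; apply: ler_sum => i _; rewrite big_ord1 mxE (bigD1 j)//=.
by rewrite lerDl sumr_ge0 // => k _; exact: sqr_ge0.
Qed.

End Blocks.

(** The common form of the two claims: [G] is linear in the sketch error up to a factor
    close to the identity as soon as the compression of the error to the columns of [W] is
    small, and that compression tends to zero in mean square. *)
Theorem srht_cvg_in_law (R : realType) (p q : nat) (m l : nat -> nat) (rho : R)
    (Phi : forall k, 'M[R]_(2 ^ l k, p.+1)) (c : forall k, 'cV[R]_(2 ^ l k))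
    (al : nat -> R) (W : forall k, 'M[R]_(2 ^ l k, q)) (B A d0 : R)
    (G : forall k, 'M[R]_(2 ^ l k) -> 'cV[R]_p.+1)
    (d : nat -> measure_display) (T : forall k : nat, measurableType (d k))
    (P : forall k : nat, probability (T k) R)
    (b s : forall k : nat, 'I_(2 ^ l k) -> {RV (P k) >-> bool}) :
  m k @[k --> \oo] --> \oo -> rho < 1 ->
  (\forall k \near \oo, (m k)%:R / (2 ^ l k)%N%:R <= rho) ->
  (\forall k \near \oo,
    (Phi k)^T *m Phi k + 2 *: ((Phi k)^T *m c k *m ((Phi k)^T *m c k)^T) = 1%:M) ->
  (\forall k \near \oo, enorm (c k) = 1) ->
  (forall k, 0 <= al k) -> al k @[k --> \oo] --> (0 : R) ->
  (\forall k \near \oo, (forall j, enorm (row j (Phi k)) ^+ 2 <= al k) \/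
     (forall j, c k j 0 ^+ 2 <= al k)) ->
  0 < B -> (\forall k \near \oo, enorm (W k) ^+ 2 <= B) -> 0 < d0 ->
  (\forall k \near \oo, forall S : 'M[R]_(2 ^ l k),
     enorm ((W k)^T *m sketch_error S *m W k) <= d0 ->
     exists2 Q : 'M[R]_p.+1,
       G k S = Q *m (pivot_scale (n := (2 ^ l k)%N) (m k) *: ((Phi k)^T *m sketch_error S *m c k)) &
       enorm (Q - 1%:M) <= A * enorm ((W k)^T *m sketch_error S *m W k)) ->
  (forall k : nat, srht_law (m k) (b k) (s k)) ->
  cvg_in_law P (fun k w => G k (srht (m k) (fun i => b k i w) (fun i => s k i w)))
    (std_normal R p.+1).
Proof.
move=> hm rho1 hg limit1 c1 al0 al_to0 flat B0 WB d00 GQ law f cf [M [_ Mf]].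
pose g k : R := (m k)%:R / (2 ^ l k)%N%:R.
pose M' := M + 1; have fM x : `|f x| <= M' by apply: (Mf M') => //; rewrite ltrDl.
pose bits k := ({ffun 'I_(2 ^ l k) -> bool} * {ffun 'I_(2 ^ l k) -> bool})%type.
pose e k (w : bits k) := enorm ((W k)^T *m srht_error (m k) w.1 w.2 *m W k).
pose eta k (w : bits k) := G k (srht (m k) w.1 w.2).
have e_to0 : pair_exp (g k) (fun w => e k w ^+ 2) @[k --> \oo] --> (0 : R).
  apply: (@squeeze_cvgr _ _ _ _ (fun=> 0)
    (fun k => (q%:R * (q%:R * moment_const B)) * (m k)%:R^-1)).
  - near=> k.
    have m0 : (0 < m k)%N by near: k; exact: near_sample_pos.
    have gr : g k <= rho by near: k; exact: hg.
    have g1 : g k < 1 by exact: le_lt_trans rho1.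
    have g01 : 0 <= g k <= 1 by rewrite (ltW g1) andbT divr_ge0.
    have Ek := @pair_exp_mean R (2 ^ l k) _ g01.
    have WkB : enorm (W k) ^+ 2 <= B by near: k.
    apply/andP; split.
      by rewrite -[leLHS](mean_cst Ek); apply: (mean_le Ek) => w; exact: sqr_ge0.
    rewrite (eq_mean Ek (g := fun w => \sum_i \sum_j
       ((col i (W k))^T *m srht_error (m k) w.1 w.2 *m col j (W k)) 0 0 ^+ 2)); last first.
      move=> w; rewrite /e sqr_enorm; apply: eq_bigr => i _; apply: eq_bigr => j _.
      by rewrite tr_col -row_mul colE mulmxA -row_mul -colE !mxE.
    rewrite (mean_sum Ek).
    have ij i j : pair_exp (g k) (fun w => ((col i (W k))^T *m srht_error (m k) w.1 w.2 *m
        col j (W k)) 0 0 ^+ 2) <= moment_const B / (m k)%:R.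
      by apply: srht_form_moment2 => //; apply: le_trans WkB;
        rewrite ler_pXn2r ?nnegrE ?enorm_ge0// enorm_col_le.
    rewrite -!mulrA; apply: (@le_trans _ _ (\sum_(i < q) \sum_(j < q) moment_const B / (m k)%:R)).
      by apply: ler_sum => i _; rewrite (mean_sum Ek); apply: ler_sum.
    by rewrite sumr_const sumr_const card_ord !mulr_natl.
  - exact: cvg_cst.
  - rewrite -[X in _ --> X](mulr0 (q%:R * (q%:R * moment_const B))).
    by apply: cvgMr; exact: inv_sample_cvg0.
have near_mean : \forall k \near \oo, mean_functional (@pair_exp R (2 ^ l k) (g k)).
  near=> k; apply: pair_exp_mean; near: k; exact: near_fraction rho1 hg.
have near_lin : \forall k \near \oo, forall w, 0 <= e k w /\ (e k w <= d0 ->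
   exists2 Q : 'M[R]_p.+1, eta k w = Q *m @sketch_score R p m l Phi c k w &
     enorm (Q - 1%:M) <= A * e k w).
  by apply: filterS GQ => k Gk w; split; [exact: enorm_ge0|exact: Gk].
have := @cvg_mean_slutsky R p.+1 bits (fun k => @pair_exp R (2 ^ l k) (g k))
  (@sketch_score R p m l Phi c) eta e _ A d0 f M' near_mean
  (score_tight hm rho1 hg limit1 c1)
  (score_clt hm rho1 hg limit1 c1 al0 al_to0 flat) d00 near_lin e_to0 cf fM.
rewrite [in X in _ -> X]unlock; apply: cvg_trans; apply: near_eq_cvg; near=> k.
rewrite -(@expectation_srht R _ _ (P k) (m k) (l k) (b k) (s k)
  (fun x y => f (eta k (x, y)))) //; last by near: k; exact: near_fraction rho1 hg.
rewrite unlock; apply: eq_integral => w _; congr (f (G k (srht _ _ _)))%:E; apply/funext => i;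
  by rewrite ffunE.
Unshelve. all: by end_near. Qed.

(** * From the data to the theorem *)

Section Orthonormal.
Context {R : realType}.

Lemma enorm_orthl n q r (V : 'M[R]_(n, q)) (A : 'M[R]_(q, r)) :
  V^T *m V = 1%:M -> enorm (V *m A) = enorm A.
Proof.
move=> VV; apply/eqP; rewrite -(@eqrXn2 _ 2) ?enorm_ge0// !sqr_enormE.
by rewrite trmx_mul mulmxA -[A^T *m V^T *m V]mulmxA VV mulmx1.
Qed.

Lemma enorm_orthr n q r (V : 'M[R]_(n, q)) (A : 'M[R]_(r, q)) :
  V^T *m V = 1%:M -> enorm (A *m V^T) = enorm A.
Proof. by move=> VV; rewrite -enorm_trmx trmx_mul trmxK enorm_orthl// enorm_trmx. Qed.

Lemma enorm_orth n p (U : 'M[R]_(n, p)) : U^T *m U = 1%:M -> enorm U ^+ 2 = p%:R.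
Proof. by move=> UU; rewrite sqr_enormE UU mxtrace1. Qed.

Lemma enorm_unit n (v : 'cV[R]_n) : v != 0 -> enorm ((enorm v)^-1 *: v) = 1.
Proof.
move=> v0; rewrite enormZ ger0_norm ?invr_ge0 ?enorm_ge0// mulVf//.
by rewrite enorm_eq0.
Qed.

End Orthonormal.

(** The polar form of a full-rank design: an orthonormal frame times a symmetric
    positive definite matrix of condition number at most [kap]. *)
Record polar_form {R : realType} n p (X U : 'M[R]_(n, p.+1)) (K : 'M[R]_p.+1)
    (lam kap : R) : Prop := PolarForm {
  polar_eq : X = U *m K;
  polar_frame : U^T *m U = 1%:M;
  polar_sym : K^T = K;
  polar_pos : 0 < lam;
  polar_lb : forall v : 'cV[R]_p.+1, lam * enorm v ^+ 2 <= (v^T *m K *m v) 0 0;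
  polar_ub : enorm K <= kap * lam }.

(** Since [U L V^T = (U V^T) (V L V^T)]. *)
Lemma svd_polar (R : realType) n p (X U : 'M[R]_(n, p.+1)) L V (r : R) :
  is_svd X U L V -> L 0 ord0 / L 0 ord_max <= r ->
  polar_form X (U *m V^T) (V *m diag_mx L *m V^T) (L 0 ord_max) (Num.sqrt p.+1%:R * r).
Proof.
move=> [XE UU VV Lmon Lpos] Lr.
have VV' : V *m V^T = 1%:M by exact: mulmx1C.
have VtV : V^T^T *m V^T = 1%:M by rewrite trmxK.
split => //.
- by rewrite XE -!mulmxA [V^T *m (V *m _)]mulmxA VV mul1mx.
- by rewrite trmx_mul trmxK mulmxA -[V *m U^T *m U]mulmxA UU mulmx1.
- by rewrite !trmx_mul trmxK tr_diag_mx mulmxA.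
- move=> v; rewrite -(enorm_orthl v VtV) sqr_enorm !mulmxA -[_ *m V^T *m v]mulmxA.
  have -> : v^T *m V = (V^T *m v)^T by rewrite trmx_mul trmxK.
  set w := V^T *m v; rewrite mul_mx_diag mxE mulr_sumr; apply: ler_sum => i _.
  rewrite big_ord1 !mxE mulrAC -expr2 mulrC ler_wpM2l ?sqr_ge0//.
  by apply: Lmon; rewrite -ltnS.
- rewrite enorm_orthr// enorm_orthl//.
  have L0r : L 0 ord0 <= r * L 0 ord_max by rewrite -ler_pdivrMr.
  apply: (@le_trans _ _ (Num.sqrt p.+1%:R * L 0 ord0)); last first.
    by rewrite -mulrA ler_wpM2l ?sqrtr_ge0.
  rewrite -(@ler_pXn2r _ 2) ?nnegrE ?enorm_ge0 ?mulr_ge0 ?sqrtr_ge0 ?(ltW (Lpos _))//.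
  rewrite sqr_enorm exprMn sqr_sqrtr// mulr_natl.
  rewrite -[leRHS](_ : \sum_(i < p.+1) L 0 ord0 ^+ 2 = _); last first.
    by rewrite sumr_const card_ord.
  apply: ler_sum => i _; rewrite (bigD1 i)//= big1 => [|j ji].
    by rewrite addr0 mxE eqxx mulr1n ler_pXn2r ?nnegrE ?(ltW (Lpos _))// Lmon.
  by rewrite mxE eq_sym (negbTE ji) mulr0n expr0n.
Qed.

Section Linearisation.
Context {R : realType} {n p : nat} {X U : 'M[R]_(n, p.+1)} {K : 'M[R]_p.+1} {lam kap : R}.
Context (XUK : polar_form X U K lam kap) (y : 'cV[R]_n) (m : nat).
Let eps := residual X y (ols X y).
Let c := (enorm eps)^-1 *: eps.

Lemma residual_frame : U^T *m c = 0.
Proof.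
rewrite /c /eps -scalemxAr (polar_eq XUK) (residual_orth _ _ _ (polar_lb XUK)) ?scaler0//.
- exact: polar_frame XUK.
- exact: polar_sym XUK.
- exact: polar_pos XUK.
Qed.

Lemma pivot_s_linear (S : 'M[R]_n) (b : 'cV[R]_p.+1) :
  let e := enorm ((row_mx U c)^T *m sketch_error S *m row_mx U c) in
  eps != 0 ->
  (gram (S *m X) \in unitmx -> b = ols (S *m X) (S *m y)) ->
  const_root (p := p) (kap := kap) * e <= 1 ->
  exists2 Q : 'M[R]_p.+1,
    pivot_s m S X y b = Q *m (pivot_scale (n := n) m *: (U^T *m sketch_error S *m c)) &
    enorm (Q - 1%:M) <=
      (4 * Num.sqrt p.+1%:R + 4 + 2 * Num.sqrt p.+1%:R * kap ^+ 2) * e.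
Proof.
move=> e eps0 bE Ce.
have [h1 h2 h3] := compressed_blocks U c (sketch_error S).
move: eps0 bE h1 h2 h3 Ce; rewrite -/e /c /eps.
case: XUK => -> UU KT lam0 Klb Kub eps0 bE h1 h2 h3 Ce.
apply: (pivot_s_near UU KT lam0 Klb Kub m eps0 bE h1 h2 _ Ce).
exact: le_trans (entry_le_enorm _ _ _) h3.
Qed.

Let fit := X *m ols X y.

(** [Phi] is the frame times [invmx K *m invmx B0], where [B0] is the root of the limiting
    covariance; as the condition numbers are bounded, its rows are not much longer than
    those of the frame. *)
Lemma pivot_pa_linear : fit != 0 ->
  let c' := - ((enorm fit)^-1 *: fit) in
  exists Phi : 'M[R]_(n, p.+1),
  [/\ Phi^T *m Phi + 2 *: (Phi^T *m c' *m (Phi^T *m c')^T) = 1%:M,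
      forall j, enorm (row j Phi) <= Num.sqrt p.+1%:R ^+ 2 * kap * enorm (row j U) &
      forall (S : 'M[R]_n) (b : 'cV[R]_p.+1),
      let e := enorm (U^T *m sketch_error S *m U) in
      (gram (S *m X) \in unitmx -> b = partial_ols S X y) ->
      const_partial (p := p) (kap := kap) * e <= 1 ->
      exists2 Q : 'M[R]_p.+1,
        pivot_pa m S X y b = Q *m (pivot_scale (n := n) m *: (Phi^T *m sketch_error S *m c')) &
        enorm (Q - 1%:M) <= const_partial (p := p) (kap := kap) * e].
Proof.
rewrite /fit; case: XUK => -> UU KT lam0 Klb Kub fit0.
set beta := ols (U *m K) y in fit0 *; rewrite -mulmxA in fit0 *.
have Ku := form_lb_unit lam0 Klb; have KiT := unit_sym_inv KT.
pose tau := (enorm (K *m beta))^-1 *: (K *m beta).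
have theta0 : K *m beta != 0.
  by apply: contra_neq fit0 => ->; rewrite mulmx0.
have [B0 [B0psd BB B0lb]] := limit_root_exists (tau := tau) KT lam0 Klb.
have B0T := B0psd.1.
have K0 : 0 < enorm K.
  rewrite lt_neqAle enorm_ge0 andbT eq_sym enorm_eq0.
  by apply: contra_neq theta0 => ->; rewrite mul0mx.
have Ki0 : 0 < (enorm K)^-1 by rewrite invr_gt0.
have B0u := form_lb_unit Ki0 B0lb; have BiT := unit_sym_inv B0T.
have cE : - ((enorm (U *m (K *m beta)))^-1 *: (U *m (K *m beta))) = - (U *m tau).
  by rewrite enorm_orthl// scalemxAr.
rewrite cE; exists (U *m invmx K *m invmx B0); split=> [|j|S b].
- have PT : (U *m invmx K *m invmx B0)^T *m U = invmx B0 *m invmx K.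
    by rewrite !trmx_mul BiT KiT -!mulmxA UU mulmx1.
  rewrite mulmxN [_ *m (U *m tau)]mulmxA PT linearN/= mulNmx mulmxN opprK.
  rewrite [_^T *m (U *m invmx K *m invmx B0)]mulmxA [_^T *m (U *m invmx K)]mulmxA PT.
  rewrite !trmx_mul BiT KiT.
  transitivity (invmx B0 *m (invmx K *m limit_cov (tau := tau) *m invmx K) *m invmx B0).
    rewrite /limit_cov mulmxDr mulmx1 mulmxDl mulmxDr mulmxDl; congr (_ + _).
      by rewrite !mulmxA.
    by rewrite -!(scalemxAr, scalemxAl) !mulmxA.
  by rewrite -BB mulmxA mulVmx// mul1mx mulmxV.
- rewrite -mulmxA row_mul mulrC; apply: (le_trans (enormM _ _)).
  rewrite ler_wpM2l ?enorm_ge0//; apply: (le_trans (enormM _ _)).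
  apply: (@le_trans _ _ ((Num.sqrt p.+1%:R / lam) * (Num.sqrt p.+1%:R / (enorm K)^-1))).
    by apply: ler_pM; rewrite ?enorm_ge0// form_lb_inv.
  rewrite invrK mulrACA [lam^-1 * _]mulrC -expr2 ler_wpM2l ?sqr_ge0//.
  by rewrite ler_pdivrMr.
- move=> bE Ce.
  exact: (pivot_pa_near UU KT lam0 Klb Kub m theta0 bE (lexx _) Ce B0psd BB B0lb).
Qed.

End Linearisation.

Lemma scaled_le1 (R : realType) (C e : R) : 0 <= e -> e <= (1 + `|C|)^-1 -> C * e <= 1.
Proof.
move=> e0 e1; have C1 : 0 < 1 + `|C| by rewrite ltr_pwDl.
apply: (@le_trans _ _ ((1 + `|C|) * e)); last by rewrite -ler_pdivlMl// mulr1.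
by rewrite ler_wpM2r// (le_trans (ler_norm _))// lerDr.
Qed.

Section Limits.
Context {R : realType} {p : nat} {m l : nat -> nat} {rho kap : R}.
Context {X U : forall k, 'M[R]_(2 ^ l k, p.+1)} {K : nat -> 'M[R]_p.+1} {lam : nat -> R}
  {y : forall k, 'cV[R]_(2 ^ l k)} {al : nat -> R}.
Context {d : nat -> measure_display} {T : forall k : nat, measurableType (d k)}
  {P : forall k : nat, probability (T k) R}
  {b s : forall k : nat, 'I_(2 ^ l k) -> {RV (P k) >-> bool}}.
Context (hm : m k @[k --> \oo] --> \oo) (rho1 : rho < 1)
  (hg : \forall k \near \oo, (m k)%:R / (2 ^ l k)%N%:R <= rho).
Context (polar : \forall k \near \oo, polar_form (X k) (U k) (K k) (lam k) kap).
Context (al0 : forall k, 0 <= al k) (al_to0 : al k @[k --> \oo] --> (0 : R)).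
Context (law : forall k : nat, srht_law (m k) (@b k) (@s k)).
Let S k (w : T k) : 'M[R]_(2 ^ l k) := srht (m k) (fun i => @b k i w) (fun i => @s k i w).

Theorem pivot_s_limit (betas : forall k : nat, 'M[R]_(2 ^ l k) -> 'cV[R]_p.+1) :
  let eps k := residual (X k) (y k) (ols (X k) (y k)) in
  (forall (k : nat) (A : 'M[R]_(2 ^ l k)), gram (A *m X k) \in unitmx ->
     betas k A = ols (A *m X k) (A *m y k)) ->
  (\forall k \near \oo, eps k != 0) ->
  (\forall k \near \oo, (forall j, enorm (row j (U k)) ^+ 2 <= al k) \/
     (forall j, ((enorm (eps k))^-1 *: eps k) j 0 ^+ 2 <= al k)) ->
  cvg_in_law P (fun k w => pivot_s (m k) (S w) (X k) (y k) (betas k (S w)))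
    (std_normal R p.+1).
Proof.
move=> eps hbetas eps0 flat.
pose c k := (enorm (eps k))^-1 *: eps k.
pose W k := row_mx (U k) (c k).
pose C : R := const_root (p := p) (kap := kap).
have d00 : 0 < (1 + `|C|)^-1 by rewrite invr_gt0 ltr_pwDl.
have c1 : \forall k \near \oo, enorm (c k) = 1.
  by apply: filterS eps0 => k; exact: enorm_unit.
apply: (@srht_cvg_in_law R p (p.+1 + 1) m l rho U c al W p.+2%:R
  (4 * Num.sqrt p.+1%:R + 4 + 2 * Num.sqrt p.+1%:R * kap ^+ 2) (1 + `|C|)^-1
  (fun k A => pivot_s (m k) A (X k) (y k) (betas k A)) d T P (@b) (@s)
  hm rho1 hg _ c1 al0 al_to0 flat _ _ d00 _ law) => //.
- apply: filterS polar => k XUK.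
  by rewrite (residual_frame XUK) mul0mx scaler0 addr0 (polar_frame XUK).
- near=> k.
  have XUK : polar_form (X k) (U k) (K k) (lam k) kap by near: k.
  have ck : enorm (c k) = 1 by near: k.
  by rewrite enorm_row_mx ck (enorm_orth (polar_frame XUK)) expr1n natr1.
- near=> k => A small.
  have XUK : polar_form (X k) (U k) (K k) (lam k) kap by near: k.
  apply: (pivot_s_linear XUK) => //.
  + by near: k.
  + exact: hbetas.
  + by apply: scaled_le1 => //; exact: enorm_ge0.
Unshelve. all: by end_near. Qed.

(** The matrix [Phi] is defined by the data only for large indices, so it is chosen with a
    default value for the others. *)
Theorem pivot_pa_limit (betapa : forall k : nat, 'M[R]_(2 ^ l k) -> 'cV[R]_p.+1) :
  let fit k := X k *m ols (X k) (y k) in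
  (forall (k : nat) (A : 'M[R]_(2 ^ l k)), gram (A *m X k) \in unitmx ->
     betapa k A = partial_ols A (X k) (y k)) ->
  (\forall k \near \oo, fit k != 0) ->
  (\forall k \near \oo, (forall j, enorm (row j (U k)) ^+ 2 <= al k) \/
     (forall j, ((enorm (fit k))^-1 *: fit k) j 0 ^+ 2 <= al k)) ->
  cvg_in_law P (fun k w => pivot_pa (m k) (S w) (X k) (y k) (betapa k (S w)))
    (std_normal R p.+1).
Proof.
move=> fit hbetapa fit0 flat.
pose C : R := const_partial (p := p) (kap := kap).
pose D : R := Num.sqrt p.+1%:R ^+ 2 * kap.
pose c k := - ((enorm (fit k))^-1 *: fit k).
have d00 : 0 < (1 + `|C|)^-1 by rewrite invr_gt0 ltr_pwDl.
have c1 : \forall k \near \oo, enorm (c k) = 1.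
  by apply: filterS fit0 => k; rewrite /c enormN; exact: enorm_unit.
have Phi_exists k : exists Phi : 'M[R]_(2 ^ l k, p.+1),
  polar_form (X k) (U k) (K k) (lam k) kap -> fit k != 0 ->
  [/\ Phi^T *m Phi + 2 *: (Phi^T *m c k *m (Phi^T *m c k)^T) = 1%:M,
      forall j, enorm (row j Phi) <= D * enorm (row j (U k)) &
      forall (S : 'M[R]_(2 ^ l k)) (b : 'cV[R]_p.+1),
      let e := enorm ((U k)^T *m sketch_error S *m U k) in
      (gram (S *m X k) \in unitmx -> b = partial_ols S (X k) (y k)) ->
      C * e <= 1 ->
      exists2 Q : 'M[R]_p.+1,
        pivot_pa (m k) S (X k) (y k) b =
          Q *m (pivot_scale (n := (2 ^ l k)%N) (m k) *: (Phi^T *m sketch_error S *m c k)) &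
        enorm (Q - 1%:M) <= C * e].
  have [[XUK fk]|no] := pselect (polar_form (X k) (U k) (K k) (lam k) kap /\ fit k != 0).
    by have [Phi PhiP] := pivot_pa_linear XUK (m k) fk; exists Phi.
  by exists 0 => XUK fk; case: no.
pose Phi k := sval (cid (Phi_exists k)); have PhiP k := svalP (cid (Phi_exists k)).
(* one bound for both alternatives, since the rows of [Phi] may be [D] times longer than
   those of the frame *)
pose al' k := (1 + D ^+ 2) * al k.
apply: (@srht_cvg_in_law R p p.+1 m l rho Phi c al' U p.+1%:R C (1 + `|C|)^-1
  (fun k A => pivot_pa (m k) A (X k) (y k) (betapa k A)) d T P (@b) (@s)
  hm rho1 hg _ c1 _ _ _ _ _ d00 _ law) => //.
- near=> k.
  have XUK : polar_form (X k) (U k) (K k) (lam k) kap by near: k.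
  have fk : fit k != 0 by near: k.
  by have [] := PhiP k XUK fk.
- by move=> k; rewrite mulr_ge0// addr_ge0 ?sqr_ge0.
- by rewrite -[X in _ --> X](mulr0 (1 + D ^+ 2)); exact: cvgMr.
- near=> k.
  have XUK : polar_form (X k) (U k) (K k) (lam k) kap by near: k.
  have fk : fit k != 0 by near: k.
  have [_ rowP _] := PhiP k XUK fk.
  have alD : D ^+ 2 * al k <= al' k by rewrite /al' ler_wpM2r// lerDr.
  have al1 : al k <= al' k by rewrite /al' ler_peMl// lerDl sqr_ge0.
  have : (forall j, enorm (row j (U k)) ^+ 2 <= al k) \/
     (forall j, ((enorm (fit k))^-1 *: fit k) j 0 ^+ 2 <= al k) by near: k.
  case=> fl; [left|right] => j.
    apply: le_trans alD; apply: (@le_trans _ _ ((D * enorm (row j (U k))) ^+ 2)).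
      by rewrite ler_pXn2r ?nnegrE ?enorm_ge0// (le_trans (enorm_ge0 _) (rowP j)).
    by rewrite exprMn ler_wpM2l ?sqr_ge0.
  by rewrite /c mxE sqrrN (le_trans (fl j)).
- by apply: filterS polar => k XUK; rewrite (enorm_orth (polar_frame XUK)).
- near=> k => A small.
  have XUK : polar_form (X k) (U k) (K k) (lam k) kap by near: k.
  have fk : fit k != 0 by near: k.
  have [_ _ lin] := PhiP k XUK fk.
  apply: lin; first exact: hbetapa.
  by apply: scaled_le1 => //; exact: enorm_ge0.
Unshelve. all: by end_near. Qed.

End Limits.

Lemma near_limsup (R : realType) (u : nat -> R) (a : \bar R) :
  (limn_esup (fun k => (u k)%:E) < a)%E ->
  exists2 r : R, (r%:E < a)%E & \forall k \near \oo, u k <= r.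
Proof.
set v := (fun k => (u k)%:E); rewrite limn_esup_lim.
have -> : limn (esups v) = ereal_inf (range (esups v)).
  by apply: cvg_lim => //; exact: cvg_esups_inf.
move=> /ereal_inf_lt[_ [N _ <-]] supa.
have uN k : (N <= k)%N -> ((u k)%:E <= esups v N)%E.
  by move=> Nk; apply: ereal_sup_ubound; exists k.
move: uN supa; case: (esups _ N) => [r| |] uN supa.
- by exists r => //; exists N => // k /uN; rewrite lee_fin.
- by move: supa; rewrite ltNge leey.
- by have := uN N (leqnn N).
Qed.

Lemma flat_rate (R : realType) (l : nat -> nat) (F : forall j, 'I_(2 ^ j) -> R) :
  l k @[k --> \oo] --> \oo -> (forall j i, 0 <= F j i) ->
  \big[Num.max/0]_(i < 2 ^ j) F j i @[j --> \oo] --> (0 : R) ->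
  exists al : nat -> R, [/\ forall k, 0 <= al k, al k @[k --> \oo] --> (0 : R) &
    forall k i, F (l k) i ^+ 2 <= al k].
Proof.
move=> hl F0 Fto0; exists (fun k => (\big[Num.max/0]_(i < 2 ^ l k) F (l k) i) ^+ 2); split.
- by move=> k; exact: sqr_ge0.
- have h : \big[Num.max/0]_(i < 2 ^ l k) F (l k) i @[k --> \oo] --> (0 : R).
    exact: (cvg_comp l _ hl Fto0).
  by rewrite -[X in _ --> X](mulr0 0); under eq_fun do rewrite expr2; exact: cvgM.
- move=> k i; have h : F (l k) i <= \big[Num.max/0]_(i < 2 ^ l k) F (l k) i.
    exact: le_bigmax.
  by rewrite ler_pXn2r ?nnegrE// (le_trans (F0 _ i)).
Qed.

Theorem mainTheorem6 (R : realType) (p : nat)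
  (* data: X l and y l are indexed by l, with n = 2 ^ l rows *)
  (X U : forall l : nat, 'M[R]_(2 ^ l, p.+1))
  (L : nat -> 'rV[R]_p.+1) (V : nat -> 'M[R]_p.+1)
  (y : forall l : nat, 'cV[R]_(2 ^ l))
  (hsvd : \forall l \near \oo, is_svd (X l) (U l) (L l) (V l))
  (hcond : (limn_esup (fun l => (L l 0 ord0 / L l 0 ord_max)%:E) < +oo)%E)
  (* the pairs (m k, n k) with n k = 2 ^ l k *)
  (m l : nat -> nat)
  (hm : m k @[k --> \oo] --> \oo)
  (hl : l k @[k --> \oo] --> \oo)
  (hmlog : (m k)%:R / ln (2 ^ l k)%N%:R ^+ 2 @[k --> \oo] --> (+oo%R : set_system R))
  (hgamma : (limn_esup (fun k => ((m k)%:R / (2 ^ l k)%N%:R : R)%:E) < 1)%E)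
  (* the randomness of the sketches *)
  (d : nat -> measure_display) (T : forall k : nat, measurableType (d k))
  (P : forall k : nat, probability (T k) R)
  (b s : forall k : nat, 'I_(2 ^ l k) -> {RV (P k) >-> bool})
  (hbs : forall k : nat, srht_law (m k) (b k) (s k))
  (* the sketched estimators, arbitrary when the Gram matrix is singular *)
  (betas betapa : forall k : nat, 'M[R]_(2 ^ l k) -> 'cV[R]_p.+1)
  (hbetas : forall (k : nat) (A : 'M[R]_(2 ^ l k)),
     gram (A *m X (l k)) \in unitmx ->
     betas k A = ols (A *m X (l k)) (A *m y (l k)))
  (hbetapa : forall (k : nat) (A : 'M[R]_(2 ^ l k)),
     gram (A *m X (l k)) \in unitmx ->
     betapa k A = partial_ols A (X (l k)) (y (l k))) :
  let eps (j : nat) : 'cV[R]_(2 ^ j) := residual (X j) (y j) (ols (X j) (y j)) in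
  let S (k : nat) (w : T k) : 'M[R]_(2 ^ l k) :=
    srht (m k) (fun i => b k i w) (fun i => s k i w) in
  let flatU :=
    \big[Num.max/0]_(i < 2 ^ j) enorm (row i (U j)) @[j --> \oo] --> (0 : R) in
  ((\forall j \near \oo, eps j != 0) ->
   flatU \/
   \big[Num.max/0]_(i < 2 ^ j) (`|eps j i 0| / enorm (eps j)) @[j --> \oo]
     --> (0 : R) ->
   cvg_in_law P
     (fun k w => pivot_s (m k) (S k w) (X (l k)) (y (l k)) (betas k (S k w)))
     (std_normal R p.+1))
  /\
  ((\forall j \near \oo, X j *m ols (X j) (y j) != 0) ->
   flatU \/
   \big[Num.max/0]_(i < 2 ^ j) (`|y j i 0 - eps j i 0| / enorm (y j - eps j))
     @[j --> \oo] --> (0 : R) ->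
   cvg_in_law P
     (fun k w => pivot_pa (m k) (S k w) (X (l k)) (y (l k)) (betapa k (S k w)))
     (std_normal R p.+1)).
Proof.
move=> eps S flatU.
have [r _ Lr] := near_limsup hcond.
have [rho rho1 hg] := near_limsup hgamma; rewrite lte_fin in rho1.
pose Ut k := U (l k) *m (V (l k))^T.
pose K k := V (l k) *m diag_mx (L (l k)) *m (V (l k))^T.
have polar : \forall k \near \oo,
    polar_form (X (l k)) (Ut k) (K k) (L (l k) 0 ord_max) (Num.sqrt p.+1%:R * r).
  near=> k; apply: svd_polar; first by near: k; exact: hl hsvd.
  by near: k; exact: hl Lr.
have rowU : \forall k \near \oo, forall j, enorm (row j (Ut k)) = enorm (row j (U (l k))).
  near=> k => j; have [_ _ VV _ _] : is_svd (X (l k)) (U (l k)) (L (l k)) (V (l k)).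
    by near: k; exact: hl hsvd.
  by rewrite row_mul enorm_orthr.
have norm_entry j (v : 'cV[R]_(2 ^ j)) i :
    ((enorm v)^-1 *: v) i 0 ^+ 2 = (`|v i 0| / enorm v) ^+ 2.
  rewrite mxE mulrC -[LHS]real_normK ?num_real// normrM [`|_^-1|]ger0_norm//.
  by rewrite invr_ge0 enorm_ge0.
split=> nz0 flat.
- have nz : \forall k \near \oo, eps (l k) != 0 by exact: hl nz0.
  have [al [al0 al_to0 alP]] : exists al : nat -> R,
      [/\ forall k, 0 <= al k, al k @[k --> \oo] --> (0 : R) &
      \forall k \near \oo, (forall j, enorm (row j (Ut k)) ^+ 2 <= al k) \/
        (forall j, ((enorm (eps (l k)))^-1 *: eps (l k)) j 0 ^+ 2 <= al k)].
    case: flat => /(flat_rate hl)[|al [al0 al_to0 alP]].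
    + by move=> j i; exact: enorm_ge0.
    + exists al; split => //; near=> k; left => j.
      by rewrite (near rowU k).
    + by move=> j i; rewrite divr_ge0 ?enorm_ge0.
    + by exists al; split => //; apply: nearW => k; right => j; rewrite norm_entry.
  exact: (pivot_s_limit hm rho1 hg polar al0 al_to0 hbs hbetas nz alP).
- have fitE j : y j - eps j = X j *m ols (X j) (y j) by rewrite /eps /residual subKr.
  have nz : \forall k \near \oo, X (l k) *m ols (X (l k)) (y (l k)) != 0 by exact: hl nz0.
  have [al [al0 al_to0 alP]] : exists al : nat -> R,
      [/\ forall k, 0 <= al k, al k @[k --> \oo] --> (0 : R) &
      \forall k \near \oo, (forall j, enorm (row j (Ut k)) ^+ 2 <= al k) \/
        (forall j, ((enorm (X (l k) *m ols (X (l k)) (y (l k))))^-1 *: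
           (X (l k) *m ols (X (l k)) (y (l k)))) j 0 ^+ 2 <= al k)].
    case: flat => /(flat_rate hl)[|al [al0 al_to0 alP]].
    + by move=> j i; exact: enorm_ge0.
    + exists al; split => //; near=> k; left => j.
      by rewrite (near rowU k).
    + by move=> j i; rewrite divr_ge0 ?enorm_ge0.
    + exists al; split => //; apply: nearW => k; right => j.
      by rewrite norm_entry -fitE; have := alP k j; rewrite !mxE.
  exact: (pivot_pa_limit hm rho1 hg polar al0 al_to0 hbs hbetapa nz alP).
Unshelve. all: by end_near. Qed.
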